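(* Let $1<p<q<\infty$ and $0<r,\rho<\infty$. Then there is a constant $c$, not depending on $f$, such that for every $f\in L^p(\mathbb{R}^n)$ the following two inequalities hold: $$\|f\|_q\le c\,\|f\|_{\dot B^{n/r}_{r,\rho}}^{1-p/q}\,\|f\|_p^{p/q}$$ and $$\|f\|_q\le c\,\|f\|_{\dot F^{n/r}_{r,\infty}}^{1-p/q}\,\|f\|_p^{p/q}.$$
   Context: $\|\cdot\|_p$ is the $L^p(\mathbb{R}^n)$ (quasi)norm. The inequalities are trivial when the right-hand side is infinite. Let $p_h(y)=(4\pi h)^{-n/2}e^{-|y|^2/(4h)}$ and $P_hf(x)=\int_{\mathbb{R}^n}p_h(y)f(x-y)\,dy$, $h>0$. For $-\infty<s<\infty$ and a non-negative integer $m$ with $2m>s$: the homogeneous Besov quasinorm is, for $0<p\le\infty$, $0<q<\infty$, $$\|f\|_{\dot B^s_{p,q}}=\left(\int_0^\infty h^{(m-s/2)q}\left\|\frac{\partial^mP_hf}{\partial h^m}\right\|_p^q\frac{dh}{h}\right)^{1/q};$$ the homogeneous Triebel-Lizorkin quasinorm with second index $\infty$ is, for $0<p<\infty$, $$\|f\|_{\dot F^s_{p,\infty}}=\left\|\sup_{h>0}h^{m-s/2}\left|\frac{\partial^mP_hf}{\partial h^m}(\cdot)\right|\right\|_p.$$ The integer $m$ (here $2m>n/r$) is fixed; constants may depend on it and on $n$ and the parameters. *)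

(* Defs.v *)
From HB Require Import structures.
From mathcomp Require Import all_boot all_order all_algebra.
From mathcomp Require Import all_classical all_reals all_analysis.

Set Implicit Arguments.
Unset Strict Implicit.
Unset Printing Implicit Defensive.

Import Order.TTheory GRing.Theory Num.Theory.
Import numFieldNormedType.Exports.

Local Open Scope classical_set_scope.
Local Open Scope ring_scope.

(* R^n is [n.-tuple R], with the product (i.e. Borel) sigma-algebra; every
   Lebesgue-measurable function is a.e. equal to a Borel one. *)

Section lebesgue_tuple.
Variable R : realType.

Definition cons_pair n (z : measurableTypeR R * n.-tuple R) : n.+1.-tuple R :=
  [tuple of z.1 :: z.2].

Lemma measurable_cons_pair n : measurable_fun [set: _] (@cons_pair n).
Proof.
by apply: measurable_cons; [exact: measurable_fst|exact: measurable_snd].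
Qed.

Let uncons n (x : n.+1.-tuple R) : measurableTypeR R * n.-tuple R :=
  (thead x, [tuple of behead x]).

Let measurable_uncons n : measurable_fun [set: _] (@uncons n).
Proof.
apply: measurable_fun_pair; [exact: measurable_tnth|exact: measurable_behead].
Qed.

Let cons_pairK n : cancel (@cons_pair n) (@uncons n).
Proof. by move=> [x t]; congr pair; apply/val_inj. Qed.

Section lebesgue_cons.
Variables (n : nat) (mu : {sigma_finite_measure set (n.-tuple R) -> \bar R}).

Definition lebesgue_cons : set (n.+1.-tuple R) -> \bar R :=
  pushforward (lebesgue_measure \x mu)%E (@cons_pair n).

Let mc := @measurable_cons_pair n.

Let lebesgue_cons0 : lebesgue_cons set0 = 0%E.
Proof. exact: measure0. Qed.

Let lebesgue_cons_ge0 A : (0 <= lebesgue_cons A)%E.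
Proof. exact: measure_ge0. Qed.

Let lebesgue_cons_sigma_additive : semi_sigma_additive lebesgue_cons.
Proof. exact: measure_semi_sigma_additive. Qed.

HB.instance Definition _ := isMeasure.Build _ _ _ lebesgue_cons
  lebesgue_cons0 lebesgue_cons_ge0 lebesgue_cons_sigma_additive.

Let lebesgue_cons_sigma_finite : sigma_finite setT lebesgue_cons.
Proof.
have /sigma_finiteP[F [TF ndF Foo]] := sigma_finiteT (@lebesgue_measure R).
have /sigma_finiteP[G [TG ndG Goo]] := sigma_finiteT mu.
exists (fun k => @uncons n @^-1` (F k `*` G k)).
  rewrite -preimage_bigcup (_ : \bigcup_k _ = setT) ?preimage_setT//.
  apply/seteqP; split=> // -[x t] _.
  have [i _ Fix] : (\bigcup_k F k) x by rewrite -TF.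
  have [j _ Gjt] : (\bigcup_k G k) t by rewrite -TG.
  exists (maxn i j) => //; split.
  - by move: x Fix; exact/subsetPset/ndF/leq_maxl.
  - by move: t Gjt; exact/subsetPset/ndG/leq_maxr.
move=> k; have [mFk Fkoo] := Foo k; have [mGk Gkoo] := Goo k; split.
  rewrite -[X in measurable X]setTI.
  by apply: measurable_uncons => //; exact: measurableX.
rewrite /lebesgue_cons /pushforward -comp_preimage.
rewrite (_ : _ \o _ = id); last by apply/funext => z; exact: cons_pairK.
by rewrite preimage_id product_measure1E// lte_mul_pinfty// ge0_fin_numE.
Qed.

HB.instance Definition _ := Measure_isSigmaFinite.Build _ _ _ lebesgue_cons
  lebesgue_cons_sigma_finite.

End lebesgue_cons.

(* Lebesgue measure on R^n, as the n-fold product of Lebesgue measure on R;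
   [lebesgue_tuple_box] below characterizes it. *)
Fixpoint lebesgue_tuple n : {sigma_finite_measure set (n.-tuple R) -> \bar R} :=
  match n with
  | 0 => \d_[tuple]
  | k.+1 => lebesgue_cons (lebesgue_tuple k)
  end.

Lemma lebesgue_tuple_box n (A : 'I_n -> set R) :
  (forall i, measurable (A i)) ->
  lebesgue_tuple n [set x | forall i, A i (tnth x i)] =
  (\prod_(i < n) lebesgue_measure (A i))%E.
Proof.
elim: n A => [|n IH] A mA.
  by rewrite big_ord0 /= diracE mem_set// => -[].
rewrite big_ord_recl /= /lebesgue_cons /pushforward.
rewrite -IH; last by move=> i; exact: mA.
have mbox : measurable [set x : n.-tuple R |
    forall i, A (lift ord0 i) (tnth x i)].
  rewrite (_ : mkset _ = \bigcap_(i : 'I_n)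
      (fun x : n.-tuple R => tnth x i) @^-1` A (lift ord0 i)); last first.
    by apply/seteqP; split => [x Ax i _|x Ax i]; exact: Ax.
  apply: fin_bigcap_measurable => // i _.
  rewrite -[X in measurable X]setTI.
  by apply: measurable_tnth => //; exact: mA.
have mA0 : measurable (A ord0) by exact: mA.
rewrite -(product_measure1E lebesgue_measure (lebesgue_tuple n) mA0 mbox).
congr ((_ \x _)%E _).
apply/seteqP; split => [[x t] /= Axt|[x t] /= [Ax At] i].
  split; first by have := Axt ord0.
  by move=> i; have := Axt (lift ord0 i); rewrite tnthS.
case: (unliftP ord0 i) => [j|] ->; last exact: Ax.
by rewrite tnthS; exact: At.
Qed.

End lebesgue_tuple.

Section heat.
Variables (R : realType) (n : nat).
Implicit Types (x y : n.-tuple R) (f : n.-tuple R -> R).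

Definition sub_tuple x y : n.-tuple R := [tuple tnth x i - tnth y i | i < n].

(* |y|^2 for the Euclidean norm |y| *)
Definition sqnorm y : R := \sum_(i < n) tnth y i ^+ 2.

Definition heat_kernel (h : R) y : R :=
  (4 * pi * h) `^ (- (n%:R / 2)) * expR (- (sqnorm y / (4 * h))).

Definition heat (h : R) f x : R :=
  \int[lebesgue_tuple R n]_y (heat_kernel h y * f (sub_tuple x y)).

(* d^m P_h f / dh^m (x); only used at h > 0, near which P_h f(x) is smooth in h *)
Definition dheat (m : nat) f (h : R) x : R :=
  derive1n m (fun t => heat t f x) h.

(* p is any exponent in ]0, +oo]; a quasinorm if p < 1, with values in [0, +oo] *)
Definition Lpnorm (p : \bar R) f : \bar R :=
  'N[lebesgue_tuple R n]_p[EFin \o f].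

(* the homogeneous Besov quasinorm, depending on the integer m with 2m > s *)
Definition besov_norm (m : nat) (s : R) (p : \bar R) (q : R) f : \bar R :=
  ((\int[lebesgue_measure]_(h in `]0%R, +oo[)
     (((h `^ ((m%:R - s / 2) * q))%:E * Lpnorm p (dheat m f h) `^ q)
      * (h^-1)%:E)) `^ q^-1)%E.

(* sup_(h > 0) h^(m - s/2) |d^m P_h f / dh^m (x)| *)
Definition heat_maximal (m : nat) (s : R) f x : \bar R :=
  ereal_sup [set (h `^ (m%:R - s / 2) * `|dheat m f h x|)%:E
            | h in `]0, +oo[].

(* the Triebel-Lizorkin quasinorm with second index oo *)
Definition triebel_lizorkin_norm (m : nat) (s p : R) f : \bar R :=
  'N[lebesgue_tuple R n]_p%:E[heat_maximal m s f].

End heat.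

(* Main.v *)
Require Import Defs.
From HB Require Import structures.
From mathcomp Require Import all_boot all_order all_algebra.
From mathcomp Require Import all_classical all_reals all_analysis.
From mathcomp Require Import measurable_realfun ring lra.

Set Implicit Arguments.
Unset Strict Implicit.
Unset Printing Implicit Defensive.

Import Order.TTheory GRing.Theory Num.Theory.
Import numFieldNormedType.Exports.

Local Open Scope classical_set_scope.
Local Open Scope ring_scope.

(** Let nu = n/2, and let B and N be real numbers above the Besov or
    Triebel-Lizorkin norm of f and above its L^p norm. Write u_k(h) for the k-th
    derivative of P_h f in h. The two norms enter through one consequence only
    ([sparse_besov], [sparse_triebel_lizorkin]): for each h there is a time t in
    [h/2, h] with ||u_m(t)||_r <= B t^(nu/r - m), where B is first enlarged by a constant
    in the Besov case. From this the proof derives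
    ||f||_q <= C B^(1 - p/q) N^(p/q) ([Lp_le_of_sparse]); taking B and N at most twice
    the norms ([le_of_forall_gt]) gives the theorem.

    From L^r to L^Q. Fix Q above 1, r, q and nu. By the semigroup law, u_k(s + t) is
    the average of u_k(t) against the kernel p_s ([dheat_semigroup]). With Jensen's
    inequality this makes L^Q norms decrease in time and bounds |u_k(s + t)|^Q by
    (4 pi s)^(-nu) times the integral of |u_k(t)|^Q. For r < 1 this cannot be done in
    L^r, so L^Q is interpolated between L^r and the sup norm. If M is the supremum of
    h^m |u_m(h)| over all h and x, the outcome is M <= K^theta M^(1 - theta) with K a
    multiple of B and theta = r/Q. Hence M <= K, provided M is finite. To guarantee
    that, the supremum is taken with a weight which is removed afterwards
    ([dheat_sup_bootstrap]). So |u_m(h)| <= C B h^(-m) and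
    ||u_m(h)||_Q <= C B h^(nu/Q - m) ([Lp_le_bootstrap]).

    From u_m to f. The fundamental theorem of calculus over [h, 2 h] gives
    ||u_k(h)||_Q <= ||u_k(2 h)||_Q + h ||u_(k+1)(h)||_Q ([dheat_doubling]). While
    k >= 1 > nu/Q, iterating this towards large h brings the estimate of order h^(nu/Q - k)
    down from k + 1 to k ([dheat_descent]). For k = 0 the powers are summable towards
    small h instead, and ||f||_Q <= ||P_T f||_Q + C B T^(nu/Q) for every T
    ([heat_backward]). Finally ||P_T f||_Q <= C N T^(nu/Q - nu/p) ([Lp_le_dheat]). The
    best T yields ||f||_Q <= C B^(1 - p/Q) N^(p/Q), and q lies between p and Q.

    The passage from P_h f to f at h = 0 uses that f is approximated by P_h f in a
    weighted L^1 space ([heat_vanish_integrable]). The functions with this property are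
    closed under the operations of measure theory, so it suffices to treat
    indicators of half-spaces. *)

(** * Reflections and translations of Lebesgue measure *)

Section tuple_integral.
Variable R : realType.

Lemma integral_lebesgue_tupleS n (g : n.+1.-tuple R -> \bar R) :
  measurable_fun setT g -> (forall x, (0 <= g x)%E) ->
  (\int[lebesgue_tuple R n.+1]_x g x =
   \int[lebesgue_measure]_a \int[lebesgue_tuple R n]_t g (cons_pair (a, t)))%E.
Proof.
move=> mg g0.
rewrite (_ : (\int[lebesgue_tuple R n.+1]_x g x)%E =
  (\int[pushforward (lebesgue_measure \x lebesgue_tuple R n)%E (@cons_pair R n)]_x g x)%E) //.
rewrite ge0_integral_pushforward//; last exact: measurable_cons_pair.
rewrite preimage_setT fubini_tonelli1//.
  by apply: measurableT_comp => //; exact: measurable_cons_pair.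
by move=> z; exact: g0.
Qed.

Lemma lebesgue_measure_reflection (a : R) (A : set (measurableTypeR R)) :
  measurable A ->
  lebesgue_measure ((fun y => a - y) @^-1` A) = lebesgue_measure A.
Proof.
move=> mA.
have mphi : measurable_fun setT ((fun y => a - y) : measurableTypeR R -> measurableTypeR R).
  exact: measurable_funB.
apply/esym.
rewrite -[RHS]/(pushforward lebesgue_measure (fun y : measurableTypeR R => a - y : measurableTypeR R) A).
pose phi : {mfun measurableTypeR R >-> measurableTypeR R} :=
  HB.pack ((fun y => a - y) : measurableTypeR R -> measurableTypeR R)
    (isMeasurableFun.Build _ _ _ _ _ mphi).
apply: (lebesgue_measure_unique (mu := pushforward lebesgue_measure phi)) => //.
move=> X [[u v] /= uv <-]; rewrite /pushforward.
rewrite [X in _ = lebesgue_measure X](_ : _ = `[a - v, a - u[%classic); last first.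
  by apply/seteqP; split => y /=; rewrite !in_itv/= => /andP[? ?]; apply/andP; split; lra.
rewrite !lebesgue_measure_itv/= !lte_fin.
rewrite (_ : (a - v < a - u)%R = (u < v)%R); last by apply/idP/idP => ?; lra.
by case: ifP => // _; rewrite -!EFinD; congr (_%:E); lra.
Qed.

Lemma integral_reflection (a : R) (g : R -> \bar R) :
  measurable_fun setT g -> (forall x, (0 <= g x)%E) ->
  (\int[lebesgue_measure]_y g (a - y)%R = \int[lebesgue_measure]_y g y)%E.
Proof.
move=> mg g0.
have mphi : measurable_fun setT ((fun y => a - y) : measurableTypeR R -> measurableTypeR R).
  exact: measurable_funB.
have := @ge0_integral_pushforward _ _ (measurableTypeR R) (measurableTypeR R) R _ mphi lebesgue_measure setT g measurableT mg.
rewrite preimage_setT => <-//.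
apply: eq_measure_integral => A mA _.
exact: (lebesgue_measure_reflection a mA).
Qed.

Section sub_tuple.
Variable n : nat.

Lemma measurable_sub_tuple d (T : measurableType d) (g h : T -> n.-tuple R) :
  measurable_fun setT g -> measurable_fun setT h ->
  measurable_fun setT (fun z => sub_tuple (g z) (h z)).
Proof.
move=> mg mh; apply/measurable_fun_tnthP => i.
rewrite (_ : _ \o _ = (fun z => tnth (g z) i - tnth (h z) i)); last first.
  by apply/funext => z /=; rewrite /sub_tuple tnth_mktuple.
apply: measurable_funB.
  exact: (measurableT_comp (measurable_tnth i) mg).
exact: (measurableT_comp (measurable_tnth i) mh).
Qed.

Lemma sub_tupleK (x : n.-tuple R) : involutive (sub_tuple x).
Proof.
move=> y; apply: eq_from_tnth => i; rewrite !tnth_mktuple.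
by rewrite opprB addrCA subrr addr0.
Qed.

End sub_tuple.

Lemma sub_tuple_cons n (a b : R) (x y : n.-tuple R) :
  sub_tuple (cons_pair (a, x)) (cons_pair (b, y)) =
  cons_pair (a - b, sub_tuple x y).
Proof.
apply: eq_from_tnth => i; rewrite tnth_mktuple.
by case: (unliftP ord0 i) => [j|] ->; rewrite ?tnthS ?tnth0//= ?tnth_mktuple.
Qed.

Lemma cons_pair_eta n (x : n.+1.-tuple R) :
  x = cons_pair (thead x, [tuple of behead x]).
Proof. by rewrite {1}(tuple_eta x); exact/val_inj. Qed.

(** Coordinate by coordinate: [lebesgue_tuple] is an iterated product, and each
    factor is invariant under the reflection y |-> a - y. *)
Lemma integral_sub_tuple n (x : n.-tuple R) (g : n.-tuple R -> \bar R) :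
  measurable_fun setT g -> (forall y, (0 <= g y)%E) ->
  (\int[lebesgue_tuple R n]_y g (sub_tuple x y) = \int[lebesgue_tuple R n]_y g y)%E.
Proof.
elim: n x g => [|n IH] x g mg g0.
  by apply: eq_integral => y _; rewrite (tuple0 (sub_tuple x y)) (tuple0 y).
have mgc : measurable_fun setT (g \o @cons_pair R n).
  apply: measurableT_comp => //; exact: measurable_cons_pair.
rewrite !integral_lebesgue_tupleS//; last first.
  apply: measurableT_comp => //; exact: measurable_sub_tuple.
rewrite (cons_pair_eta x).
set a := thead x; set t := [tuple of behead x].
transitivity (\int[lebesgue_measure]_b
    \int[lebesgue_tuple R n]_y g (cons_pair ((a - b)%R, y)))%E.
  apply: eq_integral => b _.
  rewrite -(IH t (fun y => g (cons_pair (a - b, y)))) //.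
    by apply: eq_integral => y _; rewrite sub_tuple_cons.
  exact: (measurableT_comp mgc (measurable_pair1 _)).
rewrite (integral_reflection a (g := fun b : R => \int[lebesgue_tuple R n]_y g (cons_pair (b, y)))%E) //.
  have := @measurable_fun_fubini_tonelli_F _ _ _ _ _ (lebesgue_tuple R n) _ mgc (fun=> g0 _). exact.
by move=> b; apply: integral_ge0.
Qed.

End tuple_integral.

(** * The heat kernel *)

Section heat_kernel.
Variable R : realType.

Lemma powR_expR (x a : R) : 0 < x -> x `^ a = expR (a * ln x).
Proof. by move=> x0; rewrite /powR gt_eqF. Qed.

Lemma sqnorm_ge0 n (y : n.-tuple R) : 0 <= sqnorm y.
Proof. by apply: sumr_ge0 => i _; exact: sqr_ge0. Qed.

Lemma measurable_sqnorm n : measurable_fun setT (@sqnorm R n).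
Proof.
apply: measurable_sum => i; apply: measurable_funX; exact: measurable_tnth.
Qed.

Lemma heat_kernel_ge0 n (h : R) (y : n.-tuple R) : 0 <= heat_kernel h y.
Proof. by rewrite mulr_ge0 ?powR_ge0 ?expR_ge0. Qed.

Lemma heat_kernel_ub n (h : R) (y : n.-tuple R) : 0 < h ->
  heat_kernel h y <= (4 * pi * h) `^ (- (n%:R / 2)).
Proof.
move=> h0; rewrite ler_piMr ?powR_ge0// -expR0 ler_expR oppr_le0.
by rewrite divr_ge0 ?sqnorm_ge0 ?mulr_ge0// ltW.
Qed.

(** At 0 the inverse is 0 by convention, which is also what x (x^2)^(-1) gives; the
    latter is a product of measurable functions. *)
Lemma measurable_inv : measurable_fun setT (@GRing.inv R).
Proof.
rewrite (_ : @GRing.inv R = fun x => x * (x ^+ 2) `^ (-1)).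
  apply: measurable_funM => //; apply: (measurableT_comp (measurable_powR _)).
  exact: measurable_funX.
apply/funext => x; rewrite powR_inv1 ?sqr_ge0//.
have [->|x0] := eqVneq x 0; first by rewrite invr0 mul0r.
by rewrite expr2 invfM mulrA mulfV// mul1r.
Qed.

Lemma measurable_heat_kernel n :
  measurable_fun setT (fun z : measurableTypeR R * n.-tuple R => heat_kernel z.1 z.2).
Proof.
apply: measurable_funM.
  apply: (measurableT_comp (measurable_powR _)).
  by apply: measurable_funM => //; exact: measurable_fst.
apply: (measurableT_comp (@measurable_expR R)).
apply: measurableT_comp => //; apply: measurable_funM.
  apply: (measurableT_comp (@measurable_sqnorm n)); exact: measurable_snd.
apply: (measurableT_comp measurable_inv).
by apply: measurable_funM => //; exact: measurable_fst.
Qed.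

Lemma measurable_heat_kernelr n (h : R) :
  measurable_fun setT (@heat_kernel R n h).
Proof.
apply: measurable_funM => //; apply: (measurableT_comp (@measurable_expR R)).
apply: measurableT_comp => //; apply: measurable_funM => //.
exact: measurable_sqnorm.
Qed.

Lemma sqnorm_cons n (a : R) (t : n.-tuple R) :
  sqnorm (cons_pair (a, t)) = a ^+ 2 + sqnorm t.
Proof.
rewrite /sqnorm big_ord_recl tnth0; congr (_ + _).
by apply: eq_bigr => i _; rewrite tnthS.
Qed.

(** The Gaussian splits off one coordinate, whose factor is the centred normal
    density of variance 2 h; this reduces the total mass to dimension one. *)
Lemma heat_kernel_cons n (h a : R) (t : n.-tuple R) : 0 < h ->
  heat_kernel h (cons_pair (a, t)) =
  normal_pdf 0 (Num.sqrt (2 * h)) a * heat_kernel h t.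
Proof.
move=> h0; have s0 : Num.sqrt (2 * h) != 0 by rewrite gt_eqF// sqrtr_gt0 mulr_gt0.
have p0 := @pi_gt0 R.
rewrite /normal_pdf (negbTE s0) /normal_peak /normal_fun subr0.
rewrite sqr_sqrtr ?mulr_ge0 ?ltW// /heat_kernel sqnorm_cons.
rewrite (_ : 2 * h * pi *+ 2 = 4 * pi * h); last by rewrite -mulr_natr; lra.
rewrite -powR12_sqrt ?mulr_ge0 ?(ltW p0) ?(ltW h0)// -powRN.
rewrite (_ : - (n.+1%:R / 2) = - 2^-1 + - (n%:R / 2)); last first.
  by rewrite -addn1 natrD; lra.
rewrite powRD; last by rewrite [_ == 0 :> R in X in _ ==> X]gt_eqF ?implybT ?mulr_gt0.
rewrite (_ : - ((a ^+ 2 + sqnorm t) / (4 * h)) =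
  - a ^+ 2 / (2 * h *+ 2) + - (sqnorm t / (4 * h))); last first.
  by rewrite -mulr_natr; field; lra.
by rewrite expRD; ring.
Qed.

Lemma integral_heat_kernel n (h : R) : 0 < h ->
  (\int[lebesgue_tuple R n]_y (heat_kernel h y)%:E = 1)%E.
Proof.
move=> h0; elim: n => [|n IH].
  rewrite /= integral_dirac//; last by apply/measurable_EFinP; exact: measurable_heat_kernelr.
  rewrite diracT mul1e /heat_kernel /sqnorm big_ord0 !mul0r oppr0.
  by rewrite powRr0 expR0 mulr1.
rewrite integral_lebesgue_tupleS; first last.
- by move=> x; rewrite lee_fin heat_kernel_ge0.
- by apply/measurable_EFinP; exact: measurable_heat_kernelr.
rewrite -(@integral_normal_pdf R 0 (Num.sqrt (2 * h))).
apply: eq_integral => a _.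
under eq_integral do rewrite heat_kernel_cons// EFinM.
rewrite ge0_integralZl//.
- by rewrite [X in (_ * X)%E]IH mule1.
- by apply/measurable_EFinP; exact: measurable_heat_kernelr.
- by move=> x _; rewrite lee_fin heat_kernel_ge0.
- by rewrite lee_fin normal_pdf_ge0.
Qed.

Lemma integrable_heat_kernel n (h : R) : 0 < h ->
  (lebesgue_tuple R n).-integrable setT (EFin \o @heat_kernel R n h).
Proof.
move=> h0; apply/integrableP; split.
  by apply/measurable_EFinP; exact: measurable_heat_kernelr.
rewrite (eq_integral (fun y => (heat_kernel h y)%:E)) ?integral_heat_kernel ?ltry//.
by move=> y _; rewrite /= ger0_norm ?heat_kernel_ge0.
Qed.

End heat_kernel.

(** * Jensen's inequality and monotonicity of integrals *)

Section jensen.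
Context d (T : measurableType d) (R : realType) (mu : {measure set T -> \bar R}).

Lemma lee_poweR (x y : \bar R) (r : R) : 0 <= r -> (0 <= x)%E -> (x <= y)%E ->
  (x `^ r <= y `^ r)%E.
Proof.
move=> r0 x0 xy; apply: gt0_ler_poweR => //; rewrite in_itv/= leey andbT//.
exact: le_trans xy.
Qed.

(** Jensen's inequality for the weight w of arbitrary mass: Hoelder applied to the
    factors w^(1/Q) g and w^(1/Q'), with 1/Q + 1/Q' = 1. *)
Lemma powR_integral_le (w g : T -> R) (Q : R) : 1 < Q ->
  measurable_fun setT w -> measurable_fun setT g ->
  (forall x, 0 <= w x) -> (forall x, 0 <= g x) ->
  ((\int[mu]_x (w x * g x)%:E) `^ Q <=
   (\int[mu]_x (w x * g x `^ Q)%:E) * (\int[mu]_x (w x)%:E) `^ (Q - 1))%E.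
Proof.
move=> Q1 mw mg w0 g0; have Q0 : 0 < Q by lra.
pose Q' := Q / (Q - 1).
have Q'0 : 0 < Q' by rewrite divr_gt0//; lra.
have QQ' : Q^-1 + Q'^-1 = 1 by rewrite /Q'; field; rewrite !gt_eqF//; lra.
pose F x := w x `^ Q^-1 * g x.
pose G x := w x `^ Q'^-1.
have mF : measurable_fun setT F.
  by apply: measurable_funM => //; apply: (measurableT_comp (measurable_powR _)).
have mG : measurable_fun setT G by apply: (measurableT_comp (measurable_powR _)).
have := hoelder mu mF mG Q0 Q'0 QQ'.
rewrite Lnorm1 unlock.
rewrite (eq_integral (fun x => (w x * g x)%:E)); last first.
  move=> x _ /=; rewrite ger0_norm; last by rewrite !mulr_ge0 ?powR_ge0.
  rewrite /F /G mulrAC -powRD; last by rewrite QQ' oner_eq0.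
  by rewrite QQ' powRr1.
rewrite (_ : (\int[mu]_x (`|(EFin \o F) x| `^ Q) =
    \int[mu]_x (w x * g x `^ Q)%:E)%E); last first.
  apply: eq_integral => x _ /=; rewrite ger0_norm ?mulr_ge0 ?powR_ge0//.
  by rewrite powRM ?powR_ge0// -powRrM mulVf ?gt_eqF// powRr1.
rewrite (_ : (\int[mu]_x (`|(EFin \o G) x| `^ Q') =
    \int[mu]_x (w x)%:E)%E); last first.
  apply: eq_integral => x _ /=; rewrite ger0_norm ?powR_ge0//.
  by rewrite -powRrM mulVf ?gt_eqF// powRr1.
move=> H; have I0 : (0 <= \int[mu]_x (w x * g x)%:E)%E.
  by apply: integral_ge0 => x _; rewrite lee_fin mulr_ge0.
apply: (le_trans (lee_poweR (ltW Q0) I0 H)).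
rewrite poweRM ?poweR_ge0// -!poweRrM mulVf ?gt_eqF// poweRe1; last first.
  by apply: integral_ge0 => x _; rewrite lee_fin mulr_ge0 ?powR_ge0.
rewrite (_ : Q'^-1 * Q = Q - 1)//.
by rewrite /Q'; field; rewrite !gt_eqF//; lra.
Qed.

(** The integral of a non-negative function is a supremum over the simple functions
    below it, hence monotone. The lemma is applied to [heat_maximal], a supremum over
    uncountably many times, and to the integrand of [besov_norm]. *)
Lemma le_integral_nomeas (D : set T) (f g : T -> \bar R) :
  (forall x, D x -> 0 <= f x)%E ->
  (forall x, D x -> (f x <= g x)%E) ->
  (\int[mu]_(x in D) f x <= \int[mu]_(x in D) g x)%E.
Proof.
move=> f0 fg; rewrite (integral_mkcond D f) (integral_mkcond D g).
rewrite !ge0_integralTE; last 2 first.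
- move=> x; apply: erestrict_ge0 => y Dy.
  by apply: (le_trans (f0 y Dy)); exact: fg.
- by move=> x; apply: erestrict_ge0 => y; exact: f0.
apply: ereal_sup_le => _ [h hf <-]; exists h => // x; apply: (le_trans (hf x)).
rewrite !patchE; case: ifPn => // /set_mem; exact: fg.
Qed.

End jensen.

(** * Convolution of heat kernels *)

Section heat_semigroup.
Variable R : realType.

Lemma Rintegral_sub_tuple n (x : n.-tuple R) (g : n.-tuple R -> R) :
  measurable_fun setT g ->
  \int[lebesgue_tuple R n]_y g (sub_tuple x y) = \int[lebesgue_tuple R n]_y g y.
Proof.
move=> mg; rewrite /Rintegral; congr fine.
rewrite integralE [RHS]integralE.
have mG : measurable_fun setT (EFin \o g) by exact/measurable_EFinP.
have H1 := integral_sub_tuple x (measurable_funepos mG) (fun=> funepos_ge0 _ _).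
have H2 := integral_sub_tuple x (measurable_funeneg mG) (fun=> funeneg_ge0 _ _).
rewrite -H1 -H2; congr (_ - _)%E; apply: eq_integral => y _.
  by rewrite !funeposE.
by rewrite !funenegE.
Qed.

Lemma sub_tupleAC n (x y z : n.-tuple R) :
  sub_tuple (sub_tuple x y) z = sub_tuple (sub_tuple x z) y.
Proof. by apply: eq_from_tnth => i; rewrite !tnth_mktuple; ring. Qed.

(** Completing the square in z: the product is a Gaussian in z centred at
    t y / (s + t), and what remains depends on y only. *)
Lemma heat_kernelM n (s t : R) (y z : n.-tuple R) : 0 < s -> 0 < t ->
  heat_kernel s (sub_tuple y z) * heat_kernel t z =
  heat_kernel (s + t) y * heat_kernel (s * t / (s + t))
    (sub_tuple [tuple t / (s + t) * tnth y i | i < n] z).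
Proof.
move=> s0 t0; have st0 : 0 < s + t by rewrite addr_gt0.
have p0 := @pi_gt0 R.
rewrite /heat_kernel.
have st1 : 0 < s * t / (s + t) by rewrite divr_gt0 ?mulr_gt0.
have pos (u : R) : 0 < u -> 0 <= 4 * pi * u by move=> u0; apply/ltW/mulr_gt0 => //; exact: mulr_gt0.
rewrite mulrACA [RHS]mulrACA -!expRD -!powRM ?pos//.
congr (_ `^ _ * expR _); first by field; rewrite gt_eqF.
rewrite /sqnorm !mulr_suml -!sumrN -!big_split/=; apply: eq_bigr => i _.
rewrite !tnth_mktuple; field; rewrite !gt_eqF//.
Qed.

Lemma integral_heat_kernelM n (s t : R) (y : n.-tuple R) : 0 < s -> 0 < t ->
  (\int[lebesgue_tuple R n]_z
     (heat_kernel s (sub_tuple y z) * heat_kernel t z)%:E =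
   (heat_kernel (s + t) y)%:E)%E.
Proof.
move=> s0 t0; have st0 : 0 < s + t by rewrite addr_gt0.
under eq_integral do rewrite heat_kernelM// EFinM.
have mk := @measurable_heat_kernelr R n (s * t / (s + t)).
rewrite ge0_integralZl// ?lee_fin ?heat_kernel_ge0//; first last.
- by move=> z _; rewrite lee_fin heat_kernel_ge0.
- apply/measurable_EFinP; apply: (measurableT_comp mk).
  exact: measurable_sub_tuple.
rewrite (integral_sub_tuple _ (g := fun z => (heat_kernel _ z)%:E)); first last.
- by move=> z; rewrite lee_fin heat_kernel_ge0.
- exact/measurable_EFinP.
by rewrite integral_heat_kernel ?mule1// divr_gt0 ?mulr_gt0.
Qed.

End heat_semigroup.

(** * Time derivatives of the heat kernel *)

Section heat_kernel_derivatives.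
Variable R : realType.

(** Horner's scheme and an induction that gives half of the rate d to the factor w,
    through w <= (2/d) exp(d w / 2), and the other half to the remaining polynomial. *)
Lemma poly_le_expR (P : {poly R}) (d : R) : 0 < d ->
  exists C : R, 0 < C /\ forall w : R, 0 <= w -> `|P.[w]| <= C * expR (d * w).
Proof.
elim/poly_ind: P d => [|P c IH] d d0.
  exists 1; split => // w _; by rewrite horner0 normr0 mul1r expR_ge0.
have [C [C0 HC]] := IH (d / 2) (divr_gt0 d0 (ltr0n _ 2)).
exists (C * (2 / d) + `|c|); split.
  by rewrite ltr_pwDl// mulr_gt0// divr_gt0.
move=> w w0; rewrite hornerMXaddC (le_trans (ler_normD _ _))// mulrDl.
apply: lerD; last first.
  by rewrite ler_peMr// -expR0 ler_expR mulr_ge0// ltW.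
rewrite normrM (ger0_norm w0).
have -> : C * (2 / d) * expR (d * w) =
    C * expR (d / 2 * w) * (2 / d * expR (d / 2 * w)).
  rewrite (_ : d * w = d / 2 * w + d / 2 * w); last by field.
  by rewrite expRD; ring.
apply: ler_pM => //; first exact: HC.
have := expR_ge1Dx (d / 2 * w); set E := expR _ => h.
have -> : w = 2 / d * (d / 2 * w) by field; rewrite gt_eqF.
by rewrite ler_pM2l ?divr_gt0//; lra.
Qed.

Variable n : nat.
Let nu : R := n%:R / 2.

(** The k-th time derivative of the kernel is t^(-k) P_k(|y|^2 / (4 t)) times the
    kernel; differentiating such a product, with d/dt w = - w / t for
    w = |y|^2 / (4 t), gives P_(k+1) = (w - k - n/2) P_k - w P_k'. *)
Fixpoint heat_poly (k : nat) : {poly R} :=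
  if k is k'.+1 then
    ('X - (k'%:R + nu)%:P) * heat_poly k' - 'X * (heat_poly k')^`()
  else 1.

Definition dheat_kernel (k : nat) (t : R) (y : n.-tuple R) : R :=
  t ^- k * (heat_poly k).[sqnorm y / (4 * t)] * heat_kernel t y.

Lemma dheat_kernel0 t y : dheat_kernel 0 t y = heat_kernel t y.
Proof. by rewrite /dheat_kernel/= expr0 invr1 mul1r -polyC1 hornerC mul1r. Qed.

Lemma is_derive_dheat_kernel (k : nat) (t : R) (y : n.-tuple R) : 0 < t ->
  is_derive t 1 (fun t => dheat_kernel k t y) (dheat_kernel k.+1 t y).
Proof.
move=> t0; have p0 := @pi_gt0 R.
set a := sqnorm y.
have D1 : is_derive t 1 (fun t : R => a / (4 * t)) (- (a / (4 * t)) / t).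
  have t4 : 4 * t != 0 by rewrite gt_eqF ?mulr_gt0.
  have H : is_derive t 1 (fun t : R => 4 * t) 4.
    by apply: is_derive_eq; rewrite /GRing.scale/=; ring.
  have := is_deriveV t4 H.
  move=> H'; apply: is_derive_eq.
  by rewrite /GRing.scale/=; field; rewrite gt_eqF.
have D2 (c : R) : 0 < c -> is_derive t 1 (fun t : R => (c * t) `^ (- nu))
    (- nu / t * (c * t) `^ (- nu)).
  move=> c0; have H : is_derive t 1 (fun t : R => c * t) c.
    by apply: is_derive_eq; rewrite /GRing.scale/=; ring.
  have ct : 0 < c * t by rewrite mulr_gt0.
  have := @is_derive1_comp _ (fun u => u `^ (- nu)) (fun t : R => c * t) t _ _
    (is_derive1_powR (- nu) ct) H.
  move=> H'; apply: (is_derive_eq H').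
  rewrite powRB ?powRr1 ?(ltW ct)//; last by rewrite [X in _ ==> ~~ X]gt_eqF ?implybT.
  by field; rewrite !gt_eqF.
have {}D2 := D2 (4 * pi) (mulr_gt0 (ltr0n _ 4) p0).
have D3 : is_derive t 1 (fun t : R => expR (- (a / (4 * t))))
    (a / (4 * t) / t * expR (- (a / (4 * t)))).
  have := @is_derive1_comp _ expR (fun t : R => - (a / (4 * t))) t _ _
    (is_derive_expR _) (is_deriveN D1).
  by move=> H'; apply: (is_derive_eq H'); rewrite !mulNr opprK mulrC.
have D4 : is_derive t 1 (fun t : R => (heat_poly k).[a / (4 * t)])
    ((heat_poly k)^`().[a / (4 * t)] * (- (a / (4 * t)) / t)).
  exact: (@is_derive1_comp _ (horner (heat_poly k)) (fun t : R => a / (4 * t)) t _ _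
    (is_derive_poly _ _) D1).
have D5 : is_derive t 1 (fun t : R => t ^- k) (- k%:R / t * t ^- k).
  have tk : t ^+ k != 0 by rewrite expf_neq0// gt_eqF.
  have Dk : is_derive t 1 (fun t : R => t ^+ k) ((k%:R * t ^+ k.-1) *: 1).
    have := is_deriveX k (is_derive_id t (1 : R)).
    by rewrite (_ : id ^+ k = fun t : R => t ^+ k)//; apply/funext => u; rewrite fctE.
  have := is_deriveV (f := fun t : R => t ^+ k) tk Dk.
  move=> H'; apply: (is_derive_eq H').
  rewrite /GRing.scale/=.
  case: k tk {H' Dk D4} => [|k] tk; first by rewrite !mul0r ?mulr0n ?mul0r ?mulr0 ?oppr0 ?mul0r.
  rewrite [k.+1.-1]/= mulr1 expr2 (exprS t k).
  have : t ^+ k != 0 by rewrite expf_neq0// gt_eqF.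
  have : t != 0 by rewrite gt_eqF.
  move: (t ^+ k) (k.+1%:R : R) => u K t1 u1.
  by field; rewrite t1 u1.
have D6 := is_deriveM (is_deriveM D5 D4) (is_deriveM D2 D3).
apply: (is_derive_eq D6).
rewrite /dheat_kernel /heat_kernel -/a -/nu !fctE /GRing.scale/=.
rewrite !(hornerD, hornerN, hornerM, hornerX, hornerC).
move: (_ `^ _) (expR _) => A E.
set w := a / (4 * t); move: (_^`().[w]) (_.[w]) => P' P.
rewrite exprS invfM; have : t ^+ k != 0 by rewrite expf_neq0// gt_eqF.
have : t != 0 by rewrite gt_eqF.
move: (t ^+ k) w (k%:R : R) => u w K t1 u1.
by field; rewrite t1 u1.
Qed.

End heat_kernel_derivatives.

(** * Gaussian bounds for the derivatives *)

Section heat_kernel_bounds.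
Variables (R : realType) (n : nat).
Let nu : R := n%:R / 2.
Let nu0 : 0 <= nu. Proof. by rewrite divr_ge0. Qed.

Lemma ler_powRN (x y a : R) : 0 < x -> x <= y -> 0 <= a ->
  y `^ (- a) <= x `^ (- a).
Proof.
move=> x0 xy a0; have y0 := lt_le_trans x0 xy.
by rewrite !powRN lef_pV2 ?posrE ?powR_gt0// ge0_ler_powR// ?nnegrE ltW.
Qed.

(** A kernel that dominates for all t in [a, b], as needed to differentiate under the
    integral sign. *)
Lemma heat_kernel_le (a t b : R) (y : n.-tuple R) : 0 < a -> a <= t -> t <= b ->
  heat_kernel t y <= (b / a) `^ nu * heat_kernel b y.
Proof.
move=> a0 at_ tb; have t0 := lt_le_trans a0 at_; have b0 := lt_le_trans t0 tb.
have p0 := @pi_gt0 R.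
have p4 : 0 < 4 * pi :> R by rewrite mulr_gt0.
rewrite mulrA ler_pM ?powR_ge0 ?expR_ge0//.
  rewrite (_ : (b / a) `^ nu * _ = (4 * pi * a) `^ (- nu)).
    by apply: ler_powRN; rewrite ?mulr_gt0// ler_pM2l.
  rewrite (_ : 4 * pi * b = (4 * pi * a) * (b / a)); last first.
    by rewrite -[RHS]mulrA; congr (_ * _); field; rewrite gt_eqF.
  rewrite [X in _ * X]powRM; [|by rewrite ltW ?mulr_gt0|by rewrite ltW ?divr_gt0].
  rewrite mulrCA -powRD; last by rewrite [X in _ ==> ~~ X]gt_eqF ?implybT ?divr_gt0.
  by rewrite subrr powRr0 mulr1.
by rewrite ler_expR lerN2 ler_wpM2l ?sqnorm_ge0// lef_pV2 ?posrE ?mulr_gt0// ler_pM2l.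
Qed.

(** Half of the Gaussian exponent absorbs the polynomial; the other half is the
    exponent of the kernel at time 2 t. *)
Lemma dheat_kernel_bound k : exists C : R, 0 < C /\ forall (t : R) (y : n.-tuple R),
  0 < t -> `|dheat_kernel k t y| <= C * t ^- k * heat_kernel (2 * t) y.
Proof.
have [C [C0 HC]] := @poly_le_expR R (heat_poly R n k) (2^-1) ltac:(by rewrite invr_gt0).
have p0 := @pi_gt0 R.
exists (C * 2 `^ nu); split; first by rewrite mulr_gt0// powR_gt0.
move=> t y t0; have t4 : 0 < 4 * pi * t by rewrite !mulr_gt0.
rewrite /dheat_kernel /heat_kernel -/nu.
set w := sqnorm y / (4 * t).
have w0 : 0 <= w by rewrite divr_ge0 ?sqnorm_ge0// ltW ?mulr_gt0.
rewrite !normrM [`|_ ^- k|]ger0_norm; last by rewrite invr_ge0 exprn_ge0// ltW.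
rewrite [`|_ `^ _|]ger0_norm ?powR_ge0// [`|expR _|]ger0_norm ?expR_ge0//.
rewrite (_ : 4 * pi * (2 * t) = 2 * (4 * pi * t)); last by ring.
rewrite [in X in _ <= X]powRM ?(ltW t4)//.
rewrite (_ : sqnorm y / (4 * (2 * t)) = 2^-1 * w); last first.
  by rewrite /w; field; rewrite gt_eqF.
rewrite (powRN 2); have p2 : 2 `^ nu != 0 :> R by rewrite gt_eqF ?powR_gt0.
move: (2 `^ nu) p2 ((4 * pi * t) `^ (- nu)) (powR_ge0 (4 * pi * t) (- nu)) => q q0 A A0.
rewrite (_ : C * q * _ * _ = t ^- k * (C * expR (2^-1 * w)) * (A * expR (- w))); last first.
  rewrite (_ : - (2^-1 * w) = 2^-1 * w + - w); last by field.
  by rewrite expRD; move: (t ^- k) => u; field.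
rewrite ler_wpM2r ?mulr_ge0 ?expR_ge0// ler_wpM2l ?HC//.
by rewrite invr_ge0 exprn_ge0// ltW.
Qed.

Lemma measurable_dheat_kernel k :
  measurable_fun setT (fun z : measurableTypeR R * n.-tuple R => dheat_kernel k z.1 z.2).
Proof.
apply: measurable_funM; last exact: measurable_heat_kernel.
apply: measurable_funM.
  apply: (measurableT_comp (@measurable_inv R)).
  by apply: measurable_funX; exact: measurable_fst.
apply: (measurableT_comp (@measurable_poly R (heat_poly R n k) setT)).
apply: measurable_funM.
  apply: (measurableT_comp (@measurable_sqnorm R n)); exact: measurable_snd.
apply: (measurableT_comp (@measurable_inv R)).
by apply: measurable_funM => //; exact: measurable_fst.
Qed.

Lemma measurable_dheat_kernelr k (t : R) :
  measurable_fun setT (@dheat_kernel R n k t).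
Proof.
exact: (measurableT_comp (@measurable_dheat_kernel k) (measurable_pair1 (t : measurableTypeR R))).
Qed.

End heat_kernel_bounds.

(** * Integrals depending on a parameter *)

Section parametric_integral.
Context d1 d2 (T1 : measurableType d1) (T2 : measurableType d2) (R : realType).
Variable mu : {sigma_finite_measure set T2 -> \bar R}.

Lemma measurable_Rintegral (F : T1 * T2 -> R) : measurable_fun setT F ->
  measurable_fun setT (fun x => \int[mu]_y F (x, y)).
Proof.
move=> mF; rewrite /Rintegral; apply: (measurableT_comp (@fine_measurable R _ measurableT)).
have mG : measurable_fun setT (EFin \o F) by exact/measurable_EFinP.
rewrite (_ : (fun x => _) = (fun x => fubini_F mu (EFin \o F)^\+ x - fubini_F mu (EFin \o F)^\- x)%E); last first.
  apply/funext => x; rewrite integralE; congr (_ - _)%E; apply: eq_integral => y _.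
    by rewrite !funeposE.
  by rewrite !funenegE.
apply: emeasurable_funB.
  apply: measurable_fun_fubini_tonelli_F => //; exact: measurable_funepos.
apply: measurable_fun_fubini_tonelli_F => //; exact: measurable_funeneg.
Qed.

End parametric_integral.

Section derivative_under_integral.
Context d (Y : measurableType d) (R : realType) (mu : {measure set Y -> \bar R}).

Lemma is_derive_under_integral (f df : R -> Y -> R) (a u v : R) (G : Y -> R) :
  u < a < v ->
  (forall t, u < t < v -> mu.-integrable setT (EFin \o f t)) ->
  (forall t y, u < t < v -> is_derive t 1 (f ^~ y) (df t y)) ->
  (forall y, 0 <= G y) -> mu.-integrable setT (EFin \o G) ->
  (forall t y, u < t < v -> `|df t y| <= G y) ->
  is_derive a 1 (fun t => \int[mu]_y f t y) (\int[mu]_y df a y).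
Proof.
move=> auv intf dfE G0 intG Gub.
have itvE t : `]u, v[%classic t -> u < t < v by rewrite /= in_itv.
have dE t y : u < t < v -> partial1of2 f t y = df t y.
  by move=> /dfE -/(_ y)[_ <-]; rewrite partial1of2E.
have Ia : `]u, v[%classic a by rewrite /= in_itv.
have intf' t : `]u, v[%classic t -> mu.-integrable setT (EFin \o f t).
  by move=> /itvE; exact: intf.
have derf t y : `]u, v[%classic t -> setT y -> derivable (f ^~ y) t 1.
  by move=> /itvE /dfE -/(_ y)[].
have Gub' t y : `]u, v[%classic t -> setT y -> `|partial1of2 f t y| <= G y.
  by move=> /itvE tuv _; rewrite dE//; exact: Gub.
split; first exact: (derivable_under_integral measurableT Ia intf' derf G0 intG Gub').
rewrite -derive1E (differentiation_under_integral measurableT Ia intf' derf G0 intG Gub').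
by apply: eq_Rintegral => y _; rewrite dE.
Qed.

End derivative_under_integral.

(** * Time derivatives of the heat flow as integrals *)

Section dheat_integral.
Variables (R : realType) (n : nat).
Let nu : R := n%:R / 2.
Local Notation mu := (lebesgue_tuple R n).
Variables (p : R) (f : n.-tuple R -> R).
Hypotheses (p1 : 1 <= p) (mf : measurable_fun setT f).
Hypothesis fp : (\int[mu]_x (`|f x| `^ p)%:E < +oo)%E.

Let mfs x : measurable_fun setT (fun y => f (sub_tuple x y)).
Proof. by apply: (measurableT_comp mf); exact: measurable_sub_tuple. Qed.

Let mabs (g : n.-tuple R -> R) : measurable_fun setT g ->
  measurable_fun setT (fun y => `|g y| `^ p).
Proof.
move=> mg; apply: (measurableT_comp (measurable_powR p)).
exact: (measurableT_comp (@normr_measurable R setT)).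
Qed.

Lemma ler1_powR_normr (x : R) : `|x| <= 1 + `|x| `^ p.
Proof.
have [x1|x1] := leP `|x| 1; first by rewrite (le_trans x1)// lerDl powR_ge0.
by rewrite ler_wpDl// le1r_powR// ltW.
Qed.

(** The kernel is integrable and bounded, and |f| <= 1 + |f|^p. *)
Lemma integrable_heat_kernel_shift (t : R) x : 0 < t ->
  mu.-integrable setT (EFin \o (fun y => heat_kernel t y * `|f (sub_tuple x y)|)).
Proof.
move=> t0; set A := (4 * pi * t) `^ (- (n%:R / 2)) : R.
have A0 : 0 <= A by exact: powR_ge0.
have mk := @measurable_heat_kernelr R n t.
apply: (@le_integrable _ _ _ _ _ measurableT _
  (EFin \o (fun y => heat_kernel t y + A * `|f (sub_tuple x y)| `^ p))).
- apply/measurable_EFinP; apply: measurable_funM => //.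
  exact: (measurableT_comp (@normr_measurable R setT)).
- move=> y _; rewrite /= lee_fin [leLHS]ger0_norm; last by rewrite mulr_ge0 ?heat_kernel_ge0.
  rewrite [leRHS]ger0_norm; last by rewrite addr_ge0 ?mulr_ge0 ?heat_kernel_ge0 ?powR_ge0.
  rewrite (le_trans (ler_wpM2l (heat_kernel_ge0 _ _) (ler1_powR_normr _)))//.
  by rewrite mulrDr mulr1 lerD2l ler_wpM2r ?powR_ge0// heat_kernel_ub.
- rewrite (_ : _ \o _ = (EFin \o heat_kernel t) \+ (fun y => A%:E * (`|f (sub_tuple x y)| `^ p)%:E))%E//.
  apply: integrableD => //.
    exact: integrable_heat_kernel.
  apply: integrableZl => //; apply/integrableP; split.
    by apply/measurable_EFinP; exact: (mabs (mfs x)).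
  rewrite (eq_integral (fun y => (`|f (sub_tuple x y)| `^ p)%:E)); last first.
    by move=> y _; rewrite /= ger0_norm ?powR_ge0.
  rewrite (integral_sub_tuple x (g := fun y => (`|f y| `^ p)%:E))//.
  by apply/measurable_EFinP; exact: (mabs mf).
Qed.

Lemma integrable_dheat_kernel_shift k (t : R) x : 0 < t ->
  mu.-integrable setT (EFin \o (fun y => dheat_kernel k t y * f (sub_tuple x y))).
Proof.
move=> t0; have [C [C0 HC]] := @dheat_kernel_bound R n k.
have t2 : 0 < 2 * t by rewrite mulr_gt0.
apply: (@le_integrable _ _ _ _ _ measurableT _
  (EFin \o (fun y => C * t ^- k * (heat_kernel (2 * t) y * `|f (sub_tuple x y)|)))).
- apply/measurable_EFinP; apply: measurable_funM => //.
  exact: measurable_dheat_kernelr.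
- move=> y _; rewrite /= lee_fin normrM [X in _ <= X]ger0_norm; last first.
    by rewrite !mulr_ge0 ?invr_ge0 ?exprn_ge0 ?powR_ge0 ?expR_ge0// ltW.
  by rewrite mulrA ler_wpM2r// HC.
- rewrite (_ : _ \o _ = (fun y => (C * t ^- k)%:E * (heat_kernel (2 * t) y * `|f (sub_tuple x y)|)%:E)%E)//.
  by apply: integrableZl => //; exact: integrable_heat_kernel_shift.
Qed.

Lemma is_derive_dheat_integral k (t : R) x : 0 < t ->
  is_derive t 1 (fun s => \int[mu]_y (dheat_kernel k s y * f (sub_tuple x y)))
    (\int[mu]_y (dheat_kernel k.+1 t y * f (sub_tuple x y))).
Proof.
move=> t0; have [C [C0 HC]] := @dheat_kernel_bound R n k.+1.
have t2 : 0 < t / 2 by rewrite divr_gt0.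
have t8 : 0 < 2 * (2 * t) by rewrite !mulr_gt0.
pose M := C * (t / 2) ^- k.+1 * (2 * (2 * t) / (2 * (t / 2))) `^ nu.
have M0 : 0 <= M by rewrite !mulr_ge0 ?powR_ge0 ?invr_ge0 ?exprn_ge0// ltW.
apply: (@is_derive_under_integral _ _ _ mu
  (fun t y => dheat_kernel k t y * f (sub_tuple x y))
  (fun t y => dheat_kernel k.+1 t y * f (sub_tuple x y)) t (t / 2) (2 * t)
  (fun y => M * (heat_kernel (2 * (2 * t)) y * `|f (sub_tuple x y)|))).
- by lra.
- by move=> s /andP[s1 s2]; apply: integrable_dheat_kernel_shift; lra.
- move=> s y /andP[s1 s2]; have s0 : 0 < s by lra.
  apply: (is_derive_eq (is_deriveM (is_derive_dheat_kernel k y s0)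
    (is_derive_cst (f (sub_tuple x y)) s 1))).
  by rewrite /GRing.scale/= mulr0 add0r mulrC.
- by move=> y; rewrite mulr_ge0 ?M0//; by rewrite mulr_ge0 ?heat_kernel_ge0.
- rewrite (_ : _ \o _ = (fun y => M%:E * (heat_kernel (2 * (2 * t)) y * `|f (sub_tuple x y)|)%:E)%E)//.
  by apply: integrableZl => //; exact: integrable_heat_kernel_shift.
- move=> s y /andP[s1 s2]; have s0 : 0 < s by lra.
  rewrite normrM mulrA ler_wpM2r//; apply: (le_trans (HC s y s0)).
  rewrite /M -[leRHS]mulrA; apply: ler_pM; rewrite ?heat_kernel_ge0//.
    by rewrite mulr_ge0 ?invr_ge0 ?exprn_ge0// ltW.
    by rewrite ler_wpM2l ?(ltW C0)// lef_pV2 ?posrE ?exprn_gt0// lerXn2r ?nnegrE ?ltW.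
  by apply: heat_kernel_le; lra.
Qed.

(** Every differentiation passes under the integral; the induction replaces [dheat]
    by the integral on a whole neighbourhood of t, where the formula already holds. *)
Lemma dheatE k (t : R) x : 0 < t ->
  dheat k f t x = \int[mu]_y (dheat_kernel k t y * f (sub_tuple x y)).
Proof.
elim: k t => [|k IH] t t0.
  by rewrite /dheat /= /heat; apply: eq_Rintegral => y _; rewrite dheat_kernel0.
rewrite /dheat derive1nS derive1E.
have [_ <-] := is_derive_dheat_integral k x t0.
apply: near_eq_derive; near=> s; apply: IH; near: s; exact: lt_nbhsr.
Unshelve. all: by end_near.
Qed.

Lemma is_derive_dheat k (t : R) x : 0 < t ->
  is_derive t 1 (fun s => dheat k f s x) (dheat k.+1 f t x).
Proof.
move=> t0; rewrite dheatE//.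
apply: near_eq_is_derive (is_derive_dheat_integral k x t0).
near=> s; rewrite dheatE//; near: s; exact: lt_nbhsr.
Unshelve. all: by end_near.
Qed.

Lemma measurable_dheat_integral k : measurable_fun setT
  (fun z : measurableTypeR R * n.-tuple R =>
    \int[mu]_y (dheat_kernel k z.1 y * f (sub_tuple z.2 y))).
Proof.
apply: (@measurable_Rintegral _ _ _ _ R mu
  (fun w : (measurableTypeR R * n.-tuple R) * n.-tuple R =>
    dheat_kernel k w.1.1 w.2 * f (sub_tuple w.1.2 w.2))).
have m11 : measurable_fun setT (fun w : (measurableTypeR R * n.-tuple R) * n.-tuple R => w.1.1).
  exact: (measurableT_comp measurable_fst measurable_fst).
have m12 : measurable_fun setT (fun w : (measurableTypeR R * n.-tuple R) * n.-tuple R => w.1.2).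
  exact: (measurableT_comp measurable_snd measurable_fst).
apply: measurable_funM.
  have m : measurable_fun setT (fun w : (measurableTypeR R * n.-tuple R) * n.-tuple R =>
      (w.1.1, w.2) : measurableTypeR R * n.-tuple R).
    by apply: measurable_fun_pair => //; exact: measurable_snd.
  exact: (measurableT_comp (@measurable_dheat_kernel R n k) m).
by apply: (measurableT_comp mf); apply: measurable_sub_tuple => //; exact: measurable_snd.
Qed.

Lemma measurable_dheat k (t : R) : 0 < t -> measurable_fun setT (dheat k f t).
Proof.
move=> t0; rewrite (_ : dheat k f t = fun x =>
  \int[mu]_y (dheat_kernel k t y * f (sub_tuple x y))); last first.
  by apply/funext => x; rewrite dheatE.
exact: (measurableT_comp (measurable_dheat_integral k) (measurable_pair1 (t : measurableTypeR R))).
Qed.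

End dheat_integral.

(** * Convolution with the heat kernel and the semigroup law *)

Section heat_convolution.
Variables (R : realType) (n : nat).
Local Notation mu := (lebesgue_tuple R n).

Lemma integral_sub_tuplel (y : n.-tuple R) (g : n.-tuple R -> \bar R) :
  measurable_fun setT g -> (forall x, (0 <= g x)%E) ->
  (\int[mu]_x g (sub_tuple x y) = \int[mu]_x g x)%E.
Proof.
move=> mg g0; pose z : n.-tuple R := [tuple 0 | i < n].
rewrite -(integral_sub_tuple z mg g0).
rewrite -(integral_sub_tuple y (g := fun x => g (sub_tuple z x))) //; last first.
  by apply: (measurableT_comp mg); exact: measurable_sub_tuple.
apply: eq_integral => x _; congr g.
by apply: eq_from_tnth => i; rewrite !tnth_mktuple sub0r opprB.
Qed.

(** Tonelli, the invariance of Lebesgue measure, and the unit mass of the kernel. *)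
Lemma integral_heat_convolution (s : R) (g : n.-tuple R -> R) : 0 < s ->
  measurable_fun setT g -> (forall x, 0 <= g x) ->
  (\int[mu]_x \int[mu]_y (heat_kernel s y * g (sub_tuple x y))%:E =
   \int[mu]_x (g x)%:E)%E.
Proof.
move=> s0 mg g0.
have mF : measurable_fun setT (fun z : n.-tuple R * n.-tuple R =>
    (heat_kernel s z.2 * g (sub_tuple z.1 z.2))%:E).
  apply/measurable_EFinP; apply: measurable_funM.
    apply: (measurableT_comp (@measurable_heat_kernelr R n s)); exact: measurable_snd.
  apply: (measurableT_comp mg); apply: measurable_sub_tuple.
    exact: measurable_fst.
  exact: measurable_snd.
rewrite (fubini_tonelli _ mF); last first.
  by move=> z; rewrite lee_fin mulr_ge0 ?heat_kernel_ge0.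
have mG : measurable_fun setT (EFin \o g) by exact/measurable_EFinP.
transitivity (\int[mu]_y ((heat_kernel s y)%:E * \int[mu]_x (g x)%:E))%E.
  apply: eq_integral => y _ /=; under eq_integral do rewrite EFinM.
  rewrite ge0_integralZl ?lee_fin ?heat_kernel_ge0//.
  - rewrite (integral_sub_tuplel y (g := fun x => (g x)%:E)) //.
  - apply: (measurableT_comp mG); exact: measurable_sub_tuple.
  - by move=> x _; rewrite lee_fin.
rewrite ge0_integralZr//.
- by rewrite integral_heat_kernel// mul1e.
- by apply/measurable_EFinP; exact: measurable_heat_kernelr.
- by move=> y _; rewrite lee_fin heat_kernel_ge0.
- by apply: integral_ge0 => x _; rewrite lee_fin.
Qed.

Lemma heat_convolution_le (s : R) (g : n.-tuple R -> R) (x : n.-tuple R) : 0 < s ->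
  measurable_fun setT g -> (forall x, 0 <= g x) ->
  (\int[mu]_y (heat_kernel s y * g (sub_tuple x y))%:E <=
   ((4 * pi * s) `^ (- (n%:R / 2)))%:E * \int[mu]_x (g x)%:E)%E.
Proof.
move=> s0 mg g0.
have mG : measurable_fun setT (EFin \o g) by exact/measurable_EFinP.
rewrite -(integral_sub_tuple x mG); last by move=> y; rewrite lee_fin.
have ms : measurable_fun setT (fun y => (g (sub_tuple x y))%:E).
  apply: (measurableT_comp mG); exact: measurable_sub_tuple.
rewrite -ge0_integralZl ?lee_fin ?powR_ge0//; last by move=> y _; rewrite lee_fin.
apply: le_integral_nomeas => y _.
  by rewrite lee_fin mulr_ge0 ?heat_kernel_ge0.
by rewrite -EFinM lee_fin ler_wpM2r ?heat_kernel_ub.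
Qed.

End heat_convolution.

Section dheat_semigroup.
Variables (R : realType) (n : nat).
Let nu : R := n%:R / 2.
Local Notation mu := (lebesgue_tuple R n).
Variables (p : R) (f : n.-tuple R -> R).
Hypotheses (p1 : 1 <= p) (mf : measurable_fun setT f).
Hypothesis fp : (\int[mu]_x (`|f x| `^ p)%:E < +oo)%E.

Let heat_swap (t : R) (x y : n.-tuple R) : 0 < t ->
  mu.-integrable setT (EFin \o (fun v => heat_kernel t (sub_tuple (sub_tuple x v) y) * f v)) /\
  dheat 0 f t (sub_tuple x y) =
    \int[mu]_v (heat_kernel t (sub_tuple (sub_tuple x v) y) * f v).
Proof.
move=> t0; pose a := sub_tuple x y.
pose g (v : n.-tuple R) := heat_kernel t (sub_tuple a v) * f v.
have mg : measurable_fun setT g.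
  apply: measurable_funM => //.
  apply: (measurableT_comp (@measurable_heat_kernelr R n t)).
  exact: measurable_sub_tuple.
have gE v : heat_kernel t (sub_tuple (sub_tuple x v) y) * f v = g v.
  by rewrite sub_tupleAC.
have gsE v : g (sub_tuple a v) = heat_kernel t v * f (sub_tuple a v).
  by rewrite /g sub_tupleK.
split.
  rewrite (_ : (fun v => _) = g); last by apply/funext => v; exact: gE.
  apply/integrableP; split; first exact/measurable_EFinP.
  have mG : measurable_fun setT (fun v => `|(EFin \o g) v|%E).
    by apply: measurableT_comp => //; exact/measurable_EFinP.
  rewrite -(integral_sub_tuple a mG)//.
  have /integrableP[_] := integrable_heat_kernel_shift p1 mf fp a t0.
  apply: le_lt_trans; apply: le_integral_nomeas => v _ //.
  by rewrite /= gsE lee_fin !normrM normr_id.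
transitivity (\int[mu]_v g v); last by apply: eq_Rintegral => v _; rewrite gE.
rewrite -(Rintegral_sub_tuple a mg) (dheatE p1 mf fp)//.
by apply: eq_Rintegral => v _; rewrite gsE dheat_kernel0.
Qed.

(** Fubini and [integral_heat_kernelM]. [heat_swap] first moves the shift from f to
    the kernel, so that y occurs in the two kernels only. *)
Lemma heat_semigroup (s t : R) x : 0 < s -> 0 < t ->
  dheat 0 f (s + t) x = \int[mu]_y (heat_kernel s y * dheat 0 f t (sub_tuple x y)).
Proof.
move=> s0 t0; have st0 : 0 < t + s by rewrite addr_gt0.
pose F (z : n.-tuple R * n.-tuple R) := (heat_kernel s z.1 *
  (heat_kernel t (sub_tuple (sub_tuple x z.2) z.1) * f z.2))%:E.
have mF : measurable_fun setT F.
  apply/measurable_EFinP; apply: measurable_funM.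
    apply: (measurableT_comp (@measurable_heat_kernelr R n s)); exact: measurable_fst.
  apply: measurable_funM; last by apply: (measurableT_comp mf); exact: measurable_snd.
  apply: (measurableT_comp (@measurable_heat_kernelr R n t)).
  apply: measurable_sub_tuple; last exact: measurable_fst.
  by apply: measurable_sub_tuple => //; exact: measurable_snd.
have kE v : (\int[mu]_y (heat_kernel s y * heat_kernel t (sub_tuple (sub_tuple x v) y))%:E =
    (heat_kernel (t + s) (sub_tuple x v))%:E)%E.
  rewrite -(integral_heat_kernelM _ t0 s0).
  by apply: eq_integral => y _; rewrite mulrC.
have mk v : measurable_fun setT (fun y : n.-tuple R =>
    (heat_kernel s y * heat_kernel t (sub_tuple (sub_tuple x v) y))%:E).
  apply/measurable_EFinP; apply: measurable_funM.
    exact: measurable_heat_kernelr.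
  apply: (measurableT_comp (@measurable_heat_kernelr R n t)).
  exact: measurable_sub_tuple.
have k0 y v : (0 <= (heat_kernel s y * heat_kernel t (sub_tuple (sub_tuple x v) y))%:E)%E.
  by rewrite lee_fin mulr_ge0 ?heat_kernel_ge0.
have mfv : measurable_fun setT (fun v => heat_kernel (t + s) (sub_tuple x v) * f v).
  apply: measurable_funM => //.
  apply: (measurableT_comp (@measurable_heat_kernelr R n (t + s))).
  exact: measurable_sub_tuple.
have iF : (mu \x mu)%E.-integrable setT F.
  have [_ H] := @integrable21ltyP _ _ _ _ R mu mu F mF; apply: H.
  rewrite (eq_integral (fun v => `|heat_kernel (t + s) (sub_tuple x v) * f v|%:E)); last first.
    move=> v _; rewrite normrM ger0_norm ?heat_kernel_ge0// EFinM -kE -ge0_integralZr//.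
    apply: eq_integral => y _ /=.
    rewrite mulrA normrM ger0_norm; last by rewrite mulr_ge0 ?heat_kernel_ge0. by rewrite EFinM.
  pose g (v : n.-tuple R) := `|heat_kernel (t + s) (sub_tuple x v) * f v|%:E.
  have mg : measurable_fun setT g.
    apply/measurable_EFinP.
    exact: (measurableT_comp (@normr_measurable R setT)).
  rewrite -(integral_sub_tuple x mg); last by move=> v; rewrite lee_fin.
  have /integrableP[_] := integrable_heat_kernel_shift p1 mf fp x st0.
  apply: le_lt_trans; apply: le_integral_nomeas => v _.
    by rewrite lee_fin.
  by rewrite /g /= sub_tupleK lee_fin !normrM normr_id.
have /= := Fubini iF; rewrite /F {F mF iF}.
rewrite (eq_integral (fun y => (heat_kernel s y * dheat 0 f t (sub_tuple x y))%:E)); last first.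
  move=> y _; have [iy ->] := heat_swap x y t0 => /=.
  under eq_integral do rewrite EFinM.
  rewrite integralZl// [RHS]EFinM /Rintegral fineK//.
  by apply: integrable_fin_num.
rewrite [X in _ = X -> _](eq_integral (fun v => (heat_kernel (t + s) (sub_tuple x v) * f v)%:E)); last first.
  move=> v _ /=; rewrite EFinM -kE -integralZr//; last first.
    apply/integrableP; split; first exact: mk.
    rewrite (eq_integral (fun y => (heat_kernel s y *
      heat_kernel t (sub_tuple (sub_tuple x v) y))%:E)) ?kE ?ltry// => y _.
    by rewrite gee0_abs.
  by apply: eq_integral => y _; rewrite mulrA EFinM.
move=> H; rewrite [RHS]/Rintegral H addrC.
rewrite -[LHS]/(dheat 0 f (t + s) x) (dheatE p1 mf fp)//.
have := Rintegral_sub_tuple x mfv; rewrite /Rintegral => <-; congr fine.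
by apply: eq_integral => y _; rewrite sub_tupleK dheat_kernel0.
Qed.

End dheat_semigroup.

(** * Pointwise and norm bounds for the heat flow *)

Section powR_inequalities.
Variable R : realType.

Lemma ler_powR_inv (a b p : R) : 0 < p -> 0 <= a -> 0 <= b ->
  a `^ p <= b `^ p -> a <= b.
Proof.
move=> p0 a0 b0 ab; rewrite leNgt; apply/negP => ba.
by move: ab; rewrite leNgt gt0_ltr_powR ?nnegrE.
Qed.

Lemma Rintegral_norm_le d (T : measurableType d) (mu : {measure set T -> \bar R})
    (g : T -> R) : measurable_fun setT g ->
  (`|\int[mu]_x g x|%:E <= \int[mu]_x `|g x|%:E)%E.
Proof.
move=> mg; have mG : measurable_fun setT (EFin \o g) by exact/measurable_EFinP.
apply: le_trans (le_abse_integral mu measurableT mG).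
rewrite /Rintegral; case: (\int[mu]_x (g x)%:E)%E => [r| |] //=.
  by rewrite normr0 leey.
by rewrite normr0 leey.
Qed.

End powR_inequalities.

Section heat_estimates.
Variables (R : realType) (n : nat).
Let nu : R := n%:R / 2.
Local Notation mu := (lebesgue_tuple R n).
Implicit Types (f : n.-tuple R -> R) (p t : R) (x : n.-tuple R).

(** The kernel is a probability density, which makes the mass factor of
    [powR_integral_le] disappear. *)
Lemma heat_jensen (w g : n.-tuple R -> R) (s p : R) x : 0 < s -> 1 < p ->
  measurable_fun setT w -> measurable_fun setT g ->
  (forall y, `|w y| <= heat_kernel s y) ->
  ((`|\int[mu]_y (w y * g (sub_tuple x y))| `^ p)%:E <=
   \int[mu]_y (heat_kernel s y * `|g (sub_tuple x y)| `^ p)%:E)%E.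
Proof.
move=> s0 p1 mw mg wk; have p0 : 0 <= p by lra.
have mgs : measurable_fun setT (fun y => g (sub_tuple x y)).
  by apply: (measurableT_comp mg); exact: measurable_sub_tuple.
have mags : measurable_fun setT (fun y => `|g (sub_tuple x y)|).
  exact: (measurableT_comp (@normr_measurable R setT)).
have mk := @measurable_heat_kernelr R n s.
rewrite -poweR_EFin.
have H : (`|\int[mu]_y (w y * g (sub_tuple x y))|%:E <=
    \int[mu]_y (heat_kernel s y * `|g (sub_tuple x y)|)%:E)%E.
  apply: (le_trans (Rintegral_norm_le _ _)); first exact: measurable_funM.
  apply: le_integral_nomeas => y _; rewrite lee_fin//.
  by rewrite normrM ler_wpM2r.
apply: (le_trans (lee_poweR p0 _ H)); first by rewrite lee_fin.
have := powR_integral_le mu p1 mk mags (@heat_kernel_ge0 R n s) (fun=> normr_ge0 _).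
by rewrite integral_heat_kernel// poweR1r mule1.
Qed.

(** By [dheat_kernel_bound] the derivative of the kernel, divided by C t^(-k), lies
    below the kernel at time 2 t, so [heat_jensen] applies to it. *)
Lemma dheat_powR_le k : exists C : R, 0 < C /\ forall p f, 1 < p ->
  measurable_fun setT f -> (\int[mu]_x (`|f x| `^ p)%:E < +oo)%E ->
  forall t x, 0 < t ->
  ((`|dheat k f t x| `^ p)%:E <= ((C * t `^ (- k%:R)) `^ p)%:E *
    \int[mu]_y (heat_kernel (2 * t) y * `|f (sub_tuple x y)| `^ p)%:E)%E.
Proof.
have [C [C0 HC]] := @dheat_kernel_bound R n k.
exists C; split=> // p f p1 mf fp t x t0.
have t2 : 0 < 2 * t by rewrite mulr_gt0.
have p1' : 1 <= p by exact: ltW.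
have D0 : 0 < C * t `^ (- k%:R) by rewrite mulr_gt0 ?powR_gt0.
set D := C * _.
rewrite (_ : dheat k f t x = D * \int[mu]_y ((D^-1 * dheat_kernel k t y) * f (sub_tuple x y))); last first.
  rewrite (dheatE p1' mf fp)//.
  have := RintegralZl D^-1 measurableT (integrable_dheat_kernel_shift p1' mf fp k x t0).
  under eq_Rintegral do rewrite mulrA.
  by move=> ->; rewrite mulrA mulfV ?mul1r// gt_eqF.
rewrite normrM powRM// (ger0_norm (ltW D0)) EFinM lee_wpmul2l ?lee_fin ?powR_ge0//.
apply: heat_jensen => //.
  by apply: measurable_funM => //; exact: measurable_dheat_kernelr.
move=> y; rewrite normrM ger0_norm ?invr_ge0 ?(ltW D0)// ler_pdivrMl//.
by rewrite /D powR_invn ?(ltW t0)// HC.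
Qed.

Lemma dheat_sup_bound k : exists C : R, 0 < C /\ forall p f N, 1 < p -> 0 <= N ->
  measurable_fun setT f -> (\int[mu]_x (`|f x| `^ p)%:E <= (N `^ p)%:E)%E ->
  forall t x, 0 < t -> `|dheat k f t x| <= C * t `^ (- (k%:R + nu / p)) * N.
Proof.
have [C [C0 HC]] := dheat_powR_le k.
exists C; split=> // p f N p1 N0 mf fN t x t0; have p0 : 0 < p by lra.
have fp := le_lt_trans fN (ltry _).
have t2 : 0 < 2 * t by rewrite mulr_gt0.
apply: (@ler_powR_inv _ _ _ p) => //; first by rewrite !mulr_ge0 ?powR_ge0 ?(ltW C0).
rewrite -lee_fin; apply: (le_trans (HC p f p1 mf fp t x t0)).
have mfa : measurable_fun setT (fun x => `|f x| `^ p).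
  apply: (measurableT_comp (measurable_powR p)).
  exact: (measurableT_comp (@normr_measurable R setT)).
have H := heat_convolution_le x t2 mfa (fun=> powR_ge0 _ _).
apply: (@le_trans _ _ (((C * t `^ (- k%:R)) `^ p)%:E * ((t `^ (- nu))%:E * (N `^ p)%:E))%E).
  rewrite lee_wpmul2l ?lee_fin ?powR_ge0//.
  apply: (le_trans H); apply: lee_pmul => //; rewrite ?lee_fin ?powR_ge0//.
    by apply: integral_ge0 => y _; rewrite lee_fin powR_ge0.
  apply: ler_powRN => //.
  by have := @pi_ge2 R; nra.
rewrite -!EFinM lee_fin mulrA.
rewrite opprD [in leRHS]powRD; last by rewrite [X in _ ==> ~~ X]gt_eqF ?implybT.
rewrite [leRHS]powRM ?mulr_ge0 ?powR_ge0 ?(ltW C0)//.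
rewrite ler_wpM2r ?powR_ge0// mulrA [leRHS]powRM ?mulr_ge0 ?powR_ge0 ?(ltW C0)//.
rewrite -[X in _ <= _ * X]powRrM (_ : - (nu / p) * p = - nu)//.
by field; rewrite gt_eqF.
Qed.

Lemma dheat_Lp_bound k : exists C : R, 0 < C /\ forall p f N, 1 < p -> 0 <= N ->
  measurable_fun setT f -> (\int[mu]_x (`|f x| `^ p)%:E <= (N `^ p)%:E)%E ->
  forall t, 0 < t ->
  (\int[mu]_x (`|dheat k f t x| `^ p)%:E <= ((C * t `^ (- k%:R) * N) `^ p)%:E)%E.
Proof.
have [C [C0 HC]] := dheat_powR_le k.
exists C; split=> // p f N p1 N0 mf fN t t0; have p0 : 0 < p by lra.
have fp := le_lt_trans fN (ltry _).
have t2 : 0 < 2 * t by rewrite mulr_gt0.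
have mfa : measurable_fun setT (fun x => `|f x| `^ p).
  apply: (measurableT_comp (measurable_powR p)).
  exact: (measurableT_comp (@normr_measurable R setT)).
have H := integral_heat_convolution t2 mfa (fun=> powR_ge0 _ _).
apply: (@le_trans _ _ (\int[mu]_x (((C * t `^ (- k%:R)) `^ p)%:E *
    \int[mu]_y (heat_kernel (2 * t) y * `|f (sub_tuple x y)| `^ p)%:E))%E).
  by apply: le_integral_nomeas => x _; [rewrite lee_fin powR_ge0|exact: HC].
rewrite ge0_integralZl ?lee_fin ?powR_ge0//.
- rewrite H [in leRHS]powRM ?mulr_ge0 ?powR_ge0 ?(ltW C0)// EFinM.
  by rewrite lee_wpmul2l ?lee_fin ?powR_ge0.
- have mF : measurable_fun setT (fun z : n.-tuple R * n.-tuple R =>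
      (heat_kernel (2 * t) z.2 * `|f (sub_tuple z.1 z.2)| `^ p)%:E).
    apply/measurable_EFinP; apply: measurable_funM.
      apply: (measurableT_comp (@measurable_heat_kernelr R n (2 * t))); exact: measurable_snd.
    apply: (measurableT_comp mfa); apply: measurable_sub_tuple.
      exact: measurable_fst.
    exact: measurable_snd.
  have := @measurable_fun_fubini_tonelli_F _ _ _ _ _ mu _ mF; apply.
  by move=> z; rewrite lee_fin mulr_ge0 ?heat_kernel_ge0 ?powR_ge0.
- move=> x _; apply: integral_ge0 => y _.
  by rewrite lee_fin mulr_ge0 ?heat_kernel_ge0 ?powR_ge0.
Qed.

Section fixed_function.
Variables (p N : R) (f : n.-tuple R -> R).
Hypotheses (p1 : 1 < p) (N0 : 0 <= N) (mf : measurable_fun setT f).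
Hypothesis fN : (\int[mu]_x (`|f x| `^ p)%:E <= (N `^ p)%:E)%E.
Let fp := le_lt_trans fN (ltry _).

(** The case k = 0 is the semigroup law. Both sides are then differentiated in t; on
    the right the derivative passes under the integral because [dheat_sup_bound]
    bounds the integrand uniformly for t away from 0. *)
Lemma dheat_semigroup k (s t : R) x : 0 < s -> 0 < t ->
  dheat k f (s + t) x = \int[mu]_y (heat_kernel s y * dheat k f t (sub_tuple x y)).
Proof.
move=> s0; elim: k t x => [|k IH] t x t0.
  exact: (heat_semigroup (ltW p1)).
have mk := @measurable_heat_kernelr R n s.
have mD j u : 0 < u -> measurable_fun setT (fun y => dheat j f u (sub_tuple x y)).
  move=> u0; apply: (measurableT_comp (measurable_dheat (ltW p1) mf fp j u0)).
  exact: measurable_sub_tuple.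
have ik := integrable_heat_kernel n s0.
have bd j u M : 0 < u -> (forall y, `|dheat j f u y| <= M) ->
    mu.-integrable setT (EFin \o (fun y => heat_kernel s y * dheat j f u (sub_tuple x y))).
  move=> u0 HM; apply: (@le_integrable _ _ _ _ _ measurableT _
    (fun y => M%:E * (EFin \o @heat_kernel R n s) y)%E).
  - apply/measurable_EFinP; apply: measurable_funM => //; exact: mD.
  - move=> y _; rewrite /= lee_fin normrM (ger0_norm (heat_kernel_ge0 _ _)).
    rewrite [leRHS]ger0_norm; first by rewrite mulrC ler_wpM2r ?heat_kernel_ge0.
    by rewrite mulr_ge0 ?heat_kernel_ge0// (le_trans _ (HM y)).
  - by apply: integrableZl.
have [C [C0 HC]] := dheat_sup_bound k.+1.
have [C' [C'0 HC']] := dheat_sup_bound k.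
have t2 : 0 < t / 2 by rewrite divr_gt0.
pose M := C * (t / 2) `^ (- (k.+1%:R + nu / p)) * N.
have M0 : 0 <= M by rewrite !mulr_ge0 ?powR_ge0 ?(ltW C0).
have D1 : is_derive t 1 (fun u => \int[mu]_y (heat_kernel s y * dheat k f u (sub_tuple x y)))
    (\int[mu]_y (heat_kernel s y * dheat k.+1 f t (sub_tuple x y))).
  apply: (@is_derive_under_integral _ _ _ mu
    (fun u y => heat_kernel s y * dheat k f u (sub_tuple x y))
    (fun u y => heat_kernel s y * dheat k.+1 f u (sub_tuple x y)) t (t / 2) (2 * t)
    (fun y => M * heat_kernel s y)).
  - by lra.
  - move=> u /andP[u1 u2]; have u0 : 0 < u by lra.
    by apply: bd => // y; exact: (HC' p f N p1 N0 mf fN u y u0).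
  - move=> u y /andP[u1 u2]; have u0 : 0 < u by lra.
    apply: (is_derive_eq (is_deriveM (is_derive_cst (heat_kernel s y) u 1)
      (is_derive_dheat (ltW p1) mf fp k (sub_tuple x y) u0))).
    by rewrite /GRing.scale/= mulr0 addr0.
  - by move=> y; rewrite mulr_ge0// heat_kernel_ge0.
  - by rewrite (_ : _ \o _ = (fun y => M%:E * (EFin \o @heat_kernel R n s) y)%E)//; apply: integrableZl.
  - move=> u y /andP[u1 u2]; have u0 : 0 < u by lra.
    rewrite normrM (ger0_norm (heat_kernel_ge0 _ _)) mulrC ler_wpM2r ?heat_kernel_ge0//.
    apply: (le_trans (HC p f N p1 N0 mf fN u (sub_tuple x y) u0)).
    rewrite ler_wpM2r// ler_wpM2l ?(ltW C0)// ler_powRN//; first exact: ltW.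
    by rewrite addr_ge0// divr_ge0 ?(le_trans ler01 (ltW p1))// /nu divr_ge0.
have D2 : is_derive t 1 (fun u => dheat k f (s + u) x) (dheat k.+1 f (s + t) x).
  have st : 0 < s + t by lra.
  have H : is_derive t 1 (fun u : R => s + u) 1.
    by apply: (is_derive_eq (is_deriveD (is_derive_cst s t 1) (is_derive_id t (1 : R)))); rewrite add0r.
  have := @is_derive1_comp _ (fun u => dheat k f u x) (fun u : R => s + u) t _ _
    (is_derive_dheat (ltW p1) mf fp k x st) H.
  by move=> H'; apply: (is_derive_eq H'); rewrite mulr1.
have [_ <-] := D2; have [_ <-] := D1.
apply: near_eq_derive; near=> u; apply: IH; near: u; exact: lt_nbhsr.
Unshelve. all: by end_near.
Qed.

End fixed_function.

End heat_estimates.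

(** * Norm bounds with a real constant *)

Section Lp_bound.
Context d (T : measurableType d) (R : realType) (mu : {measure set T -> \bar R}).
Implicit Types (Q A B : R) (g : T -> R).

(** Norm bounds compare Q-th powers in the extended reals; this covers exponents
    below 1, and pointwise estimates can be integrated directly. *)
Definition Lp_le Q g A : Prop :=
  (\int[mu]_x (`|g x| `^ Q)%:E <= (A `^ Q)%:E)%E.

Lemma Lp_leP Q g A : 0 < Q -> 0 <= A ->
  Lp_le Q g A <-> ('N[mu]_Q%:E [EFin \o g] <= A%:E)%E.
Proof.
move=> Q0 A0; rewrite /Lp_le.
have -> : (\int[mu]_x (`|g x| `^ Q)%:E = 'N[mu]_Q%:E [EFin \o g] `^ Q)%E.
  by rewrite poweR_Lnorm ?gt_eqF//; apply: eq_integral.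
split=> [H|H]; last exact: (lee_poweR (ltW Q0) (Lnorm_ge0 _ _ _) H).
have := lee_poweR (ltW (etrans (invr_gt0 _) Q0)) (poweR_ge0 _ _) H.
by rewrite -!poweR_EFin -!poweRrM mulfV ?gt_eqF// !poweRe1 ?lee_fin ?Lnorm_ge0.
Qed.

Lemma Lp_leD Q g1 g2 A B : 1 <= Q -> 0 <= A -> 0 <= B ->
  measurable_fun setT g1 -> measurable_fun setT g2 ->
  Lp_le Q g1 A -> Lp_le Q g2 B -> Lp_le Q (fun x => g1 x + g2 x) (A + B).
Proof.
move=> Q1 A0 B0 m1 m2; have Q0 : 0 < Q by lra.
move=> /(Lp_leP _ Q0 A0) H1 /(Lp_leP _ Q0 B0) H2; apply/Lp_leP => //.
  exact: addr_ge0.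
have Q1' : (1 <= Q%:E)%E by rewrite lee_fin.
apply: (le_trans (eminkowski mu m1 m2 Q1')).
by rewrite EFinD leeD.
Qed.

Lemma Lp_leW Q g A B : 0 <= Q -> 0 <= A -> A <= B -> Lp_le Q g A -> Lp_le Q g B.
Proof.
move=> Q0 A0 AB /le_trans; apply.
by rewrite lee_fin ge0_ler_powR// nnegrE// (le_trans A0).
Qed.

End Lp_bound.

(** * Contraction and dyadic differences of the heat flow *)

Section heat_flow_estimates.
Variables (R : realType) (n : nat).
Let nu : R := n%:R / 2.
Local Notation mu := (lebesgue_tuple R n).
Variables (p N : R) (f : n.-tuple R -> R).
Hypotheses (p1 : 1 < p) (N0 : 0 <= N) (mf : measurable_fun setT f).
Hypothesis fN : Lp_le mu p f N.
Let fp := le_lt_trans fN (ltry _).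

Let mdheat k (t : R) : 0 < t -> measurable_fun setT (dheat k f t).
Proof. by move=> t0; exact: (measurable_dheat (ltW p1) mf fp). Qed.

Lemma dheat_jensen k Q (s t : R) x : 1 < Q -> 0 < s -> 0 < t ->
  ((`|dheat k f (s + t) x| `^ Q)%:E <=
   \int[mu]_y (heat_kernel s y * `|dheat k f t (sub_tuple x y)| `^ Q)%:E)%E.
Proof.
move=> Q1 s0 t0; rewrite (dheat_semigroup p1 N0 mf fN)//.
apply: heat_jensen => //; first exact: measurable_heat_kernelr.
  exact: mdheat.
by move=> y; rewrite ger0_norm// heat_kernel_ge0.
Qed.

Let mpow k Q (t : R) : 0 < t -> measurable_fun setT (fun x => `|dheat k f t x| `^ Q).
Proof.
move=> t0; apply: (measurableT_comp (measurable_powR Q)).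
by apply: (measurableT_comp (@normr_measurable R setT)); exact: mdheat.
Qed.

(** Jensen for the semigroup law; the kernel has unit mass. *)
Lemma dheat_contraction k Q (t u A : R) : 1 < Q -> 0 < t -> t <= u ->
  Lp_le mu Q (dheat k f t) A -> Lp_le mu Q (dheat k f u) A.
Proof.
move=> Q1 t0; rewrite le_eqVlt => /predU1P[<-//|tu]; apply: le_trans.
rewrite -(integral_heat_convolution (s := u - t) _ (mpow k Q t0) (fun=> powR_ge0 _ _)) ?subr_gt0//.
apply: le_integral_nomeas => x _; first by rewrite lee_fin powR_ge0.
rewrite -[in leLHS](subrK t u); apply: dheat_jensen => //.
by rewrite subr_gt0.
Qed.

Lemma dheat_pointwise k Q (s t : R) x : 1 < Q -> 0 < s -> 0 < t ->
  ((`|dheat k f (s + t) x| `^ Q)%:E <= ((4 * pi * s) `^ (- nu))%:E *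
    \int[mu]_y (`|dheat k f t y| `^ Q)%:E)%E.
Proof.
move=> Q1 s0 t0; apply: (le_trans (dheat_jensen k x Q1 s0 t0)).
by apply: heat_convolution_le => //; exact: mpow.
Qed.

(** The fundamental theorem of calculus in time. The right-hand side is written with
    the integral form of the derivative, which is jointly measurable in (t, x). *)
Lemma dheat_increment_le k (h : R) x : 0 < h ->
  (`|dheat k f (2 * h) x - dheat k f h x|%:E <=
   \int[lebesgue_measure]_t (\1_`[h, 2 * h] t *
     `|\int[mu]_y (dheat_kernel k.+1 t y * f (sub_tuple x y))|)%:E)%E.
Proof.
move=> h0; have h2 : h < 2 * h by lra.
have cont j t : h <= t -> {for t, continuous (fun t => dheat j f t x)}.
  move=> ht; have t0 : 0 < t by lra.
  apply: differentiable_continuous; apply/derivable1_diffP.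
  by have [] := is_derive_dheat (ltW p1) mf fp j x t0.
pose U t := \int[mu]_y (dheat_kernel k.+1 t y * f (sub_tuple x y)).
have UE t : h <= t -> dheat k.+1 f t x = U t.
  by move=> ht; rewrite (dheatE (ltW p1) mf fp)//; lra.
have mU : measurable_fun setT U.
  exact: (measurableT_comp (measurable_dheat_integral mf k.+1) (measurable_pair2 (T1 := measurableTypeR R) x)).
have ftc : (\int[lebesgue_measure]_(t in `[h, (2 * h)%R]) (U t)%:E =
    (dheat k f (2 * h) x - dheat k f h x)%:E)%E.
  rewrite EFinB -(@continuous_FTC2 R (fun t => dheat k.+1 f t x)
    (fun t => dheat k f t x) h (2 * h) h2).
  - apply: eq_integral => t; rewrite inE/= in_itv/= => /andP[ht _].
    by rewrite -UE.
  - apply: continuous_in_subspaceT => t; rewrite inE/= in_itv/= => /andP[ht _].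
    exact (cont k.+1 t ht).
  - split.
    + move=> t; rewrite in_itv/= => /andP[ht _].
      by have [] := is_derive_dheat (ltW p1) mf fp k x (lt_trans h0 ht).
    + by apply: cvg_at_right_filter; apply: cont.
    + by apply: cvg_at_left_filter; apply: cont; lra.
  - move=> t; rewrite in_itv/= => /andP[ht _].
    by rewrite derive1E; have [_ ->] := is_derive_dheat (ltW p1) mf fp k x (lt_trans h0 ht).
rewrite -abse_EFin -ftc.
have mU' : measurable_fun `[h, (2 * h)%R] (EFin \o U).
  by apply/measurable_EFinP; exact: measurable_funTS.
apply: (le_trans (le_abse_integral lebesgue_measure (measurable_itv _) mU')).
rewrite integral_mkcond; apply: le_integral_nomeas => t _.
  by rewrite patchE; case: ifPn.
by rewrite patchE indicE; case: ifPn => _; rewrite ?mul1r ?mul0r.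
Qed.

(** Minkowski's integral inequality for the increment over [h, 2 h], obtained from
    Jensen in t and Tonelli; the L^Q norms of the derivative decrease in time by
    [dheat_contraction], so the one at h bounds them all. *)
Lemma dheat_doubling k Q (h A B : R) : 1 < Q -> 0 < h -> 0 <= A -> 0 <= B ->
  Lp_le mu Q (dheat k f (2 * h)) A -> Lp_le mu Q (dheat k.+1 f h) B ->
  Lp_le mu Q (dheat k f h) (A + h * B).
Proof.
move=> Q1 h0 A0 B0 HA HB; have Q0 : 0 < Q by lra.
have h2 : 0 < 2 * h by lra.
have hB : 0 <= h * B by rewrite mulr_ge0// ltW.
pose D x := dheat k f h x - dheat k f (2 * h) x.
have -> : dheat k f h = fun x => dheat k f (2 * h) x + D x.
  by apply/funext => x; rewrite /D addrC subrK.
have mD : measurable_fun setT D by apply: measurable_funB; exact: mdheat.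
apply: Lp_leD => //; [exact: ltW|exact: mdheat|].
pose U (z : measurableTypeR R * n.-tuple R) :=
  `|\int[mu]_y (dheat_kernel k.+1 z.1 y * f (sub_tuple z.2 y))| : R.
have mU : measurable_fun setT U.
  by apply: (measurableT_comp (@normr_measurable R setT)); exact: measurable_dheat_integral.
pose w (t : measurableTypeR R) : R := \1_`[h, 2 * h] t.
have w0 t : 0 <= w t by [].
have mw : measurable_fun setT w by exact: measurable_indic.
have wh : (\int[lebesgue_measure]_t (w t)%:E = h%:E)%E.
  rewrite /w integral_indic// setIT [LHS]lebesgue_measure_itv/= lte_fin.
  by rewrite ifT -?EFinD; [congr EFin; lra|lra].
have mUp : measurable_fun setT (fun z : measurableTypeR R * n.-tuple R => (w z.1 * U z `^ Q)%:E).
  apply/measurable_EFinP; apply: measurable_funM.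
    exact: (measurableT_comp mw measurable_fst).
  exact: (measurableT_comp (measurable_powR Q) mU).
have Up0 z : (0 <= (w z.1 * U z `^ Q)%:E)%E by rewrite lee_fin mulr_ge0 ?powR_ge0.
have DU x : ((`|D x| `^ Q)%:E <=
    (\int[lebesgue_measure]_t (w t * U (t, x) `^ Q)%:E) * (h `^ (Q - 1))%:E)%E.
  have mUx : measurable_fun setT (fun t => U (t, x)).
    exact: (measurableT_comp mU (measurable_pair2 x)).
  have := powR_integral_le lebesgue_measure Q1 mw mUx w0 (fun=> normr_ge0 _).
  rewrite wh poweR_EFin; apply: le_trans.
  rewrite -poweR_EFin; apply: lee_poweR; rewrite ?(ltW Q0) ?lee_fin//.
  rewrite /D distrC; exact: dheat_increment_le.
have HT : (\int[mu]_x \int[lebesgue_measure]_t (w t * U (t, x) `^ Q)%:E <=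
    (h * B `^ Q)%:E)%E.
  rewrite -(fubini_tonelli _ mUp Up0) EFinM -wh.
  rewrite -ge0_integralZr//; first last.
  - by rewrite lee_fin powR_ge0.
  - by move=> t _; rewrite lee_fin.
  - exact/measurable_EFinP.
  apply: le_integral_nomeas => t _; first exact: integral_ge0.
  have [/set_mem|] := boolP (t \in `[h, 2 * h]%classic); rewrite /w indicE; last first.
    move=> /negbTE ->; rewrite mul0e.
    by rewrite (eq_integral (cst 0%E)) ?integral0// => x _; rewrite mul0r.
  move=> th; rewrite mem_set// mul1e; move: th; rewrite /= in_itv/= => /andP[ht _].
  under eq_integral do rewrite mul1r.
  have t0 : 0 < t := lt_le_trans h0 ht.
  apply: le_trans (dheat_contraction Q1 h0 ht HB).
  apply: le_integral_nomeas => x _; first by rewrite lee_fin powR_ge0.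
  by rewrite (dheatE (ltW p1) mf fp k.+1 x t0).
apply: (@le_trans _ _ (\int[mu]_x ((\int[lebesgue_measure]_t (w t * U (t, x) `^ Q)%:E) *
    (h `^ (Q - 1))%:E))%E).
  by apply: le_integral_nomeas => x _; [rewrite lee_fin powR_ge0|exact: DU].
rewrite ge0_integralZr//; first last.
- by rewrite lee_fin powR_ge0.
- by move=> x _; apply: integral_ge0 => t _; exact: (Up0 (t, x)).
- exact: (@measurable_fun_fubini_tonelli_G _ _ _ _ _ lebesgue_measure _ mUp Up0).
apply: (@le_trans _ _ ((h * B `^ Q)%:E * (h `^ (Q - 1))%:E)%E).
  by rewrite lee_wpmul2r ?lee_fin ?powR_ge0.
rewrite -EFinM lee_fin powRM ?(ltW h0)// mulrAC ler_wpM2r ?powR_ge0//.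
by rewrite mulr_powRB1 ?(ltW h0).
Qed.

End heat_flow_estimates.

(** * The heat kernel as an approximate identity *)

Section approximate_identity.
Variables (R : realType) (n : nat).
Let nu : R := n%:R / 2.
Local Notation mu := (lebesgue_tuple R n).
Implicit Types (F G : n.-tuple R -> R) (e : R).

(** An average oscillation of F at scale sqrt e. The weight [heat_kernel 1] in x makes
    it finite for every F of moderate growth, not only for integrable F. *)
Definition heat_osc e F : \bar R :=
  (\int[mu \x mu]_z (heat_kernel 1 z.1 *
    (heat_kernel e z.2 * `|F (sub_tuple z.1 z.2) - F z.1|))%:E)%E.

Let mkk e : measurable_fun setT
  (fun z : n.-tuple R * n.-tuple R => heat_kernel 1 z.1 * heat_kernel e z.2).
Proof.
apply: measurable_funM.
  exact: (measurableT_comp (@measurable_heat_kernelr R n 1) measurable_fst).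
exact: (measurableT_comp (@measurable_heat_kernelr R n e) measurable_snd).
Qed.

Let msub F : measurable_fun setT F ->
  measurable_fun setT (fun z : n.-tuple R * n.-tuple R => F (sub_tuple z.1 z.2)).
Proof. by move=> mF; apply: (measurableT_comp mF); exact: measurable_sub_tuple. Qed.

Let mosc e F : measurable_fun setT F -> measurable_fun setT
  (fun z : n.-tuple R * n.-tuple R => (heat_kernel 1 z.1 *
    (heat_kernel e z.2 * `|F (sub_tuple z.1 z.2) - F z.1|))%:E).
Proof.
move=> mF; apply/measurable_EFinP; under eq_fun do rewrite mulrA.
apply: measurable_funM => //.
apply: (measurableT_comp (@normr_measurable R setT)).
apply: measurable_funB; first exact: msub.
exact: (measurableT_comp mF measurable_fst).
Qed.

Let osc_ge0 e F (z : n.-tuple R * n.-tuple R) : (0 <= (heat_kernel 1 z.1 *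
    (heat_kernel e z.2 * `|F (sub_tuple z.1 z.2) - F z.1|))%:E)%E.
Proof. by rewrite lee_fin !mulr_ge0 ?powR_ge0 ?expR_ge0. Qed.

Lemma heat_osc_leD e F G1 G2 : measurable_fun setT G1 -> measurable_fun setT G2 ->
  (forall a b, `|F a - F b| <= `|G1 a - G1 b| + `|G2 a - G2 b|) ->
  (heat_osc e F <= heat_osc e G1 + heat_osc e G2)%E.
Proof.
move=> m1 m2 FG; rewrite /heat_osc -ge0_integralD//; try exact: mosc.
apply: le_integral_nomeas => z _; first exact: osc_ge0.
rewrite -EFinD lee_fin -!mulrDr ler_wpM2l ?heat_kernel_ge0//.
by rewrite ler_wpM2l ?heat_kernel_ge0.
Qed.

Lemma heat_osc_scale e c F G : 0 <= c -> measurable_fun setT G ->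
  (forall a b, `|F a - F b| <= c * `|G a - G b|) ->
  (heat_osc e F <= c%:E * heat_osc e G)%E.
Proof.
move=> c0 mG FG; rewrite /heat_osc -ge0_integralZl ?lee_fin//; last exact: mosc.
apply: le_integral_nomeas => z _; first exact: osc_ge0.
rewrite -EFinM lee_fin [leRHS]mulrCA ler_wpM2l ?heat_kernel_ge0//.
by rewrite [leRHS]mulrCA ler_wpM2l ?heat_kernel_ge0.
Qed.

Lemma heat_kernel_sub_tupleC e (x y : n.-tuple R) :
  heat_kernel e (sub_tuple x y) = heat_kernel e (sub_tuple y x).
Proof.
rewrite /heat_kernel (_ : sqnorm (sub_tuple x y) = sqnorm (sub_tuple y x))//.
by apply: eq_bigr => i _; rewrite !tnth_mktuple -sqrrN opprB.
Qed.

(** |F(x - y) - F(x)| <= |F(x - y)| + |F(x)|; convolving the weight with the kernel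
    turns it into the kernel at time 1 + e, and all times in [1, 2] are comparable
    with time 2. *)
Lemma heat_osc_bound e F : 0 < e -> e <= 1 -> measurable_fun setT F ->
  (heat_osc e F <=
   (2 * 2 `^ nu)%:E * \int[mu]_x (heat_kernel 2 x * `|F x|)%:E)%E.
Proof.
move=> e0 e1 mF.
have mF' : measurable_fun setT (fun x => `|F x|).
  exact: (measurableT_comp (@normr_measurable R setT)).
have k1 := @measurable_heat_kernelr R n 1.
have ke := @measurable_heat_kernelr R n e.
pose A (z : n.-tuple R * n.-tuple R) :=
  (heat_kernel 1 z.1 * (heat_kernel e z.2 * `|F (sub_tuple z.1 z.2)|))%:E.
pose B (z : n.-tuple R * n.-tuple R) :=
  (heat_kernel 1 z.1 * (heat_kernel e z.2 * `|F z.1|))%:E.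
have A0 z : (0 <= A z)%E by rewrite lee_fin !mulr_ge0 ?powR_ge0 ?expR_ge0.
have B0 z : (0 <= B z)%E by rewrite lee_fin !mulr_ge0 ?powR_ge0 ?expR_ge0.
have mA : measurable_fun setT A.
  apply/measurable_EFinP; under eq_fun do rewrite mulrA.
  by apply: measurable_funM => //; exact: (msub mF').
have mB : measurable_fun setT B.
  apply/measurable_EFinP; under eq_fun do rewrite mulrA.
  by apply: measurable_funM => //; exact: (measurableT_comp mF' measurable_fst).
have H : (heat_osc e F <= \int[mu \x mu]_z (A z + B z))%E.
  apply: le_integral_nomeas => z _; first exact: osc_ge0.
  rewrite -EFinD lee_fin -!mulrDr ler_wpM2l ?heat_kernel_ge0//.
  by rewrite ler_wpM2l ?heat_kernel_ge0// ler_normB.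
apply: (le_trans H); rewrite ge0_integralD//.
have G2 : measurable_fun setT (fun x => (heat_kernel 2 x * `|F x|)%:E).
  by apply/measurable_EFinP; apply: measurable_funM => //; exact: measurable_heat_kernelr.
have G20 x : (0 <= (heat_kernel 2 x * `|F x|)%:E)%E.
  by rewrite lee_fin mulr_ge0 ?heat_kernel_ge0.
set I := (\int[mu]_x (heat_kernel 2 x * `|F x|)%:E)%E.
have I0 : (0 <= I)%E by exact: integral_ge0.
have le2 u (x : n.-tuple R) : 1 <= u -> u <= 2 ->
    heat_kernel u x <= 2 `^ nu * heat_kernel 2 x.
  by move=> u1 u2; have := @heat_kernel_le R n 1 u 2 x ltr01 u1 u2; rewrite divr1.
have IA : (\int[mu \x mu]_z A z <= (2 `^ nu)%:E * I)%E.
  rewrite fubini_tonelli1//.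
  pose C (z : n.-tuple R * n.-tuple R) :=
    (heat_kernel e (sub_tuple z.1 z.2) * heat_kernel 1 z.1 * `|F z.2|)%:E.
  have C0 z : (0 <= C z)%E by rewrite lee_fin !mulr_ge0 ?powR_ge0 ?expR_ge0.
  have mke : measurable_fun setT (fun z : n.-tuple R * n.-tuple R =>
      heat_kernel e (sub_tuple z.1 z.2) * heat_kernel 1 z.1).
    apply: measurable_funM; first exact: msub.
    exact: (measurableT_comp k1 measurable_fst).
  have mC : measurable_fun setT C.
    apply/measurable_EFinP; apply: measurable_funM => //.
    exact: (measurableT_comp mF' measurable_snd).
  rewrite (_ : (\int[mu]_x fubini_F mu A x = \int[mu]_x \int[mu]_v C (x, v))%E); last first.
    apply: eq_integral => x _; rewrite /fubini_F.
    rewrite -(integral_sub_tuple x (g := fun v => C (x, v)))//; last first.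
      exact: (measurableT_comp mC (measurable_pair1 x)).
    by apply: eq_integral => y _; rewrite /C/= sub_tupleK /A/= mulrA (mulrC (heat_kernel 1 _)).
  rewrite (fubini_tonelli _ mC C0).
  rewrite (_ : (\int[mu]_v \int[mu]_x C (x, v) =
      \int[mu]_v (heat_kernel (e + 1) v * `|F v|)%:E)%E); last first.
    apply: eq_integral => v _; rewrite EFinM.
    rewrite -[X in (X * _)%E](integral_heat_kernelM v e0 ltr01).
    rewrite -ge0_integralZr; [|exact: measurableT| | |by rewrite lee_fin].
    - by apply: eq_integral => x _; rewrite /C/= heat_kernel_sub_tupleC.
    - apply/measurable_EFinP; apply: measurable_funM => //.
      by apply: (measurableT_comp ke); exact: measurable_sub_tuple.
    - by move=> x _; rewrite lee_fin mulr_ge0 ?heat_kernel_ge0.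
  rewrite /I -ge0_integralZl ?lee_fin ?powR_ge0//.
  apply: le_integral_nomeas => v _; first by rewrite lee_fin mulr_ge0 ?heat_kernel_ge0.
  by rewrite -EFinM lee_fin mulrA ler_wpM2r// le2//; lra.
have IB : (\int[mu \x mu]_z B z <= (2 `^ nu)%:E * I)%E.
  rewrite fubini_tonelli1//.
  rewrite (_ : (\int[mu]_x fubini_F mu B x = \int[mu]_x (heat_kernel 1 x * `|F x|)%:E)%E); last first.
    apply: eq_integral => x _; rewrite /fubini_F/B/=.
    under eq_integral do rewrite mulrCA EFinM.
    rewrite ge0_integralZr//.
    - by rewrite integral_heat_kernel// mul1e.
    - exact/measurable_EFinP.
    - by move=> y _; rewrite lee_fin heat_kernel_ge0.
    - by rewrite lee_fin mulr_ge0 ?heat_kernel_ge0.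
  rewrite /I -ge0_integralZl ?lee_fin ?powR_ge0//.
  apply: le_integral_nomeas => v _; first by rewrite lee_fin mulr_ge0 ?heat_kernel_ge0.
  by rewrite -EFinM lee_fin mulrA ler_wpM2r// le2//; lra.
apply: (le_trans (leeD IA IB)).
rewrite -ge0_muleDl ?lee_fin ?powR_ge0//.
by rewrite -EFinD (_ : 2 `^ nu + 2 `^ nu = 2 * 2 `^ nu)//; ring.
Qed.

Definition heat_vanish F : Prop := forall eta, 0 < eta ->
  exists2 delta, 0 < delta <= 1 & forall e, 0 < e -> e <= delta ->
    (heat_osc e F <= eta%:E)%E.

Lemma heat_vanishD F G1 G2 : measurable_fun setT G1 -> measurable_fun setT G2 ->
  (forall a b, `|F a - F b| <= `|G1 a - G1 b| + `|G2 a - G2 b|) ->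
  heat_vanish G1 -> heat_vanish G2 -> heat_vanish F.
Proof.
move=> m1 m2 FG v1 v2 eta eta0.
have eta2 : 0 < eta / 2 by lra.
have [d1 /andP[d10 d11] H1] := v1 _ eta2; have [d2 /andP[d20 d21] H2] := v2 _ eta2.
exists (Num.min d1 d2); first by rewrite lt_min d10 d20 ge_min d11.
move=> e e0; rewrite le_min => /andP[ed1 ed2].
apply: (le_trans (heat_osc_leD e m1 m2 FG)).
by rewrite (splitr eta) EFinD leeD ?H1 ?H2.
Qed.

Lemma heat_vanish_scale c F G : 0 <= c -> measurable_fun setT G ->
  (forall a b, `|F a - F b| <= c * `|G a - G b|) ->
  heat_vanish G -> heat_vanish F.
Proof.
move=> c0 mG FG v eta eta0.
have eta2 : 0 < eta / (c + 1) by rewrite divr_gt0//; lra.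
have [d1 dp H1] := v _ eta2; exists d1 => // e e0 ed1.
apply: (le_trans (heat_osc_scale e c0 mG FG)).
apply: (@le_trans _ _ (c%:E * (eta / (c + 1))%:E)%E).
  by rewrite lee_wpmul2l ?lee_fin// H1.
by rewrite -EFinM lee_fin mulrCA ger_pMr// ler_pdivrMr; lra.
Qed.

(** Functions with vanishing oscillation are closed under approximation in the
    weighted L^1 space, since [heat_osc_bound] is uniform in e. *)
Lemma heat_vanish_approx F : measurable_fun setT F ->
  (forall eta, 0 < eta -> exists G, [/\ measurable_fun setT G, heat_vanish G &
    (\int[mu]_x (heat_kernel 2 x * `|F x - G x|)%:E <= eta%:E)%E]) ->
  heat_vanish F.
Proof.
move=> mF approx eta eta0.
have c0 : 0 < 2 * 2 `^ nu by rewrite mulr_gt0 ?powR_gt0.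
have eta2 : 0 < eta / 2 by lra.
have eta3 : 0 < eta / 2 / (2 * 2 `^ nu) by rewrite divr_gt0.
have [G [mG vG HG]] := approx _ eta3.
have [d1 /andP[d10 d11] H1] := vG _ eta2.
exists d1; first by rewrite d10.
move=> e e0 ed1.
have mFG : measurable_fun setT (fun x => F x - G x) by exact: measurable_funB.
have FG a b : `|F a - F b| <= `|G a - G b| + `|(F a - G a) - (F b - G b)|.
  apply: le_trans (ler_normD _ _); rewrite le_eqVlt; apply/orP; left.
  by apply/eqP; congr (`|_|); ring.
apply: (le_trans (heat_osc_leD e mG mFG FG)).
rewrite (splitr eta) EFinD leeD ?H1//.
apply: (le_trans (heat_osc_bound e0 (le_trans ed1 d11) mFG)).
apply: (@le_trans _ _ ((2 * 2 `^ nu)%:E * (eta / 2 / (2 * 2 `^ nu))%:E)%E).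
  by rewrite lee_wpmul2l// lee_fin ltW.
by rewrite -EFinM lee_fin mulrC divfK// gt_eqF.
Qed.

End approximate_identity.

Section dominated_small.
Context d (T : measurableType d) (R : realType) (mu : {measure set T -> \bar R}).

(** Dominated convergence, in the form in which the approximations below use it. *)
Lemma dominated_small (g_ : nat -> T -> R) (G : T -> R) :
  (forall k, measurable_fun setT (g_ k)) -> mu.-integrable setT (EFin \o G) ->
  (forall k x, `|g_ k x| <= G x) ->
  {ae mu, forall x, g_ ^~ x @ \oo --> (0 : R)} ->
  forall eta, 0 < eta -> exists k, (\int[mu]_x `|g_ k x|%:E <= eta%:E)%E.
Proof.
move=> mg iG gG g0 eta eta0.
have mg' k : measurable_fun setT (EFin \o g_ k) by exact/measurable_EFinP.
have m0 : measurable_fun setT (cst 0%E : T -> \bar R) by exact: measurable_cst.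
have cvg0 : {ae mu, forall x, setT x -> (fun k => (EFin \o g_ k) x) @ \oo --> (cst 0%E : T -> \bar R) x}.
  apply: filterS g0 => x gx _; apply/fine_cvgP; split; [exact: nearW|exact: gx].
have dom : {ae mu, forall x k, setT x -> (`|(EFin \o g_ k) x| <= (EFin \o G) x)%E}.
  by apply/nearW => x k _; rewrite /= lee_fin.
have [_ + _] := dominated_convergence measurableT mg' m0 cvg0 iG dom.
move=> /fine_cvgP[[N1 _ H1]] /cvgrPdist_le/(_ _ eta0)[N2 _ H2].
exists (maxn N1 N2).
have := H1 _ (leq_maxl N1 N2); have := H2 _ (leq_maxr N1 N2).
rewrite /= sub0r normrN.
rewrite (eq_integral (fun x => `|g_ (maxn N1 N2) x|%:E)); last first.
  by move=> x _; rewrite /= subr0.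
move=> H /fineK <-; rewrite lee_fin; apply: le_trans H; exact: ler_norm.
Qed.

End dominated_small.

Section approximate_identity_sets.
Variables (R : realType) (n : nat).
Let nu : R := n%:R / 2.
Local Notation mu := (lebesgue_tuple R n).
Implicit Types (F G : n.-tuple R -> R) (e : R) (A B : set (n.-tuple R)).

(** The sets whose indicator has vanishing oscillation form a sigma-algebra. It
    contains the half-spaces, which generate the Borel sets, so it contains all of
    them; linear combinations and [heat_vanish_approx] then lead to all functions. *)
Let V A := measurable A /\ heat_vanish (\1_A : n.-tuple R -> R).

Let V0 : V set0.
Proof.
split => // eta eta0; exists 1; first by rewrite ltr01 lexx.
move=> e _ _; rewrite /heat_osc (eq_integral (cst 0%E)) ?integral0 ?lee_fin ?(ltW eta0)//.
by move=> z _; rewrite !indicE !in_set0 subrr normr0 !mulr0.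
Qed.

Let VC A : V A -> V (~` A).
Proof.
move=> [mA vA]; split; first exact: measurableC.
apply: (@heat_vanish_scale _ _ 1 _ (\1_A)) => //.
move=> a b; rewrite mul1r !indicE !in_setC.
by do 2 case: (_ \in A) => /=; rewrite ?subrr ?subr0 ?sub0r ?normrN.
Qed.

Let VU A B : V A -> V B -> V (A `|` B).
Proof.
move=> [mA vA] [mB vB]; split; first exact: measurableU.
apply: (@heat_vanishD _ _ _ (\1_A) (\1_B)) => //.
move=> a b; rewrite !indicE !in_setU.
by do 4 case: (_ \in _) => /=; rewrite ?subrr ?subr0 ?sub0r ?normrN ?normr0 ?normr1 ?addr0 ?add0r ?lexx ?ler01 ?lerDl.
Qed.

Let Vbigcup (A_ : (set (n.-tuple R))^nat) : (forall i, V (A_ i)) -> V (\bigcup_i A_ i).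
Proof.
move=> VA; have mA : measurable (\bigcup_i A_ i).
  by apply: bigcup_measurable => i _; have [] := VA i.
split => //; pose B_ k := \big[setU/set0]_(i < k) A_ i.
have VB k : V (B_ k).
  rewrite /B_; elim: k => [|k IH]; first by rewrite big_ord0.
  by rewrite big_ord_recr/=; exact: VU.
apply: heat_vanish_approx => // eta eta0.
pose g_ k (x : n.-tuple R) : R := heat_kernel 2 x * (\1_(\bigcup_i A_ i) x - \1_(B_ k) x).
have [] := @dominated_small _ _ _ mu g_ (heat_kernel 2) _ (integrable_heat_kernel _ _) _ _ eta eta0.
- move=> k; apply: measurable_funM; first exact: measurable_heat_kernelr.
  by apply: measurable_funB => //; apply: measurable_indic; have [] := VB k.
- by [].
- move=> k x; rewrite normrM ger0_norm ?heat_kernel_ge0// ler_piMr ?heat_kernel_ge0//.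
  rewrite !indicE.
  by do 2 case: (_ \in _) => /=; rewrite ?subrr ?subr0 ?sub0r ?normrN ?normr0 ?normr1.
- apply/nearW => x.
  have [[i _ Aix]|nAx] := pselect ((\bigcup_i A_ i) x); last first.
    apply: cvg_near_cst; apply/nearW => k; rewrite /g_ !indicE memNset// memNset ?subrr ?mulr0//.
    by move=> BK; apply: nAx; move: BK; rewrite /B_ -bigcup_mkord => -[j _ Ajx]; exists j.
  apply: cvg_near_cst; exists i.+1 => // k /= ik.
  rewrite /g_ !indicE mem_set; last by exists i.
  rewrite mem_set ?subrr ?mulr0//.
  by rewrite /B_ -bigcup_mkord; exists i.
move=> k Hk; exists (\1_(B_ k)); have [mB vB] := VB k; split => //.
apply: le_trans Hk; apply: le_integral_nomeas => x _.
  by rewrite lee_fin mulr_ge0 ?heat_kernel_ge0.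
by rewrite lee_fin /g_ normrM ger0_norm ?heat_kernel_ge0.
Qed.

(** w exp(- w) <= 2 exp(- w / 2): the factor |y|^2 costs one power of e, which makes
    large displacements unlikely. *)
Lemma heat_kernel_second_moment e (y : n.-tuple R) : 0 < e ->
  heat_kernel e y * sqnorm y <= 8 * 2 `^ nu * e * heat_kernel (2 * e) y.
Proof.
move=> e0; have p0 := @pi_gt0 R; have e4 : 0 < 4 * pi * e by rewrite !mulr_gt0.
set w := sqnorm y / (4 * e).
have w0 : 0 <= w by rewrite divr_ge0 ?sqnorm_ge0// ltW ?mulr_gt0.
have -> : sqnorm y = 4 * e * w by rewrite /w mulrC divfK// gt_eqF ?mulr_gt0.
rewrite /heat_kernel -/nu -/w (_ : 4 * pi * (2 * e) = 2 * (4 * pi * e)); last by ring.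
rewrite [in leRHS]powRM ?(ltW e4)// (powRN 2).
rewrite (_ : sqnorm y / (4 * (2 * e)) = 2^-1 * w); last by rewrite /w; field; rewrite gt_eqF.
have p2 : 2 `^ nu != 0 :> R by rewrite gt_eqF ?powR_gt0.
move: (2 `^ nu) p2 ((4 * pi * e) `^ (- nu)) (powR_ge0 (4 * pi * e) (- nu)) => q q0 A A0.
rewrite (_ : - w = - (2^-1 * w) + - (2^-1 * w)); last by field.
rewrite expRD; have := expR_ge1Dx (2^-1 * w).
have : expR (- (2^-1 * w)) * expR (2^-1 * w) = 1 by rewrite -expRD addNr expR0.
move: (expR_ge0 (- (2^-1 * w))).
move: (expR (- (2^-1 * w))) (expR (2^-1 * w)) => E E' E0 EE H.
have wE : w * E <= 2.
  have : (1 + 2^-1 * w) * E <= E' * E by rewrite ler_wpM2r.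
  by rewrite (mulrC E') EE; nra.
rewrite (_ : _ * (4 * e * w) = 4 * e * A * E * (w * E)); last by ring.
rewrite (_ : 8 * q * e * _ = 4 * e * A * E * 2); last by field.
by rewrite ler_wpM2l// !mulr_ge0// ltW.
Qed.

Lemma lebesgue_tuple_hyperplane (i : 'I_n) (a : R) :
  mu [set x | tnth x i = a] = 0%E.
Proof.
have mA j : measurable ((if j == i then [set a] else setT) : set R) by case: ifP.
have := lebesgue_tuple_box mA; rewrite (bigD1 i)//= eqxx lebesgue_measure_set1 mul0e => <-.
congr (mu _); apply/seteqP; split => x /=.
  by move=> xa j; case: ifP => // /eqP ->.
by move=> /(_ i); rewrite eqxx.
Qed.

(** A displacement by at most d in the i-th coordinate changes the indicator only in
    the slab of width 2 d around the boundary hyperplane. The slab has small mass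
    because the hyperplane is a null set, and larger displacements are rare by
    [heat_kernel_second_moment]. *)
Let Vhalf (i : 'I_n) (a : R) : V [set x | a < tnth x i].
Proof.
have mi : measurable_fun setT (fun x : n.-tuple R => tnth x i) by exact: measurable_tnth.
have mset (P : set R) : measurable P -> measurable [set x : n.-tuple R | P (tnth x i)].
  by move=> mP; rewrite -[X in measurable X]setTI; exact: mi.
have mS : measurable [set x : n.-tuple R | a < tnth x i].
  rewrite (_ : mkset _ = [set x : n.-tuple R | `]a, +oo[%classic (tnth x i)]); last first.
    by apply/seteqP; split => x /=; rewrite in_itv/= andbT.
  exact: mset.
split => // eta eta0.
pose S d := [set x : n.-tuple R | `[a - d, a + d]%classic (tnth x i)].
have mSd d : measurable (S d) by exact: mset.
have eta2 : 0 < eta / 2 by lra.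
have [d d0 Hd] : exists2 d, 0 < d &
    (\int[mu]_x (heat_kernel 1 x * \1_(S d) x)%:E <= (eta / 2)%:E)%E.
  pose g_ k (x : n.-tuple R) : R := heat_kernel 1 x * \1_(S k.+1%:R^-1) x.
  have g0 k x : 0 <= g_ k x by rewrite mulr_ge0 ?heat_kernel_ge0.
  have [] := @dominated_small _ _ _ mu g_ (heat_kernel 1) _ (integrable_heat_kernel _ _) _ _ (eta / 2) eta2.
  - move=> k; apply: measurable_funM; first exact: measurable_heat_kernelr.
    exact: measurable_indic.
  - by [].
  - move=> k x; rewrite ger0_norm// /g_ ler_piMr ?heat_kernel_ge0//.
  - exists [set x : n.-tuple R | tnth x i = a]; split.
    + rewrite (_ : mkset _ = [set x : n.-tuple R | [set a] (tnth x i)])//.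
      exact: mset.
    + exact: lebesgue_tuple_hyperplane.
    + move=> x /=; apply: contra_notP => xa.
      have xa0 : 0 < `|tnth x i - a| by rewrite normr_gt0 subr_eq0; exact/eqP.
      apply: cvg_near_cst.
      have : \forall k \near \oo, k.+1%:R^-1 < `|tnth x i - a| by exact: near_infty_natSinv_lt (PosNum xa0).
      apply: filterS => k hk; rewrite /g_ indicE memNset ?mulr0// /S /= in_itv/=.
      move: (k.+1%:R^-1 : R) hk => d hk /andP[h1 h2].
      move: hk; rewrite ltNge => /negP; apply.
      by rewrite ler_norml; apply/andP; split; lra.
  move=> k Hk; exists (k.+1%:R^-1); first by rewrite invr_gt0.
  apply: le_trans Hk; apply: le_integral_nomeas => x _; first by rewrite lee_fin g0.
  by rewrite lee_fin ger0_norm.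
(* Chebyshev: displacements beyond d have mass at most c e *)
pose c : R := 8 * 2 `^ nu / d ^+ 2.
have c0 : 0 < c by rewrite /c divr_gt0 ?exprn_gt0// mulr_gt0// powR_gt0.
exists (Num.min 1 (eta / 2 / c)).
  by rewrite lt_min ltr01 divr_gt0// ge_min lexx.
move=> e e0; rewrite le_min => /andP[e1 ec].
have k1 := @measurable_heat_kernelr R n 1.
have ke := @measurable_heat_kernelr R n e.
have mS1 : measurable_fun setT (fun x : n.-tuple R => \1_(S d) x : R) by exact: measurable_indic.
pose A (z : n.-tuple R * n.-tuple R) := ((heat_kernel 1 z.1 * \1_(S d) z.1) * heat_kernel e z.2)%:E.
pose B (z : n.-tuple R * n.-tuple R) := (heat_kernel 1 z.1 * (heat_kernel e z.2 * (sqnorm z.2 / d ^+ 2)))%:E.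
have sq0 (y : n.-tuple R) : 0 <= sqnorm y / d ^+ 2.
  by rewrite divr_ge0 ?sqnorm_ge0// exprn_ge0// ltW.
have A0 z : (0 <= A z)%E.
  by rewrite lee_fin mulr_ge0 ?heat_kernel_ge0// mulr_ge0 ?heat_kernel_ge0.
have B0 z : (0 <= B z)%E.
  by rewrite lee_fin mulr_ge0 ?heat_kernel_ge0// mulr_ge0 ?heat_kernel_ge0.
have mA : measurable_fun setT A.
  apply/measurable_EFinP; apply: measurable_funM.
    apply: measurable_funM; first exact: (measurableT_comp k1 measurable_fst).
    exact: (measurableT_comp mS1 measurable_fst).
  exact: (measurableT_comp ke measurable_snd).
have mq : measurable_fun setT (fun y : n.-tuple R => heat_kernel e y * (sqnorm y / d ^+ 2)).
  by apply: measurable_funM => //; apply: measurable_funM => //; exact: measurable_sqnorm.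
have mB : measurable_fun setT B.
  apply/measurable_EFinP; apply: measurable_funM.
    exact: (measurableT_comp k1 measurable_fst).
  exact: (measurableT_comp mq measurable_snd).
have H : (heat_osc e (\1_[set x : n.-tuple R | (a < tnth x i)%R]) <= \int[mu \x mu]_z (A z + B z))%E.
  apply: le_integral_nomeas => -[x y] _.
    by rewrite lee_fin mulr_ge0 ?heat_kernel_ge0// mulr_ge0 ?heat_kernel_ge0.
  rewrite /A /B /= -EFinD lee_fin -mulrA -mulrDr ler_wpM2l ?heat_kernel_ge0//.
  rewrite (mulrC (\1_(S d) x)) -mulrDr ler_wpM2l ?heat_kernel_ge0//.
  rewrite !indicE; have [xS|xS] := boolP (x \in S d).
    rewrite (@le_trans _ _ 1) ?lerDl//.
    by do 2 case: (_ \in _) => /=; rewrite ?subrr ?subr0 ?sub0r ?normrN ?normr0 ?normr1.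
  rewrite add0r; have [yd|yd] := leP `|tnth y i| d.
    rewrite (_ : (sub_tuple x y \in _) = (x \in [set x : n.-tuple R | a < tnth x i])).
      by rewrite subrr normr0.
    move: xS => /negP xS; have nS : ~ S d x by move=> h; apply: xS; exact: mem_set.
    move: yd; rewrite ler_norml => /andP[yd1 yd2].
    apply/idP/idP => /set_mem/=; rewrite ?tnth_mktuple => h; apply/mem_set => /=; rewrite ?tnth_mktuple.
      rewrite ltNge; apply/negP => h'; apply: nS; rewrite /S/= in_itv/=.
      by apply/andP; split; lra.
    rewrite ltNge; apply/negP => h'; apply: nS; rewrite /S/= in_itv/=.
    by apply/andP; split; lra.
  apply: (@le_trans _ _ 1).
    by do 2 case: (_ \in _) => /=; rewrite ?subrr ?subr0 ?sub0r ?normrN ?normr0 ?normr1.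
  rewrite ler_pdivlMr ?exprn_gt0// mul1r.
  rewrite /sqnorm (bigD1 i)//= -[tnth y i ^+ 2]real_normK ?num_real//.
  rewrite (@le_trans _ _ (`|tnth y i| ^+ 2))//.
    by rewrite lerXn2r ?nnegrE ?(ltW d0) ?(ltW yd).
  by rewrite lerDl; apply: sumr_ge0 => j _; exact: sqr_ge0.
apply: (le_trans H); rewrite ge0_integralD//.
rewrite (splitr eta) EFinD; apply: leeD.
  rewrite fubini_tonelli1//; apply: le_trans Hd.
  apply: le_integral_nomeas => x _; first exact: integral_ge0.
  rewrite /fubini_F /A/=; under eq_integral do rewrite EFinM.
  rewrite ge0_integralZl ?lee_fin ?mulr_ge0 ?powR_ge0 ?expR_ge0//.
  - by rewrite integral_heat_kernel// mule1.
  - exact/measurable_EFinP.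
  - by move=> y _; rewrite lee_fin heat_kernel_ge0.
have e2 : 0 < 2 * e by rewrite mulr_gt0.
have IBy : (\int[mu]_y (heat_kernel e y * (sqnorm y / d ^+ 2))%:E <= (c * e)%:E)%E.
  rewrite -[leRHS]mule1 -(integral_heat_kernel n e2) -ge0_integralZl//; first last.
  - by rewrite lee_fin mulr_ge0// ltW.
  - by move=> y _; rewrite lee_fin heat_kernel_ge0.
  - by apply/measurable_EFinP; exact: measurable_heat_kernelr.
  apply: le_integral_nomeas => y _.
    by rewrite lee_fin mulr_ge0 ?heat_kernel_ge0.
  rewrite -EFinM lee_fin mulrA ler_pdivrMr ?exprn_gt0//.
  apply: (le_trans (heat_kernel_second_moment _ e0)).
  rewrite /c le_eqVlt; apply/orP; left; apply/eqP; field; rewrite gt_eqF//.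
rewrite fubini_tonelli1//.
apply: (@le_trans _ _ (\int[mu]_x ((heat_kernel 1 x)%:E * (c * e)%:E))%E).
  apply: le_integral_nomeas => x _; first exact: integral_ge0.
  rewrite /fubini_F /B/=; under eq_integral do rewrite EFinM.
  rewrite ge0_integralZl ?lee_fin ?heat_kernel_ge0//.
  - by rewrite lee_wpmul2l ?lee_fin ?heat_kernel_ge0.
  - exact/measurable_EFinP.
  - by move=> y _; rewrite lee_fin mulr_ge0 ?heat_kernel_ge0.
have ce0 : (0 <= (c * e)%:E)%E by rewrite lee_fin ltW// mulr_gt0.
rewrite ge0_integralZr//.
- by rewrite integral_heat_kernel// mul1e lee_fin mulrC -ler_pdivlMr.
- exact/measurable_EFinP.
- by move=> y _; rewrite lee_fin heat_kernel_ge0.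
Qed.

Lemma heat_vanish_indic A : measurable A -> heat_vanish (\1_A : n.-tuple R -> R).
Proof.
suff : measurable `<=` V by move=> /(_ A) /[apply] -[].
apply: smallest_sub; first by split; [exact: V0|move=> B VB; rewrite setTD; exact: VC|exact: Vbigcup].
rewrite -bigcup_seq; apply: bigcup_sub => i _ _ [C mC <-]; rewrite setTI.
pose W : set (set R) := [set C | V [set x : n.-tuple R | C (tnth x i)]].
suff : (@ocitv R).-sigma.-measurable `<=` W by move=> /(_ C mC).
rewrite RGenOInfty.measurableE; apply: smallest_sub.
  split.
  - by rewrite /W /=; exact: V0.
  - by move=> B VB; rewrite setTD; exact: (VC VB).
  - move=> B_ VB; rewrite /W /=.
    rewrite (_ : mkset _ = \bigcup_k [set x : n.-tuple R | B_ k (tnth x i)]).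
      exact: Vbigcup.
    by apply/seteqP; split => x [k _ Bk]; exists k.
move=> _ [a ->]; rewrite /W /=.
rewrite (_ : mkset _ = [set x : n.-tuple R | a < tnth x i]); first exact: Vhalf.
by apply/seteqP; split => x /=; rewrite in_itv/= andbT.
Qed.

Lemma heat_vanish_sum (s : seq R) (h : R -> n.-tuple R -> R) :
  (forall r, measurable_fun setT (h r)) -> (forall r, heat_vanish (h r)) ->
  heat_vanish (fun x => \sum_(r <- s) h r x).
Proof.
move=> mh vh; elim: s => [|r s IH].
  apply: (@heat_vanish_scale _ _ 0 _ (h 0)) => // a b.
  by rewrite !big_nil subrr normr0 mul0r.
apply: (@heat_vanishD _ _ _ (h r) (fun x => \sum_(r <- s) h r x)) => //.
  by apply: measurable_sum.
move=> a b; rewrite !big_cons; apply: le_trans (ler_normD _ _).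
by rewrite le_eqVlt; apply/orP; left; apply/eqP; congr (`|_|); ring.
Qed.

Import HBNNSimple.

Lemma heat_vanish_nnsfun (g : {nnsfun n.-tuple R >-> R}) : heat_vanish (g : n.-tuple R -> R).
Proof.
pose h (r : R) (x : n.-tuple R) : R := r * \1_(g @^-1` [set r]) x.
have -> : (g : n.-tuple R -> R) = fun x => \sum_(r <- finmap.enum_fset (fset_set (range g))) h r x.
  by apply/funext => x; rewrite (fimfunE g x) fsbig_finite.
apply: heat_vanish_sum => r.
  by apply: measurable_funM => //; exact: measurable_indic.
apply: (@heat_vanish_scale _ _ `|r| _ (\1_(g @^-1` [set r]))) => //.
  by move=> a b; rewrite /h -mulrBr normrM.
exact: heat_vanish_indic.
Qed.

Let heat_vanish_ge0 F : measurable_fun setT F -> (forall x, 0 <= F x) ->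
  (\int[mu]_x (heat_kernel 2 x * F x)%:E < +oo)%E -> heat_vanish F.
Proof.
move=> mF F0 iF; have mF' : measurable_fun setT (EFin \o F) by exact/measurable_EFinP.
have mk := @measurable_heat_kernelr R n 2.
apply: heat_vanish_approx => // eta eta0.
pose a_ := nnsfun_approx measurableT mF'.
pose g_ k (x : n.-tuple R) : R := heat_kernel 2 x * (F x - a_ k x).
have aF k x : a_ k x <= F x.
  rewrite -lee_fin /a_ nnsfun_approxE.
  by apply: (@le_approx _ _ _ setT (EFin \o F)) => // y _; rewrite /= lee_fin.
have a0 k x : 0 <= a_ k x by [].
have [] := @dominated_small _ _ _ mu g_ (fun x => heat_kernel 2 x * F x) _ _ _ _ eta eta0.
- by move=> k; apply: measurable_funM => //; exact: measurable_funB.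
- apply/integrableP; split; first by apply/measurable_EFinP; exact: measurable_funM.
  rewrite (eq_integral (fun x => (heat_kernel 2 x * F x)%:E))// => x _.
  by rewrite /= ger0_norm// mulr_ge0 ?heat_kernel_ge0.
- move=> k x; rewrite normrM ger0_norm ?heat_kernel_ge0// ler_wpM2l ?heat_kernel_ge0//.
  by rewrite ger0_norm ?subr_ge0// lerBlDr lerDl.
- apply/nearW => x.
  have : (fun k => (a_ k x)%:E) @ \oo --> (F x)%:E.
    exact: (@cvg_nnsfun_approx _ _ _ _ measurableT _ mF' (fun x _ => F0 x : (0%:E <= (F x)%:E)%E) x I).
  move=> /fine_cvgP[_ /= aFx].
  rewrite -(mulr0 (heat_kernel 2 x)) -(subrr (F x)).
  by apply: cvgMl_tmp; apply: cvgB => //; exact: cvg_cst.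
move=> k Hk; exists (a_ k); split => //; first exact: heat_vanish_nnsfun.
apply: le_trans Hk; apply: le_integral_nomeas => x _.
  by rewrite lee_fin mulr_ge0 ?heat_kernel_ge0.
by rewrite lee_fin /g_ normrM ger0_norm ?heat_kernel_ge0.
Qed.

Lemma heat_vanish_integrable F : measurable_fun setT F ->
  (\int[mu]_x (heat_kernel 2 x * `|F x|)%:E < +oo)%E -> heat_vanish F.
Proof.
move=> mF iF.
pose P x := Num.max (F x) 0; pose M x := Num.max (- F x) 0.
have mP : measurable_fun setT P by exact: measurable_maxr.
have mM : measurable_fun setT M by apply: measurable_maxr => //; exact: measurableT_comp.
have P0 x : 0 <= P x by rewrite /P le_max lexx orbT.
have M0 x : 0 <= M x by rewrite /M le_max lexx orbT.
have FPM x : F x = P x - M x by rewrite /P /M; do 2 case: ltP => ?; lra.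
have PF x : P x <= `|F x| by rewrite /P ge_max normr_ge0 ler_norm.
have MF x : M x <= `|F x| by rewrite /M ge_max normr_ge0 -normrN ler_norm.
have bd (G : n.-tuple R -> R) : (forall x, 0 <= G x) -> (forall x, G x <= `|F x|) ->
    (\int[mu]_x (heat_kernel 2 x * G x)%:E < +oo)%E.
  move=> G0 GF; apply: le_lt_trans iF; apply: le_integral_nomeas => x _.
    by rewrite lee_fin mulr_ge0 ?heat_kernel_ge0.
  by rewrite lee_fin ler_wpM2l ?heat_kernel_ge0.
apply: (@heat_vanishD _ _ _ P M) => //; last 2 first.
- by apply: heat_vanish_ge0 => //; exact: bd.
- by apply: heat_vanish_ge0 => //; exact: bd.
move=> a b; rewrite !FPM.
rewrite (_ : _ - _ = (P a - P b) - (M a - M b)); last by ring.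
exact: ler_normB.
Qed.

End approximate_identity_sets.

(** * Bounds that pass to the limit at time zero *)

Section heat_limit.
Variables (R : realType) (n : nat).
Let nu : R := n%:R / 2.
Local Notation mu := (lebesgue_tuple R n).

(** The graph of x^Q lies above its tangent at b. This is Young's inequality for
    a and b^(Q - 1). *)
Lemma powR_tangent_le (a b Q : R) : 1 < Q -> 0 <= a -> 0 <= b ->
  b `^ Q <= a `^ Q + Q * b `^ (Q - 1) * `|a - b|.
Proof.
move=> Q1 a0 b0; have Q0 : 0 < Q by lra.
pose Q' := Q / (Q - 1).
have Q'0 : 0 < Q' by rewrite divr_gt0//; lra.
have QQ' : Q^-1 + Q'^-1 = 1 by rewrite /Q'; field; rewrite !gt_eqF//; lra.
have := conjugate_powR a0 (powR_ge0 b (Q - 1)) Q0 Q'0 QQ'.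
have -> : (b `^ (Q - 1)) `^ Q' = b `^ Q.
  by rewrite -powRrM; congr (_ `^ _); rewrite /Q'; field; rewrite gt_eqF//; lra.
have : b * b `^ (Q - 1) = b `^ Q by rewrite mulr_powRB1.
have -> : Q'^-1 = 1 - Q^-1 by rewrite -QQ' addrAC subrr add0r.
have := powR_ge0 b (Q - 1); have := ler_norm (b - a); rewrite distrC.
move: (b `^ (Q - 1)) (b `^ Q) (a `^ Q) `|a - b| => B BQ AQ d dab B0 BE H.
have H' : Q * (a * B) <= AQ + BQ * (Q - 1).
  rewrite (_ : AQ + BQ * (Q - 1) = Q * (AQ / Q + BQ * (1 - Q^-1))); last first.
    by field; rewrite gt_eqF.
  by rewrite ler_pM2l.
have : Q * B * (b - a) <= Q * B * d by rewrite ler_wpM2l// mulr_ge0// ltW.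
rewrite -BE in H' *; nra.
Qed.

Variables (p N : R) (f : n.-tuple R -> R).
Hypotheses (p1 : 1 < p) (N0 : 0 <= N) (mf : measurable_fun setT f).
Hypothesis fN : Lp_le mu p f N.
Let fp := le_lt_trans fN (ltry _).

Let iff : (\int[mu]_x (heat_kernel 2 x * `|f x|)%:E < +oo)%E.
Proof.
set A := (4 * pi * 2) `^ (- (n%:R / 2)) : R.
apply: (@le_lt_trans _ _ (\int[mu]_x ((heat_kernel 2 x)%:E + A%:E * (`|f x| `^ p)%:E))%E).
  apply: le_integral_nomeas => x _; first by rewrite lee_fin mulr_ge0 ?heat_kernel_ge0.
  rewrite -EFinM -EFinD lee_fin.
  rewrite (le_trans (ler_wpM2l (heat_kernel_ge0 _ _) (ler1_powR_normr (ltW p1) _)))//.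
  by rewrite mulrDr mulr1 lerD2l ler_wpM2r ?powR_ge0// heat_kernel_ub.
have mfa : measurable_fun setT (fun x => (`|f x| `^ p)%:E).
  apply/measurable_EFinP; apply: (measurableT_comp (measurable_powR p)).
  exact: (measurableT_comp (@normr_measurable R setT)).
rewrite ge0_integralD//; first last.
- exact: measurable_funeM.
- by move=> x _; rewrite mule_ge0 ?lee_fin ?powR_ge0.
- by apply/measurable_EFinP; exact: measurable_heat_kernelr.
- by move=> x _; rewrite lee_fin heat_kernel_ge0.
rewrite integral_heat_kernel// ge0_integralZl ?lee_fin ?powR_ge0//.
by apply: lte_add_pinfty; [exact: ltry|apply: lte_mul_pinfty; rewrite ?lee_fin ?powR_ge0].
Qed.

(** The kernel has unit mass, so P_t f(x) - f(x) is an average of f(x - y) - f(x). *)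
Let heat_diff (t : R) : 0 < t ->
  (\int[mu]_x (heat_kernel 1 x * `|dheat 0 f t x - f x|)%:E <= heat_osc t f)%E.
Proof.
move=> t0; have mk := @measurable_heat_kernelr R n t.
have mfs x : measurable_fun setT (fun y => f (sub_tuple x y)).
  by apply: (measurableT_comp mf); exact: measurable_sub_tuple.
have mh : measurable_fun setT (fun z : n.-tuple R * n.-tuple R => (heat_kernel 1 z.1 *
    (heat_kernel t z.2 * `|f (sub_tuple z.1 z.2) - f z.1|))%:E).
  apply/measurable_EFinP; apply: measurable_funM.
    exact: (measurableT_comp (@measurable_heat_kernelr R n 1) measurable_fst).
  apply: measurable_funM; first exact: (measurableT_comp mk measurable_snd).
  apply: (measurableT_comp (@normr_measurable R setT)); apply: measurable_funB.
    by apply: (measurableT_comp mf); exact: measurable_sub_tuple.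
  exact: (measurableT_comp mf measurable_fst).
rewrite /heat_osc fubini_tonelli1//; last first.
  by move=> z; rewrite lee_fin mulr_ge0 ?heat_kernel_ge0// mulr_ge0 ?heat_kernel_ge0.
apply: le_integral_nomeas => x _; first by rewrite lee_fin mulr_ge0 ?heat_kernel_ge0.
have md : measurable_fun setT (fun y => heat_kernel t y * (f (sub_tuple x y) - f x)).
  by apply: measurable_funM => //; apply: measurable_funB.
have -> : dheat 0 f t x - f x = \int[mu]_y (heat_kernel t y * (f (sub_tuple x y) - f x)).
  under [in RHS]eq_Rintegral => y _ do rewrite mulrBr (mulrC _ (f x)).
  have ik := integrable_heat_kernel n t0.
  have ikf : mu.-integrable setT (EFin \o (fun y => heat_kernel t y * f (sub_tuple x y))).
    have := integrable_dheat_kernel_shift (ltW p1) mf fp 0 x t0.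
    rewrite (_ : (fun y => dheat_kernel 0 t y * _) = (fun y => heat_kernel t y * f (sub_tuple x y)))//.
    by apply/funext => y; rewrite dheat_kernel0.
  rewrite RintegralB//; last first.
    rewrite (_ : _ \o _ = (fun y => (f x)%:E * (EFin \o @heat_kernel R n t) y)%E)//.
    exact: integrableZl.
  rewrite RintegralZl// (dheatE (ltW p1) mf fp)//; congr (_ - _).
    by apply: eq_Rintegral => y _; rewrite dheat_kernel0.
  by rewrite /Rintegral integral_heat_kernel// mulr1.
rewrite EFinM /fubini_F.
apply: (@le_trans _ _ ((heat_kernel 1 x)%:E *
    \int[mu]_y `|heat_kernel t y * (f (sub_tuple x y) - f x)|%:E)%E).
  by rewrite lee_wpmul2l ?lee_fin ?heat_kernel_ge0// Rintegral_norm_le.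
rewrite -ge0_integralZl ?lee_fin ?heat_kernel_ge0//; last first.
  apply/measurable_EFinP; exact: (measurableT_comp (@normr_measurable R setT)).
apply: le_integral_nomeas => y _.
  by rewrite mule_ge0// lee_fin heat_kernel_ge0.
by rewrite -EFinM lee_fin normrM (ger0_norm (heat_kernel_ge0 _ _)).
Qed.

(** On the set where |f| and |x|^2 are at most k, [powR_tangent_le] bounds |f|^Q by
    |P_t f|^Q plus a constant times |P_t f - f|, whose integral vanishes along the
    given times. Monotone convergence in k removes the restriction. *)
Lemma Lp_le_heat_limit (Q L : R) : 1 < Q -> 0 <= L ->
  (forall delta, 0 < delta -> exists t, [/\ 0 < t, t <= delta &
    Lp_le mu Q (dheat 0 f t) L]) ->
  Lp_le mu Q f L.
Proof.
move=> Q1 L0 HL; have Q0 : 0 < Q by lra.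
have p4 : 0 < 4 * pi * 1 :> R by rewrite !mulr_gt0 ?pi_gt0.
have mfQ : measurable_fun setT (fun x => `|f x| `^ Q).
  apply: (measurableT_comp (measurable_powR Q)).
  exact: (measurableT_comp (@normr_measurable R setT)).
pose E (k : nat) := [set x : n.-tuple R | `|f x| <= k%:R] `&` [set x | sqnorm x <= k%:R].
have mE k : measurable (E k).
  have ray : measurable `]-oo, (k%:R : R)]%classic by exact: measurable_itv.
  apply: measurableI.
    rewrite (_ : [set x | _] = setT `&` (fun x => `|f x|) @^-1` `]-oo, (k%:R : R)]%classic).
      by apply: (measurableT_comp (@normr_measurable R setT) mf).
    by rewrite setTI; apply/seteqP; split => x /=; rewrite in_itv.
  rewrite (_ : [set x | _] = setT `&` (@sqnorm R n) @^-1` `]-oo, (k%:R : R)]%classic).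
    by apply: measurable_sqnorm.
  by rewrite setTI; apply/seteqP; split => x /=; rewrite in_itv.
have ndE : nondecreasing_seq E.
  move=> i j ij; apply/subsetPset => x [/= h1 h2].
  by split; rewrite /= (le_trans h1, le_trans h2) ?ler_nat.
have UE : \bigcup_k E k = setT.
  apply/seteqP; split => // x _.
  have m0 : 0 <= `|f x| + sqnorm x by rewrite addr_ge0 ?sqnorm_ge0.
  exists (Num.truncn (`|f x| + sqnorm x)).+1 => //.
  have h := ltW (truncnS_gt (`|f x| + sqnorm x)).
  split => /=; apply: le_trans h; [by rewrite lerDl sqnorm_ge0|by rewrite lerDr].
have IE k : (\int[mu]_(x in E k) (`|f x| `^ Q)%:E <= (L `^ Q)%:E)%E.
  (* a lower bound for the weight where |x|^2 <= k *)
  pose c : R := (4 * pi * 1) `^ (- (n%:R / 2)) * expR (- (k%:R / (4 * 1))).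
  have c0 : 0 < c by rewrite mulr_gt0 ?powR_gt0 ?expR_gt0.
  pose M := Q * k%:R `^ (Q - 1) / c.
  have M0 : 0 <= M by rewrite divr_ge0 ?(ltW c0)// mulr_ge0 ?powR_ge0// ltW.
  apply/lee_addgt0Pr => eta eta0.
  have eM : 0 < eta / (M + 1) by rewrite divr_gt0//; lra.
  have [d /andP[d0 d1] Hd] := heat_vanish_integrable mf iff eM.
  have [t [t0 td Ht]] := HL _ d0.
  have mD := measurable_dheat (ltW p1) mf fp 0 t0.
  rewrite integral_mkcond.
  apply: (@le_trans _ _ (\int[mu]_x ((`|dheat 0 f t x| `^ Q)%:E +
      M%:E * (heat_kernel 1 x * `|dheat 0 f t x - f x|)%:E))%E).
    apply: le_integral_nomeas => x _.
      by rewrite patchE; case: ifPn => // _; rewrite lee_fin powR_ge0.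
    rewrite patchE; case: ifPn => [/set_mem[/= fk sk]|_]; last first.
      rewrite -EFinM -EFinD lee_fin addr_ge0 ?powR_ge0//.
      by rewrite mulr_ge0// mulr_ge0 ?heat_kernel_ge0.
    rewrite -EFinM -EFinD lee_fin.
    apply: (le_trans (powR_tangent_le Q1 (normr_ge0 (dheat 0 f t x)) (normr_ge0 (f x)))).
    rewrite lerD2l.
    have ck : c <= heat_kernel 1 x.
      by rewrite ler_wpM2l ?powR_ge0// ler_expR lerN2 ler_pM2r// invr_gt0 mulr_gt0.
    apply: (@le_trans _ _ (Q * k%:R `^ (Q - 1) * `|dheat 0 f t x - f x|)).
      apply: ler_pM => //; rewrite ?mulr_ge0 ?powR_ge0 ?(ltW Q0)//.
        rewrite ler_wpM2l ?(ltW Q0)// ge0_ler_powR ?nnegrE//; lra.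
      exact: ler_dist_dist.
    rewrite mulrA ler_wpM2r// /M mulrAC ler_pdivlMr//.
    by rewrite ler_wpM2l// mulr_ge0 ?powR_ge0 ?(ltW Q0).
  have mk1 := @measurable_heat_kernelr R n 1.
  have mB : measurable_fun setT (fun x => (heat_kernel 1 x * `|dheat 0 f t x - f x|)%:E).
    apply/measurable_EFinP; apply: measurable_funM => //.
    apply: (measurableT_comp (@normr_measurable R setT)); exact: measurable_funB.
  have B0 x : (0 <= (heat_kernel 1 x * `|dheat 0 f t x - f x|)%:E)%E.
    by rewrite lee_fin mulr_ge0 ?heat_kernel_ge0.
  rewrite ge0_integralD//; first last.
  - exact: measurable_funeM.
  - by move=> x _; rewrite mule_ge0 ?B0 ?lee_fin.
  - apply/measurable_EFinP; apply: (measurableT_comp (measurable_powR Q)).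
    exact: (measurableT_comp (@normr_measurable R setT)).
  apply: leeD => //; rewrite ge0_integralZl ?lee_fin//.
  apply: (@le_trans _ _ (M%:E * (eta / (M + 1))%:E)%E).
    by rewrite lee_wpmul2l ?lee_fin// (le_trans (heat_diff t0))// Hd.
  by rewrite -EFinM lee_fin mulrCA ger_pMr// ler_pdivrMr; lra.
have := @ge0_nondecreasing_set_cvg_integral _ _ R E (fun x => (`|f x| `^ Q)%:E) mu ndE mE _ _.
rewrite UE => H.
have {H} H : (\int[mu]_(x in E i) (`|f x| `^ Q)%:E @[i --> \oo] --> \int[mu]_x (`|f x| `^ Q)%:E)%E.
  apply: H => [i|i x _]; last by rewrite lee_fin powR_ge0.
  by apply/measurable_EFinP; exact: measurable_funTS.
rewrite /Lp_le -(cvg_lim _ H)//; apply: lime_le; first by apply/cvg_ex; eexists; exact: H.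
exact: nearW.
Qed.

End heat_limit.

(** * The bootstrap *)

Section self_improvement.
Variable R : realType.

(** The least upper bound satisfies every inequality M <= phi M that holds with any
    upper bound M on the right. Finiteness is what makes it useful: M can then be
    cancelled from both sides. *)
Lemma self_improving_bound (T : Type) (a : T -> R) (phi : R -> R) (x0 : T) :
  (forall x, 0 <= a x) -> (exists M, forall x, a x <= M) ->
  (forall M, 0 <= M -> (forall x, a x <= M) -> forall x, a x <= phi M) ->
  exists M, [/\ 0 <= M, forall x, a x <= M & M <= phi M].
Proof.
move=> a0 [M0 aM0] H.
have hs : has_sup (range a).
  by split; [exists (a x0), x0|exists M0 => _ [x _ <-]].
have aS x : a x <= sup (range a) by apply: ub_le_sup; [exact: hs.2|exists x].
exists (sup (range a)); split => //; first exact: le_trans (a0 x0) (aS x0).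
apply: ge_sup; first exact: hs.1.
by move=> _ [x _ <-]; apply: H => //; exact: le_trans (a0 x0) (aS x0).
Qed.

End self_improvement.

Section Lp_interpolation.
Context d (T : measurableType d) (R : realType) (mu : {measure set T -> \bar R}).

(** |g|^Q <= S^(Q - r) |g|^r. *)
Lemma Lp_le_interpolation (r Q S A : R) (g : T -> R) :
  0 < r -> r <= Q -> 0 <= S -> 0 <= A -> measurable_fun setT g ->
  (forall x, `|g x| <= S) -> Lp_le mu r g A ->
  Lp_le mu Q g (S `^ (1 - r / Q) * A `^ (r / Q)).
Proof.
move=> r0 rQ S0 A0 mg gS gA; have Q0 : 0 < Q by lra.
rewrite /Lp_le powRM ?powR_ge0// -!powRrM divfK ?gt_eqF//.
rewrite (_ : (1 - r / Q) * Q = Q - r); last by field; rewrite gt_eqF.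
have mgr : measurable_fun setT (fun x => (`|g x| `^ r)%:E).
  apply/measurable_EFinP; apply: (measurableT_comp (measurable_powR r)).
  exact: (measurableT_comp (@normr_measurable R setT)).
apply: (@le_trans _ _ ((S `^ (Q - r))%:E * \int[mu]_x (`|g x| `^ r)%:E)%E); last first.
  by rewrite EFinM lee_wpmul2l ?lee_fin ?powR_ge0.
rewrite -ge0_integralZl ?lee_fin ?powR_ge0//.
apply: le_integral_nomeas => x _; first by rewrite lee_fin powR_ge0.
rewrite -EFinM lee_fin (_ : Q = (Q - r) + r); last by rewrite subrK.
rewrite powRD; last first.
  by rewrite subrK gt_eqF.
rewrite addrK ler_wpM2r ?powR_ge0// ge0_ler_powR ?nnegrE ?subr_ge0//.
Qed.

End Lp_interpolation.

Section bootstrap.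
Variables (R : realType) (n : nat).
Let nu : R := n%:R / 2.
Hypothesis n0 : (0 < n)%N.
Let nu0 : 0 < nu. Proof. by rewrite divr_gt0// ltr0n. Qed.
Local Notation mu := (lebesgue_tuple R n).

(** The L^p bound on f only gives |d^m P_h f| <= C h^(- m - b) with b = nu / p, too
    singular at h = 0 for h^m |d^m P_h f| to be known to be bounded. Dividing by this
    weight makes the supremum finite. The weight changes by a bounded factor when h is
    halved, uniformly in a, and it is 2 at h = a; as a is arbitrary, it leaves no trace
    in the final bounds. *)
Definition blowup_weight (b a h : R) : R := 1 + (a / h) `^ b.

Lemma blowup_weight_ge1 b a h : 1 <= blowup_weight b a h.
Proof. by rewrite lerDl powR_ge0. Qed.

Lemma blowup_weight_le b a h h' : 0 <= b -> 0 < a -> 0 < h -> h <= h' ->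
  blowup_weight b a h' <= blowup_weight b a h.
Proof.
move=> b0 a0 h0 hh; have h'0 := lt_le_trans h0 hh.
rewrite lerD2l ge0_ler_powR ?nnegrE ?divr_ge0 ?(ltW a0) ?(ltW h0) ?(ltW h'0)//.
by rewrite ler_pM2l// lef_pV2 ?posrE.
Qed.

Lemma blowup_weight_half b a h : 0 <= b -> 0 < a -> 0 < h ->
  blowup_weight b a (h / 2) <= 2 `^ b * blowup_weight b a h.
Proof.
move=> b0 a0 h0; rewrite /blowup_weight mulrDr mulr1.
rewrite (_ : a / (h / 2) = 2 * (a / h)); last by field; rewrite gt_eqF.
rewrite (powRM _ (ler0n R 2)) ?divr_ge0 ?(ltW a0) ?(ltW h0)// lerD2r.
by rewrite -[leLHS](powRr0 (2 : R)) ler_powR// ler1n.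
Qed.

Lemma blowup_weight_dom b a h : 0 < a -> 0 < h ->
  h `^ (- b) <= a `^ (- b) * blowup_weight b a h.
Proof.
move=> a0 h0; rewrite /blowup_weight mulrDr mulr1 powRM ?invr_ge0 ?(ltW a0) ?(ltW h0)//.
rewrite mulrA -powRD; last by rewrite [X in _ ==> ~~ X]gt_eqF ?implybT.
rewrite addNr powRr0 mul1r -(powR_inv1 (ltW h0)) -powRrM mulN1r.
by rewrite lerDr powR_ge0.
Qed.

(** Interpolation between the bounds in sup norm and in L^p. *)
Lemma Lp_le_dheat k (p Q : R) : 1 < p -> p <= Q -> exists C : R, 0 < C /\
  forall f N, 0 <= N -> measurable_fun setT f -> Lp_le mu p f N ->
  forall t, 0 < t ->
    Lp_le mu Q (dheat k f t) (C * t `^ (nu / Q - k%:R - nu / p) * N).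
Proof.
move=> p1 pQ; have p0 : 0 < p by lra.
have Q0 : 0 < Q by lra.
have [C1 [C10 H1]] := @dheat_sup_bound R n k.
have [C2 [C20 H2]] := @dheat_Lp_bound R n k.
exists (C1 `^ (1 - p / Q) * C2 `^ (p / Q)); split; first by rewrite mulr_gt0 ?powR_gt0.
move=> f N N0 mf fN t t0.
have fp := le_lt_trans fN (ltry _).
have S0 : 0 <= C1 * t `^ (- (k%:R + nu / p)) * N by rewrite !mulr_ge0 ?powR_ge0 ?(ltW C10).
have A0 : 0 <= C2 * t `^ (- k%:R) * N by rewrite !mulr_ge0 ?powR_ge0 ?(ltW C20).
have := Lp_le_interpolation p0 pQ S0 A0 (measurable_dheat (ltW p1) mf fp k t0)
  (fun x => H1 p f N p1 N0 mf fN t x t0) (H2 p f N p1 N0 mf fN t t0).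
congr (Lp_le mu Q _ _).
rewrite !powRM ?mulr_ge0 ?powR_ge0 ?(ltW C10) ?(ltW C20)//.
rewrite -!powRrM mulrACA [X in X * _ = _]mulrACA; congr (_ * _ * _).
  rewrite -powRD; last by rewrite [X in _ ==> ~~ X]gt_eqF ?implybT.
  by congr (_ `^ _); field; rewrite !gt_eqF.
rewrite -powRD; last by rewrite subrK oner_eq0.
by rewrite subrK powRr1.
Qed.

Section sup_bound.
Variables (p r Q : R) (m : nat).
Hypotheses (p1 : 1 < p) (r0 : 0 < r) (rQ : r < Q) (Q1 : 1 < Q).
Hypothesis m_large : nu / r < m%:R.
Let theta := r / Q.
Let b := nu / p.

Let Q0 : 0 < Q. Proof. exact: lt_trans Q1. Qed.
Let th0 : 0 < theta. Proof. by rewrite divr_gt0. Qed.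
Let th1 : theta < 1. Proof. by rewrite ltr_pdivrMr ?mul1r. Qed.
Let b0 : 0 <= b. Proof. by rewrite divr_ge0 ?(ltW nu0) ?(le_trans ler01 (ltW p1)). Qed.
Let eQ : nu / Q <= m%:R.
Proof.
rewrite (le_trans _ (ltW m_large))// ler_pM2l// lef_pV2 ?posrE//; exact: ltW.
Qed.

(** The only information kept from the norms of the theorem: a bound in L^r at one
    time of each dyadic interval. As r may be less than 1, it cannot be carried to
    other times directly. *)
Definition sparse_Lp_le (f : n.-tuple R -> R) (B : R) : Prop :=
  forall h, 0 < h -> exists t, [/\ h / 2 <= t, t <= h &
    Lp_le mu r (dheat m f t) (B * t `^ (nu / r - m%:R))].

Let K1 : R := 2 `^ (m%:R - nu / Q + b).
Let K10 : 0 < K1. Proof. exact: powR_gt0. Qed.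

(** At the sparse time t, interpolate between the assumed supremum and the bound in
    L^r. The result is a bound in L^Q with Q > 1, which [dheat_contraction] carries
    from t to h at the cost of a constant, because t >= h / 2. *)
Lemma Lp_le_of_sup f N B M a : 0 <= N -> 0 < B -> 0 <= M -> 0 < a ->
  measurable_fun setT f -> Lp_le mu p f N -> sparse_Lp_le f B ->
  (forall h x, 0 < h -> `|dheat m f h x| <= M * h `^ (- m%:R) * blowup_weight b a h) ->
  forall h, 0 < h -> Lp_le mu Q (dheat m f h)
    (K1 * M `^ (1 - theta) * B `^ theta * h `^ (nu / Q - m%:R) * blowup_weight b a h).
Proof.
move=> N0 B0 M0 a0 mf fN HB HM h h0.
have fp := le_lt_trans fN (ltry _).
have [t [t1 t2 Ht]] := HB h h0; have t0 : 0 < t by lra.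
have w1 u := blowup_weight_ge1 b a u.
have w0 u : 0 <= blowup_weight b a u by rewrite (le_trans ler01).
have S0 : 0 <= M * t `^ (- m%:R) * blowup_weight b a t by rewrite !mulr_ge0 ?powR_ge0.
have A0 : 0 <= B * t `^ (nu / r - m%:R) by rewrite mulr_ge0 ?powR_ge0 ?(ltW B0).
have := Lp_le_interpolation r0 (ltW rQ) S0 A0 (measurable_dheat (ltW p1) mf fp m t0)
  (fun x => HM t x t0) Ht.
move=> /(dheat_contraction p1 N0 mf fN Q1 t0 t2).
apply: Lp_leW; rewrite ?(ltW Q0)// ?mulr_ge0 ?powR_ge0//.
rewrite -/theta !powRM ?mulr_ge0 ?powR_ge0 ?(ltW B0)//.
have rearrange (u v w y z : R) : u * v * w * (y * z) = u * y * (v * z) * w by ring.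
rewrite rearrange.
rewrite -!powRrM -powRD; last by rewrite [X in _ ==> ~~ X]gt_eqF ?implybT.
rewrite (_ : - m%:R * (1 - theta) + _ = nu / Q - m%:R); last first.
  by rewrite /theta; field; rewrite !gt_eqF.
rewrite (_ : K1 * _ * _ * _ * _ = M `^ (1 - theta) * B `^ theta *
  (2 `^ (m%:R - nu / Q) * h `^ (nu / Q - m%:R)) * (2 `^ b * blowup_weight b a h)); last first.
  by rewrite /K1 powRD; [ring|rewrite [X in _ ==> ~~ X]gt_eqF ?implybT].
rewrite ler_pM ?mulr_ge0 ?powR_ge0//.
  rewrite ler_wpM2l ?mulr_ge0 ?powR_ge0//.
  rewrite (_ : 2 `^ (m%:R - nu / Q) * _ = (h / 2) `^ (- (m%:R - nu / Q))).
    by rewrite -opprB ler_powRN ?subr_ge0// divr_gt0.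
  rewrite powRM ?invr_ge0 ?(ltW h0)// mulrC opprB; congr (_ * _).
  by rewrite -(powR_inv1 (ler0n R 2)) -powRrM; congr (_ `^ _); ring.
apply: (@le_trans _ _ (blowup_weight b a t)).
  by rewrite -[leRHS]powRr1// ler_powR// lerBlDr lerDl ltW.
apply: (le_trans _ (blowup_weight_half b0 a0 h0)).
by apply: blowup_weight_le => //; rewrite divr_gt0.
Qed.

Let K2 : R := (K1 * 2 `^ (m%:R + b)) `^ theta^-1.

(** If M is the weighted supremum, [Lp_le_of_sup] bounds the L^Q norm at time h / 2 by
    a multiple of M^(1 - theta) B^theta, and the kernel over another time h / 2 turns
    this into a bound for the supremum. Hence M <= K^theta M^(1 - theta), that is,
    M <= K. *)
Lemma dheat_sup_bootstrap f N B : 0 <= N -> 0 < B ->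
  measurable_fun setT f -> Lp_le mu p f N -> sparse_Lp_le f B ->
  forall h x a, 0 < h -> 0 < a ->
    `|dheat m f h x| <= K2 * B * h `^ (- m%:R) * blowup_weight b a h.
Proof.
move=> N0 B0 mf fN HB h x a h0 a0.
have w1 u := blowup_weight_ge1 b a u.
have w0 u : 0 < blowup_weight b a u by rewrite (lt_le_trans ltr01).
pose T := ({u : R | 0 < u} * n.-tuple R)%type.
pose g (z : T) := `|dheat m f (sval z.1) z.2| /
  (sval z.1 `^ (- m%:R) * blowup_weight b a (sval z.1)).
have den (u : R) : 0 < u -> 0 < u `^ (- m%:R) * blowup_weight b a u.
  by move=> u0; rewrite mulr_gt0 ?powR_gt0.
have g0 z : 0 <= g z by rewrite divr_ge0// ltW// den// (svalP z.1).
pose K := K2 * B.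
have K20 : 0 < K2 by rewrite powR_gt0 ?mulr_gt0 ?powR_gt0.
pose phi M := K `^ theta * M `^ (1 - theta).
have [C [C0 HC]] := @dheat_sup_bound R n m.
have bdd : exists M, forall z, g z <= M.
  (* finite a priori: [dheat_sup_bound] and h^(- b) <= a^(- b) (1 + (a / h)^b) *)
  exists (C * N * a `^ (- b)) => -[[u u0] y]; rewrite /g/= ler_pdivrMr ?den//.
  apply: (le_trans (HC p f N p1 N0 mf fN u y u0)).
  rewrite opprD powRD; last by rewrite [X in _ ==> ~~ X]gt_eqF ?implybT.
  rewrite (_ : C * _ * N = C * N * u `^ (- m%:R) * u `^ (- b)); last by ring.
  rewrite (_ : C * N * a `^ _ * _ = C * N * u `^ (- m%:R) *
    (a `^ (- b) * blowup_weight b a u)); last by ring.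
  by rewrite ler_wpM2l ?mulr_ge0 ?powR_ge0 ?(ltW C0)// blowup_weight_dom.
have step M : 0 <= M -> (forall z, g z <= M) -> forall z, g z <= phi M.
  move=> M0 gM [[u u0] y]; rewrite /g/= ler_pdivrMr ?den//.
  have HM v z : 0 < v -> `|dheat m f v z| <= M * v `^ (- m%:R) * blowup_weight b a v.
    move=> v0; have := gM (exist _ v v0, z).
    by rewrite /g/= ler_pdivrMr ?den// mulrA.
  have u2 : 0 < u / 2 by rewrite divr_gt0.
  have L := Lp_le_of_sup N0 B0 M0 a0 mf fN HB HM u2.
  have := dheat_pointwise p1 N0 mf fN m y Q1 u2 u2.
  rewrite -splitr => P.
  set A := K1 * _ * _ * _ * _ in L.
  have A0 : 0 <= A by rewrite !mulr_ge0 ?powR_ge0 ?(ltW (w0 _)).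
  have P2 : `|dheat m f u y| <= (u / 2) `^ (- nu / Q) * A.
    apply: (@ler_powR_inv _ _ _ Q) => //; first by rewrite mulr_ge0 ?powR_ge0.
    rewrite -lee_fin; apply: (le_trans P).
    have -> : ((u / 2) `^ (- nu / Q) * A) `^ Q = (u / 2) `^ (- nu) * A `^ Q.
      by rewrite powRM ?powR_ge0// -powRrM divfK ?gt_eqF.
    rewrite EFinM.
    apply: lee_pmul => //; rewrite ?lee_fin ?powR_ge0//.
      by apply: integral_ge0 => z _; rewrite lee_fin powR_ge0.
    apply: ler_powRN; [exact: u2| |exact: (ltW nu0)].
    by rewrite ler_peMl ?(ltW u2)//; have := @pi_ge2 R; lra.
  apply: (le_trans P2).
  have KE : K `^ theta = K1 * 2 `^ (m%:R + b) * B `^ theta.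
    rewrite /K powRM ?(ltW K20) ?(ltW B0)// /K2 -powRrM mulVf ?gt_eqF// powRr1//.
    by rewrite mulr_ge0 ?powR_ge0// ltW.
  rewrite /phi KE.
  rewrite (_ : _ * A = K1 * M `^ (1 - theta) * B `^ theta *
    ((u / 2) `^ (- nu / Q) * (u / 2) `^ (nu / Q - m%:R)) * blowup_weight b a (u / 2)); last first.
    by rewrite /A; ring.
  rewrite -powRD; last by rewrite [X in _ ==> ~~ X]gt_eqF ?implybT.
  rewrite (_ : - nu / Q + _ = - m%:R); last by ring.
  rewrite [leRHS](_ : _ = K1 * M `^ (1 - theta) * B `^ theta *
    (2 `^ (m%:R + b) * (u `^ (- m%:R) * blowup_weight b a u))); last by ring.
  rewrite -[leLHS]mulrA ler_wpM2l ?mulr_ge0 ?powR_ge0 ?(ltW K10)//.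
  apply: (@le_trans _ _ ((2 `^ m%:R * u `^ (- m%:R)) * (2 `^ b * blowup_weight b a u))).
    rewrite ler_pM ?powR_ge0 ?(ltW (w0 _))//; last exact: blowup_weight_half.
    rewrite powRM ?(ltW u0)// mulrC ler_wpM2r ?powR_ge0//.
    by rewrite -(powR_inv1 (ler0n R 2)) -powRrM mulN1r opprK.
  by rewrite powRD ?[X in _ ==> ~~ X]gt_eqF ?implybT// le_eqVlt; apply/orP; left; apply/eqP; ring.
have [M [M0 gM Mphi]] := self_improving_bound (exist _ h h0, x) g0 bdd step.
have MK : M <= K.
  have [->|Mn0] := eqVneq M 0; first by rewrite mulr_ge0 ?(ltW K20) ?(ltW B0).
  have Mp : 0 < M by rewrite lt_neqAle eq_sym Mn0.
  apply: (@ler_powR_inv _ _ _ theta) => //; first by rewrite mulr_ge0 ?(ltW K20) ?(ltW B0).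
  rewrite -(ler_pM2r (powR_gt0 (1 - theta) Mp)) -powRD ?subrKC ?oner_eq0//.
  by rewrite powRr1.
have := gM (exist _ h h0, x); rewrite /g/= ler_pdivrMr ?den// => /le_trans; apply.
by rewrite -[leRHS]mulrA ler_wpM2r// ltW// den.
Qed.

(** The weight equals 2 for a = h. *)
Lemma Lp_le_bootstrap : exists C : R, 0 < C /\ forall f N B, 0 <= N -> 0 < B ->
  measurable_fun setT f -> Lp_le mu p f N -> sparse_Lp_le f B ->
  forall h, 0 < h -> Lp_le mu Q (dheat m f h) (C * B * h `^ (nu / Q - m%:R)).
Proof.
have K20 : 0 < K2 by rewrite powR_gt0 ?mulr_gt0 ?powR_gt0.
exists (2 * K1 * K2 `^ (1 - theta)); split.
  by rewrite mulr_gt0 ?powR_gt0// mulr_gt0.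
move=> f N B N0 B0 mf fN HB h h0.
have M0 : 0 <= K2 * B by rewrite mulr_ge0 ?(ltW K20) ?(ltW B0).
have := Lp_le_of_sup N0 B0 M0 h0 mf fN HB (fun u x u0 => dheat_sup_bootstrap N0 B0 mf fN HB x u0 h0) h0.
congr (Lp_le mu Q _ _).
rewrite /blowup_weight divff ?gt_eqF// powR1 powRM ?(ltW K20) ?(ltW B0)//.
rewrite (_ : K1 * _ * _ * _ * _ = 2 * K1 * K2 `^ (1 - theta) *
  (B `^ (1 - theta) * B `^ theta) * h `^ (nu / Q - m%:R)); last by ring.
by rewrite -powRD subrK ?oner_eq0// powRr1// ltW.
Qed.

End sup_bound.

(** The L^Q norm F(h) of the k-th derivative satisfies F(h) <= F(2 h) + h G(h), where
    G bounds the next derivative. The weighted supremum of F(h) h^(k - nu/Q) is finite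
    by [Lp_le_dheat] and satisfies M <= 2^(nu/Q - k) M + D; the factor is less than 1.
    The weight again serves only to make the supremum finite. *)
Lemma dheat_descent k (p Q N D : R) f : 1 < p -> p <= Q -> nu / Q < k%:R -> 0 <= D ->
  0 <= N -> measurable_fun setT f -> Lp_le mu p f N ->
  (forall h, 0 < h -> Lp_le mu Q (dheat k.+1 f h) (D * h `^ (nu / Q - k.+1%:R))) ->
  forall h, 0 < h -> Lp_le mu Q (dheat k f h)
    (2 * (D / (1 - 2 `^ (nu / Q - k%:R))) * h `^ (nu / Q - k%:R)).
Proof.
move=> p1 pQ kQ D0 N0 mf fN HD h h0.
have Q1 : 1 < Q by lra.
have Q0 : 0 < Q by lra.
have fp := le_lt_trans fN (ltry _).
have [C [C0 HC]] := Lp_le_dheat k p1 pQ.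
pose b := nu / p; have b0 : 0 <= b by rewrite divr_ge0 ?(ltW nu0)//; lra.
pose e := nu / Q - k%:R; have e0 : e < 0 by rewrite subr_lt0.
pose nrm (u : R) := fine ('N[mu]_Q%:E [EFin \o dheat k f u]).
have nrmE u : 0 < u -> ('N[mu]_Q%:E [EFin \o dheat k f u] = (nrm u)%:E)%E.
  move=> u0; rewrite /nrm fineK// ge0_fin_numE ?Lnorm_ge0//.
  have /(Lp_leP mu) := HC f N N0 mf fN u u0.
  by move=> /(_ Q0) H; apply: le_lt_trans (H _) (ltry _); rewrite !mulr_ge0 ?powR_ge0 ?(ltW C0).
have nrm0 u : 0 <= nrm u by rewrite fine_ge0 ?Lnorm_ge0.
have nrm_Lp u A : 0 < u -> 0 <= A -> Lp_le mu Q (dheat k f u) A -> nrm u <= A.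
  by move=> u0 A0 /(Lp_leP _ _ Q0 A0); rewrite nrmE.
have Lp_nrm u A : 0 < u -> 0 <= A -> nrm u <= A -> Lp_le mu Q (dheat k f u) A.
  by move=> u0 A0 H; apply/Lp_leP => //; rewrite nrmE.
have w1 u := blowup_weight_ge1 b h u.
have w0 u : 0 < blowup_weight b h u by rewrite (lt_le_trans ltr01).
have den (u : R) : 0 < u -> 0 < u `^ e * blowup_weight b h u.
  by move=> u0; rewrite mulr_gt0 ?powR_gt0.
pose g (z : {u : R | 0 < u}) := nrm (sval z) / (sval z `^ e * blowup_weight b h (sval z)).
have g0 z : 0 <= g z by rewrite divr_ge0// ltW// den// (svalP z).
have bdd : exists M, forall z, g z <= M.
  exists (C * N * h `^ (- b)) => -[u u0]; rewrite /g/= ler_pdivrMr ?den//.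
  apply: (@le_trans _ _ (C * u `^ (nu / Q - k%:R - nu / p) * N)).
    by apply: nrm_Lp => //; [rewrite !mulr_ge0 ?powR_ge0 ?(ltW C0)|exact: HC].
  rewrite -/e -/b powRD; last by rewrite [X in _ ==> ~~ X]gt_eqF ?implybT.
  rewrite (_ : C * _ * N = C * N * u `^ e * u `^ (- b)); last by ring.
  rewrite (_ : C * N * h `^ _ * _ = C * N * u `^ e *
    (h `^ (- b) * blowup_weight b h u)); last by ring.
  by rewrite ler_wpM2l ?mulr_ge0 ?powR_ge0 ?(ltW C0)// blowup_weight_dom.
pose phi M := 2 `^ e * M + D.
have step M : 0 <= M -> (forall z, g z <= M) -> forall z, g z <= phi M.
  move=> M0 gM [u u0]; rewrite /g/= ler_pdivrMr ?den//.
  have u2 : 0 < 2 * u by rewrite mulr_gt0.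
  have HM v : 0 < v -> nrm v <= M * (v `^ e * blowup_weight b h v).
    move=> v0; have := gM (exist _ v v0).
    by rewrite /g/= ler_pdivrMr ?den.
  have A0 : 0 <= M * ((2 * u) `^ e * blowup_weight b h (2 * u)).
    by rewrite mulr_ge0// ltW// den.
  have B0 : 0 <= D * u `^ (nu / Q - k.+1%:R) by rewrite mulr_ge0 ?powR_ge0.
  have := dheat_doubling p1 N0 mf fN Q1 u0 A0 B0 (Lp_nrm _ _ u2 A0 (HM _ u2)) (HD u u0).
  move=> /(nrm_Lp _ _ u0 (addr_ge0 A0 (mulr_ge0 (ltW u0) B0))) => /le_trans; apply.
  rewrite /phi [leRHS]mulrDl; apply: lerD.
    rewrite powRM ?(ltW u0)//.
    rewrite (_ : 2 `^ e * M * _ = M * (2 `^ e * u `^ e * blowup_weight b h u)); last by ring.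
    rewrite ler_wpM2l// ler_wpM2l ?mulr_ge0 ?powR_ge0//.
    by apply: blowup_weight_le => //; lra.
  rewrite mulrCA (_ : nu / Q - k.+1%:R = e - 1); last by rewrite /e -natr1; ring.
  rewrite powRB ?powRr1 ?(ltW u0)//; last by rewrite [X in _ ==> ~~ X]gt_eqF ?implybT.
  by rewrite ler_wpM2l// mulrC divfK ?gt_eqF// ler_peMr ?powR_ge0 ?w1.
have [M [M0 gM Mphi]] := self_improving_bound (exist _ h h0) g0 bdd step.
have q1 : 2 `^ e < 1.
  by rewrite powR_expR// expR_lt1 nmulr_rlt0// ln_gt0// ltr1n.
have MD : M <= D / (1 - 2 `^ e).
  by rewrite ler_pdivlMr ?subr_gt0// mulrBr mulr1 lerBlDr addrC [M * _]mulrC.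
have D1 : 0 <= D / (1 - 2 `^ e) by rewrite divr_ge0 ?subr_ge0// ltW.
apply: Lp_nrm => //; first by rewrite mulr_ge0 ?powR_ge0// mulr_ge0.
have := gM (exist _ h h0); rewrite /g/= ler_pdivrMr ?den// => /le_trans; apply.
rewrite /blowup_weight divff ?gt_eqF// powR1.
rewrite (_ : M * _ = 2 * M * h `^ e); last by ring.
by rewrite ler_wpM2r ?powR_ge0// ler_wpM2l.
Qed.

(** For k = 0 the exponent nu / Q is positive, so the increments over [h, 2 h] sum up
    towards h = 0: along h = T / 2^j the bounds increase to the stated one, and
    [Lp_le_heat_limit] passes to f itself. *)
Lemma heat_backward (p Q N A D T : R) f : 1 < p -> 1 < Q -> 0 <= D -> 0 <= A ->
  0 <= N -> measurable_fun setT f -> Lp_le mu p f N -> 0 < T ->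
  (forall h, 0 < h -> Lp_le mu Q (dheat 1 f h) (D * h `^ (nu / Q - 1))) ->
  Lp_le mu Q (dheat 0 f T) A ->
  Lp_le mu Q f (A + D / (2 `^ (nu / Q) - 1) * T `^ (nu / Q)).
Proof.
move=> p1 Q1 D0 A0 N0 mf fN T0 HD HA; have Q0 : 0 < Q by lra.
set s := nu / Q; have s0 : 0 < s by rewrite divr_gt0.
have q1 : 1 < 2 `^ s by rewrite powR_expR// expR_gt1 mulr_gt0// ln_gt0// ltr1n.
set D' := D / _; have D'0 : 0 <= D' by rewrite divr_ge0// subr_ge0 ltW.
pose t j : R := T / 2 ^+ j.
have t0 j : 0 < t j by rewrite divr_gt0 ?exprn_gt0.
have tT j : t j <= T by rewrite ler_pdivrMr ?exprn_gt0// ler_peMr ?(ltW T0)// exprn_ege1// ler1n.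
have sub0 j : 0 <= D' * (T `^ s - t j `^ s).
  by rewrite mulr_ge0// subr_ge0 ge0_ler_powR ?nnegrE ?(ltW T0) ?(ltW (t0 _)) ?(ltW s0).
have H j : Lp_le mu Q (dheat 0 f (t j)) (A + D' * (T `^ s - t j `^ s)).
  elim: j => [|j IH]; first by rewrite /t expr0 divr1 subrr mulr0 addr0.
  have tj : t j = 2 * t j.+1 by rewrite /t exprS; field; rewrite expf_neq0.
  have B0 : 0 <= D * t j.+1 `^ (s - 1) by rewrite mulr_ge0 ?powR_ge0.
  rewrite tj in IH.
  have IH0 : 0 <= A + D' * (T `^ s - (2 * t j.+1) `^ s) by rewrite -tj addr_ge0.
  have := dheat_doubling p1 N0 mf fN Q1 (t0 _) IH0 B0 IH (HD _ (t0 _)).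
  congr (Lp_le mu Q _ _).
  rewrite powRB ?powRr1 ?(ltW (t0 _))//; last by rewrite [X in _ ==> ~~ X]gt_eqF ?implybT.
  rewrite powRM ?(ltW (t0 _))//.
  rewrite (_ : t j.+1 * _ = D * t j.+1 `^ s); last by field; rewrite gt_eqF.
  rewrite (_ : D = D' * (2 `^ s - 1)); first by ring.
  by rewrite /D' divfK// subr_eq0 gt_eqF.
have L0 : 0 <= A + D' * T `^ s by rewrite addr_ge0// mulr_ge0 ?powR_ge0.
apply: (Lp_le_heat_limit p1 mf fN Q1 L0) => delta d0.
pose j := (Num.truncn (T / delta)).+1.
exists (t j); split => //.
  rewrite ler_pdivrMr ?exprn_gt0// -ler_pdivrMl// mulrC.
  apply: (le_trans (ltW (truncnS_gt _))).
  by rewrite -natrX ler_nat ltnW// ltn_expl.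
apply: Lp_leW (H j); rewrite ?(ltW Q0) ?addr_ge0//.
by rewrite lerD2l ler_wpM2l// gerBl powR_ge0.
Qed.

End bootstrap.

(** * The inequality for functions with sparse bounds *)

Section core.
Variables (R : realType) (n m : nat).
Let nu : R := n%:R / 2.
Local Notation mu := (lebesgue_tuple R n).

Lemma powR_ratio (N B a : R) : 0 < N -> 0 < B ->
  (N / B) `^ a * B = B `^ (1 - a) * N `^ a.
Proof.
move=> N0 B0; rewrite powRM ?invr_ge0 ?(ltW N0) ?(ltW B0)//.
rewrite -(powR_inv1 (ltW B0)) -powRrM powRB; last first.
  by rewrite [X in _ ==> ~~ X]gt_eqF ?implybT.
by rewrite powRr1 ?(ltW B0)// mulN1r powRN; ring.
Qed.

(** One of the two terms suffices, according to whether y > B or y <= B. *)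
Lemma powR_le_two_powers (y B p q Q : R) : 0 <= y -> 0 < B -> 0 < p -> p <= q -> q <= Q ->
  y `^ q <= B `^ (q - p) * y `^ p + B `^ (q - Q) * y `^ Q.
Proof.
move=> y0 B0 p0 pq qQ.
have [->|yn0] := eqVneq y 0.
  rewrite powR0 ?gt_eqF ?(lt_le_trans p0)//.
  by rewrite addr_ge0// mulr_ge0 ?powR_ge0.
have yp : 0 < y by rewrite lt_neqAle eq_sym yn0.
have D a c : y `^ (a + c) = y `^ a * y `^ c.
  by rewrite powRD// [X in _ ==> ~~ X]gt_eqF ?implybT.
have [yB|By] := leP y B.
  rewrite ler_wpDr ?mulr_ge0 ?powR_ge0// -{1}(subrK p q) D.
  by rewrite ler_wpM2r ?powR_ge0// ge0_ler_powR ?nnegrE ?subr_ge0// ltW.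
rewrite ler_wpDl ?mulr_ge0 ?powR_ge0// -{1}(subrK Q q) D.
rewrite ler_wpM2r ?powR_ge0// -(opprB Q) ler_powRN ?subr_ge0//; exact: ltW.
Qed.

(** The exponent Q is so large that nu / Q < 1, which lets the descent reach the
    first derivative. Then ||f||_Q <= ||P_T f||_Q + C B T^(nu/Q), where the first term
    is at most C N T^(nu/Q - nu/p); T = (N / B)^(p / nu) makes both equal to a multiple
    of B^(1 - p/Q) N^(p/Q). The exponent q lies between p and Q. *)
Lemma Lp_le_of_sparse (p q r : R) : (0 < n)%N -> 1 < p -> p < q -> 0 < r ->
  nu / r < m%:R ->
  exists C : R, 0 < C /\ forall f N B, 0 < N -> 0 < B ->
    measurable_fun setT f -> Lp_le mu p f N -> sparse_Lp_le r m f B ->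
    Lp_le mu q f (C * B `^ (1 - p / q) * N `^ (p / q)).
Proof.
move=> n0 p1 pq r0 m_large.
have n1 : 1 <= n%:R :> R by rewrite ler1n.
have nu0 : 0 < nu by rewrite /nu; lra.
(* anything above 1, r, q and nu would do *)
pose Q := q + r + n%:R.
have q0 : 0 < q by lra.
have Q1 : 1 < Q by rewrite /Q; lra.
have Q0 : 0 < Q by lra.
have rQ : r < Q by rewrite /Q; lra.
have pQ : p <= Q by rewrite /Q; lra.
have qQ : q <= Q by rewrite /Q; lra.
have nuQ : nu / Q < 1 by rewrite ltr_pdivrMr// /Q /nu; lra.
have m0 : (0 < m)%N.
  by rewrite -(ltr0n R); apply: le_lt_trans m_large; rewrite divr_ge0// ltW.
have descent j k : (0 < k)%N -> (k + j = m)%N ->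
    exists D : R, 0 < D /\ forall f N B, 0 < N -> 0 < B ->
    measurable_fun setT f -> Lp_le mu p f N -> sparse_Lp_le r m f B ->
    forall h, 0 < h -> Lp_le mu Q (dheat k f h) (D * B * h `^ (nu / Q - k%:R)).
  (* j counts the derivatives that are still to be removed from m *)
  elim: j k => [|j IH] k k0 kj.
    rewrite addn0 in kj; rewrite kj.
    have [D [D0 HD]] := Lp_le_bootstrap n0 p1 r0 rQ Q1 m_large.
    exists D; split => // f N B N0 B0; exact: HD (ltW N0) B0.
  have [D [D0 HD]] := IH k.+1 isT (etrans (addSnnS _ _) kj).
  have kQ : nu / Q < k%:R by rewrite (lt_le_trans nuQ)// ler1n.
  have q1 : 2 `^ (nu / Q - k%:R) < 1 :> R.
    by rewrite powR_expR// expR_lt1 pmulr_llt0 ?subr_lt0// ln_gt0// ltr1n.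
  exists (2 * (D / (1 - 2 `^ (nu / Q - k%:R)))); split.
    by rewrite mulr_gt0// divr_gt0// subr_gt0.
  move=> f N B N0 B0 mf fN HB h h0.
  have DB0 : 0 <= D * B by rewrite ltW// mulr_gt0.
  have := dheat_descent n0 p1 pQ kQ DB0 (ltW N0) mf fN (HD f N B N0 B0 mf fN HB) h0.
  by congr (Lp_le mu Q _ _); ring.
have [D [D0 HD]] := descent m.-1 1%N isT (etrans (add1n _) (prednK m0)).
have [C [C0 HC]] := @Lp_le_dheat R n 0 p Q p1 pQ.
have q1 : 1 < 2 `^ (nu / Q) :> R.
  by rewrite powR_expR// expR_gt1 mulr_gt0 ?(divr_gt0 nu0 Q0)// ln_gt0// ltr1n.
pose C3 := C + D / (2 `^ (nu / Q) - 1).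
have C30 : 0 < C3 by rewrite addr_gt0// divr_gt0// subr_gt0.
have LQ f N B : 0 < N -> 0 < B -> measurable_fun setT f -> Lp_le mu p f N ->
    sparse_Lp_le r m f B -> Lp_le mu Q f (C3 * (B `^ (1 - p / Q) * N `^ (p / Q))).
  move=> N0 B0 mf fN HB.
  pose T := (N / B) `^ (p / nu).
  have NB : 0 < N / B by rewrite divr_gt0.
  have T0 : 0 < T by rewrite powR_gt0.
  have A0 : 0 <= C * T `^ (nu / Q - 0%:R - nu / p) * N by rewrite !mulr_ge0 ?powR_ge0 ?ltW.
  have DB0 : 0 <= D * B by rewrite ltW// mulr_gt0.
  have := heat_backward n0 p1 Q1 DB0 A0 (ltW N0) mf fN T0 (HD f N B N0 B0 mf fN HB)
    (HC f N (ltW N0) mf fN T T0).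
  congr (Lp_le mu Q _ _).
  have E1 : T `^ (nu / Q) = (N / B) `^ (p / Q).
    by rewrite /T -powRrM; congr (_ `^ _); field; rewrite !gt_eqF.
  have E2 : T `^ (nu / Q - 0%:R - nu / p) * N = (N / B) `^ (p / Q) * B.
    rewrite /T -powRrM (_ : p / nu * _ = p / Q - 1); last first.
      by rewrite mulr0n subr0; field; rewrite !gt_eqF//; lra.
    rewrite powRB; last by rewrite [X in _ ==> ~~ X]gt_eqF ?implybT.
    by rewrite powRr1 ?(ltW NB)//; field; rewrite !gt_eqF.
  rewrite -mulrA E2 E1 -powR_ratio// /C3 mulrDl; congr (_ + _).
  by rewrite [_ `^ _ * B]mulrC; field; rewrite subr_eq0 gt_eqF.
exists ((1 + C3 `^ Q) `^ q^-1); split; first by rewrite powR_gt0// ltr_pwDl// powR_ge0.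
move=> f N B N0 B0 mf fN HB.
have mpow s : measurable_fun setT (fun x => (`|f x| `^ s)%:E).
  apply/measurable_EFinP; apply: (measurableT_comp (measurable_powR s)).
  exact: (measurableT_comp (@normr_measurable R setT)).
have fQ := LQ f N B N0 B0 mf fN HB.
rewrite /Lp_le.
apply: (@le_trans _ _ (\int[mu]_x ((B `^ (q - p))%:E * (`|f x| `^ p)%:E +
    (B `^ (q - Q))%:E * (`|f x| `^ Q)%:E))%E).
  apply: le_integral_nomeas => x _; first by rewrite lee_fin powR_ge0.
  rewrite -!EFinM -EFinD lee_fin powR_le_two_powers//; lra.
rewrite ge0_integralD//; first last.
- exact: measurable_funeM.
- by move=> x _; rewrite -EFinM lee_fin mulr_ge0 ?powR_ge0.
- exact: measurable_funeM.
- by move=> x _; rewrite -EFinM lee_fin mulr_ge0 ?powR_ge0.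
rewrite !ge0_integralZl ?lee_fin ?powR_ge0//.
apply: (@le_trans _ _ ((B `^ (q - p))%:E * (N `^ p)%:E +
    (B `^ (q - Q))%:E * ((C3 * (B `^ (1 - p / Q) * N `^ (p / Q))) `^ Q)%:E)%E).
  by apply: leeD; rewrite lee_wpmul2l ?lee_fin ?powR_ge0.
rewrite -!EFinM -EFinD lee_fin le_eqVlt; apply/orP; left; apply/eqP.
rewrite !powRM ?mulr_ge0 ?powR_ge0 ?(ltW C30) ?addr_ge0 ?powR_ge0//.
rewrite -!powRrM mulVf ?gt_eqF// powRr1 ?addr_ge0 ?powR_ge0//.
rewrite !divfK ?gt_eqF// (_ : (1 - p / Q) * Q = Q - p); last by field; rewrite gt_eqF.
rewrite (_ : (1 - p / q) * q = q - p); last by field; rewrite gt_eqF.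
have E : B `^ (q - p) = B `^ (q - Q) * B `^ (Q - p).
  rewrite -powRD; last by rewrite [X in _ ==> ~~ X]gt_eqF ?implybT.
  by congr (_ `^ _); ring.
by rewrite E; ring.
Qed.

End core.

(** * Sparse bounds from the two norms *)

Section norms.
Variables (R : realType) (n m : nat).
Let nu : R := n%:R / 2.
Local Notation mu := (lebesgue_tuple R n).
Variables (p r : R) (f : n.-tuple R -> R).
Hypotheses (p1 : 1 <= p) (r0 : 0 < r) (mf : measurable_fun setT f).
Hypothesis fp : (\int[mu]_x (`|f x| `^ p)%:E < +oo)%E.

Let half_smoothness : n%:R / r / 2 = nu / r :> R.
Proof. by rewrite /nu mulrAC. Qed.

(** For each x the maximal function dominates its value at time h, so here every time
    satisfies the bound, not just one per dyadic interval. *)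
Lemma sparse_triebel_lizorkin (B : R) : 0 < B ->
  (triebel_lizorkin_norm m (n%:R / r) r f < B%:E)%E -> sparse_Lp_le r m f B.
Proof.
move=> B0; rewrite /triebel_lizorkin_norm => XB h h0.
exists h; split; [lra|exact: lexx|].
have mD := measurable_dheat p1 mf fp m h0.
set c := h `^ (m%:R - nu / r); have c0 : 0 < c by exact: powR_gt0.
have H : (\int[mu]_x ((c * `|dheat m f h x|) `^ r)%:E <= (B `^ r)%:E)%E.
  apply: (@le_trans _ _ (\int[mu]_x (`|heat_maximal m (n%:R / r) f x| `^ r))%E).
    apply: le_integral_nomeas => x _; first by rewrite lee_fin powR_ge0.
    rewrite -poweR_EFin; apply: lee_poweR; first exact: ltW.
      by rewrite lee_fin mulr_ge0 ?powR_ge0.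
    apply: (le_trans _ (lee_abs _)); apply: ereal_sup_ubound.
    by exists h; rewrite /= ?in_itv/= ?h0 ?half_smoothness.
  rewrite -poweR_Lnorm ?gt_eqF// -poweR_EFin; apply: lee_poweR; first exact: ltW.
    exact: Lnorm_ge0.
  exact: ltW.
rewrite /Lp_le.
have -> : (\int[mu]_x (`|dheat m f h x| `^ r)%:E =
    \int[mu]_x ((c `^ r)^-1%:E * ((c * `|dheat m f h x|) `^ r)%:E))%E.
  apply: eq_integral => x _; rewrite -EFinM powRM ?(ltW c0)//.
  by rewrite mulKf// gt_eqF// powR_gt0.
have mc : measurable_fun setT (fun x => ((c * `|dheat m f h x|) `^ r)%:E).
  apply/measurable_EFinP; apply: (measurableT_comp (measurable_powR r)).
  apply: measurable_funM => //; exact: (measurableT_comp (@normr_measurable R setT)).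
rewrite ge0_integralZl ?lee_fin ?invr_ge0 ?powR_ge0//; last first.
  by move=> x _; rewrite lee_fin powR_ge0.
apply: (@le_trans _ _ ((c `^ r)^-1%:E * (B `^ r)%:E)%E).
  by rewrite lee_wpmul2l// lee_fin invr_ge0 powR_ge0.
rewrite -EFinM lee_fin powRM ?powR_ge0 ?(ltW B0)// mulrC ler_wpM2l ?powR_ge0//.
by rewrite /c -powRN -powRrM -powRrM -opprB mulrN mulNr opprK.
Qed.

(** If the bound failed at every t in [h/2, h], the integrand would be at least
    2 B^rho / h on this interval, of length h / 2, and the integral at least B^rho. *)
Lemma sparse_besov (rho B : R) : 0 < rho -> 0 < B ->
  (besov_norm m (n%:R / r) r%:E rho f < B%:E)%E ->
  sparse_Lp_le r m f (2 `^ rho^-1 * B).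
Proof.
move=> rho0 B0 XB h h0; apply: contrapT => nt.
(* a constant lower bound for the integrand on [h/2, h], whose integral is B^rho *)
pose c := (2 `^ rho^-1 * B) `^ rho / h.
have cE : c = 2 * B `^ rho / h.
  rewrite /c powRM ?powR_ge0 ?(ltW B0)// -powRrM mulVf ?gt_eqF// powRr1//.
have c0 : 0 <= c by rewrite divr_ge0 ?powR_ge0 ?ltW.
have XBr : (besov_norm m (n%:R / r) r%:E rho f `^ rho < (B `^ rho)%:E)%E.
  have X0 : (0 <= besov_norm m (n%:R / r) r%:E rho f)%E by exact: poweR_ge0.
  move: XB X0; case: (besov_norm _ _ _ _ _) => [x| |]//=; rewrite !lte_fin lee_fin => xB x0.
  by apply: gt0_ltr_powR; rewrite ?nnegrE ?(ltW B0).
move: XBr; apply/negP; rewrite -leNgt.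
rewrite /besov_norm -poweRrM mulVf ?gt_eqF// poweRe1; last first.
  apply: integral_ge0 => t; rewrite /= in_itv/= andbT => t0.
  by rewrite mule_ge0 ?lee_fin ?invr_ge0 ?(ltW t0)// mule_ge0 ?lee_fin ?powR_ge0 ?poweR_ge0.
apply: (@le_trans _ _ (\int[lebesgue_measure]_(t in `]0%R, +oo[)
    (c%:E * (\1_`[h / 2, h]%classic t)%:E))%E).
  rewrite ge0_integralZl ?lee_fin//.
  rewrite integral_indic//.
  rewrite (_ : `[h / 2, h]%classic `&` _ = `[h / 2, h]%classic); last first.
    apply/seteqP; split => t /=; rewrite !in_itv/=; first by case.
    by move=> /andP[t1 t2]; rewrite t1 t2 andbT; split => //; lra.
  rewrite [X in (_ * X)%E]lebesgue_measure_itv/= lte_fin ifT; last lra.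
  rewrite -EFinB -EFinM lee_fin cE.
  by rewrite (_ : _ * (h - h / 2) = B `^ rho)//; field; rewrite gt_eqF.
  by apply/measurable_EFinP; exact: measurable_indic.
apply: le_integral_nomeas => t /=; rewrite in_itv/= andbT => t0.
  by rewrite -EFinM lee_fin mulr_ge0.
have [|tI] := boolP (t \in `[h / 2, h]%classic); last first.
  rewrite indicE (negbTE tI) mule0.
  by rewrite mule_ge0 ?lee_fin ?invr_ge0 ?(ltW t0)// mule_ge0 ?lee_fin ?powR_ge0 ?poweR_ge0.
move=> tI; rewrite indicE tI mule1; move: tI; rewrite inE/= in_itv/= => /andP[t1 t2].
have K0 : 0 <= 2 `^ rho^-1 * B * t `^ (nu / r - m%:R).
  by rewrite !mulr_ge0 ?powR_ge0 ?(ltW B0).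
have big : ((2 `^ rho^-1 * B * t `^ (nu / r - m%:R))%:E <= Lpnorm r%:E (dheat m f t))%E.
  rewrite leNgt; apply/negP => /ltW small; apply: nt; exists t; split => //.
  exact/(Lp_leP _ _ r0 K0).
have := lee_poweR (ltW rho0) _ big; rewrite lee_fin => /(_ K0) bigr.
apply: (@le_trans _ _ (((t `^ ((m%:R - n%:R / r / 2) * rho))%:E *
   ((2 `^ rho^-1 * B * t `^ (nu / r - m%:R)) `^ rho)%:E) * (t^-1)%:E)%E).
  rewrite -!EFinM lee_fin [in leRHS]powRM ?mulr_ge0 ?powR_ge0 ?(ltW B0)//.
  rewrite -powRrM mulrC [X in _ * X]mulrC -[X in _ * X]mulrA -powRD; last first.
    by rewrite [X in _ ==> ~~ X]gt_eqF ?implybT.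
  have -> : (nu / r - m%:R) * rho + (m%:R - n%:R / r / 2) * rho = 0.
    by rewrite half_smoothness; ring.
  by rewrite powRr0 mulr1 mulrC ler_wpM2l ?powR_ge0// lef_pV2 ?posrE.
by rewrite lee_wpmul2r ?lee_fin ?invr_ge0 ?(ltW t0)// lee_wpmul2l ?lee_fin ?powR_ge0.
Qed.

End norms.

(** * From real bounds to the norms *)

Section limit.
Variable R : realType.
Implicit Types (C a b : R) (X Y Z : \bar R).
Local Open Scope ereal_scope.

(** B = 2 X and N = 2 Y are admissible when X and Y are positive and finite, and each
    power at most doubles the bound. If X = 0, then B is as small as wanted, hence so
    is Z; if X is infinite, so is the right-hand side. As 0 times infinity is 0, the
    case Y = 0 rests on the separate hypothesis. *)
Lemma le_of_forall_gt C a b X Y Z : (0 < C)%R -> (0 < a <= 1)%R -> (0 < b <= 1)%R ->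
  0 <= X -> 0 <= Y -> Y < +oo -> (Y = 0 -> Z = 0) ->
  (forall B N : R, X < B%:E -> Y < N%:E -> Z <= (C * B `^ a * N `^ b)%:E) ->
  Z <= (4 * C)%:E * X `^ a * Y `^ b.
Proof.
move=> C0 /andP[a0 a1] /andP[b0 b1] X0 Y0 Yoo YZ H.
have C4 : (0 < 4 * C)%R by rewrite mulr_gt0.
have [/eqP Ye|Yn0] := boolP (Y == 0).
  by rewrite (YZ Ye) mule_ge0 ?poweR_ge0// mule_ge0 ?poweR_ge0// lee_fin ltW.
have Yp : 0 < Y by rewrite lt_def Yn0.
case: Y Y0 Yoo YZ H Yp {Yn0} => [y| |]// _ _ _ H.
rewrite lte_fin => y0.
have yp : (0 < y `^ b)%R by exact: powR_gt0.
have two s c : (0 < s <= 1)%R -> (0 <= c)%R -> ((2 * c) `^ s <= 2 * c `^ s)%R.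
  move=> /andP[s0 s1] c0; rewrite powRM// ler_wpM2r ?powR_ge0//.
  by rewrite (le_trans (ler_powR _ s1)) ?ler1n// powRr1.
have y2 : (y%:E < (2 * y)%:E) by rewrite lte_fin; lra.
case: X X0 H => [x| |]// X0 H; last first.
  by rewrite poweRyr ?gt_eqF// gt0_muley ?lte_fin// gt0_mulye ?lte_fin// leey.
move: X0; rewrite lee_fin le_eqVlt => /orP[/eqP x0|x0]; last first.
  have x2 : (x%:E < (2 * x)%:E) by rewrite lte_fin; lra.
  apply: (le_trans (H _ _ x2 y2)).
  rewrite !poweR_EFin -!EFinM lee_fin.
  rewrite (_ : (4 * C * x `^ a * y `^ b = C * (2 * x `^ a) * (2 * y `^ b))%R); last by ring.
  have Cl := ltW C0.
  apply: ler_pM; rewrite ?mulr_ge0 ?powR_ge0//; last by rewrite two ?b0// ltW.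
  by rewrite ler_wpM2l// two ?a0// ltW.
rewrite -x0 in H *.
rewrite poweR_EFin powR0 ?gt_eqF// mule0 mul0e.
apply/lee_addgt0Pr => e e0; rewrite add0e.
have K0 : (0 < C * (2 * y) `^ b)%R by rewrite mulr_gt0 ?powR_gt0 ?mulr_gt0.
have E0 : (0 < e / (C * (2 * y) `^ b))%R by rewrite divr_gt0.
have B0 : 0 < ((e / (C * (2 * y) `^ b)) `^ a^-1)%:E by rewrite lte_fin powR_gt0.
apply: (le_trans (H _ _ B0 y2)).
rewrite lee_fin -powRrM mulVf ?gt_eqF// powRr1 ?(ltW E0)//.
by rewrite mulrAC mulrC divfK// gt_eqF.
Qed.

End limit.

Theorem mainTheorem7 (R : realType) (n m : nat) (p q r rho : R)
    (n_gt0 : (0 < n)%N) (p_gt1 : 1 < p) (p_lt_q : p < q)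
    (r_gt0 : 0 < r) (rho_gt0 : 0 < rho) (m_large : n%:R / r < 2 * m%:R) :
  exists c : R, 0 < c /\
    forall f : n.-tuple R -> R, f \in Lfun (lebesgue_tuple R n) p%:E ->
      (Lpnorm q%:E f <=
         c%:E * besov_norm m (n%:R / r) r%:E rho f `^ (1 - p / q)
              * Lpnorm p%:E f `^ (p / q))%E /\
      (Lpnorm q%:E f <=
         c%:E * triebel_lizorkin_norm m (n%:R / r) r f `^ (1 - p / q)
              * Lpnorm p%:E f `^ (p / q))%E.
Proof.
have p0 : 0 < p by lra.
have q0 : 0 < q by lra.
have r0 : 0 < r := r_gt0.
have m' : n%:R / 2 / r < m%:R by rewrite mulrAC ltr_pdivrMr// [ltRHS]mulrC.
have [C [C0 HC]] := Lp_le_of_sparse n_gt0 p_gt1 p_lt_q r_gt0 m'.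
have b01 : 0 < p / q <= 1 by rewrite divr_gt0//= ler_pdivrMr// mul1r ltW.
have a01 : 0 < 1 - p / q <= 1.
  by rewrite subr_gt0 ltr_pdivrMr// mul1r p_lt_q/= gerBl divr_ge0// ltW.
pose K : R := (2 `^ rho^-1) `^ (1 - p / q).
have K0 : 0 < K by rewrite !powR_gt0.
have CK0 : 0 < C * (1 + K) by rewrite mulr_gt0// addr_gt0.
exists (4 * (C * (1 + K))); split; first by rewrite mulr_gt0.
move=> f fL.
have mf : measurable_fun setT f.
  by have := sub_Lfun_mfun fL; rewrite inE.
have foo : (Lpnorm p%:E f < +oo)%E.
  by have := sub_Lfun_finLfun fL; rewrite inE.
have fp : (\int[lebesgue_tuple R n]_x (`|f x| `^ p)%:E < +oo)%E.
  have := poweR_lty p foo; rewrite /Lpnorm powR_Lnorm ?gt_eqF//; apply: le_lt_trans.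
have f0 : Lpnorm p%:E f = 0%E -> Lpnorm q%:E f = 0%E.
  have mEf : measurable_fun setT (EFin \o f) by exact/measurable_EFinP.
  move=> /(Lnorm_eq0_eq0 mEf) => /(_ p0) f_ae0.
  apply: (@poweR_eq0_eq0 _ _ q (Lnorm_ge0 _ _ _)).
  rewrite /Lpnorm powR_Lnorm ?gt_eqF//.
  transitivity (\int[lebesgue_tuple R n]_x (cst 0%E x : \bar R))%E; last exact: integral0.
  apply: ae_eq_integral => //.
    apply: (@measurableT_comp _ _ _ _ _ _ (fun x : \bar R => (x `^ q)%E)); first exact: measurable_poweR.
    exact: measurableT_comp.
  by apply: filterS f_ae0 => x /(_ I) -> _; rewrite abse0 poweR0r// gt_eqF.
have key (B N : R) : 0 < B -> sparse_Lp_le r m f B -> (Lpnorm p%:E f < N%:E)%E ->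
    (Lpnorm q%:E f <= (C * B `^ (1 - p / q) * N `^ (p / q))%:E)%E.
  move=> B0 HB YN.
  have N0 : 0 < N by rewrite -lte_fin (le_lt_trans _ YN)// Lnorm_ge0.
  apply/(Lp_leP _ _ q0); first by rewrite !mulr_ge0 ?powR_ge0// ltW.
  by apply: HC => //; apply/(Lp_leP _ _ p0); exact: ltW.
split; apply: le_of_forall_gt => //; rewrite ?Lnorm_ge0 ?poweR_ge0// => B N XB YN.
- have B0 : 0 < B by rewrite -lte_fin (le_lt_trans _ XB)// poweR_ge0.
  have HB := sparse_besov r_gt0 rho_gt0 B0 XB.
  apply: le_trans (key _ _ _ HB YN) _; first by rewrite mulr_gt0 ?powR_gt0.
  rewrite lee_fin ler_wpM2r ?powR_ge0// powRM ?powR_ge0 ?(ltW B0)// mulrA.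
  by rewrite ler_wpM2r ?powR_ge0// ler_wpM2l ?(ltW C0)// /K lerDr.
- have B0 : 0 < B by rewrite -lte_fin (le_lt_trans _ XB)// Lnorm_ge0.
  have HB := sparse_triebel_lizorkin (ltW p_gt1) r_gt0 mf fp B0 XB.
  apply: le_trans (key _ _ B0 HB YN) _.
  rewrite lee_fin ler_wpM2r ?powR_ge0// ler_wpM2r ?powR_ge0//.
  by rewrite ler_peMr ?(ltW C0)// lerDl ltW.
Qed.
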